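(* For each $n\ge2$ let $W_n$ be one of the groups $S_n,B_n,D_n$, and let $d=d(n)\in\{1,\dots,d_{\max}-1\}$ satisfy $\sqrt n=o(d)$. Let $k_n\to\infty$ be positive integers with $k_n\log(k_n)=o(d^2/n)$, let $(X_{nj})_{j=1,\dots,k_n}$ be a row-wise i.i.d. triangular array with $X_{n1}$ distributed as $X_{\mathrm{inv}}^{(d)}$ on $W_n$, and let $M_n=\max\{X_{n1},\dots,X_{nk_n}\}$. Let $\sigma_n=\sqrt{\mathrm{Var}(X_{\mathrm{inv}}^{(d)})}$, $a_n=\sigma_n\alpha_{k_n}$ and $b_n=\sigma_n\beta_{k_n}+\mathbb E\bigl(X_{\mathrm{inv}}^{(d)}\bigr)$. Then for all $x\in\mathbb R$, $$\mathbb P(M_n\le a_nx+b_n)\longrightarrow\exp(-\exp(-x))\qquad(n\to\infty).$$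
   Context: For an integer $k\ge2$, $\alpha_k=\frac1{\sqrt{2\log k}}$ and $\beta_k=\frac1{\alpha_k}-\frac12\alpha_k\bigl(\log\log k+\log(4\pi)\bigr)$. Set $d_{\max}=n$ for $S_n$, $d_{\max}=2n$ for $B_n$, $d_{\max}=2n-2$ for $D_n$. Let $Z_1,\dots,Z_n$ be i.i.d., uniform on $(0,1)$ for $S_n$ and uniform on $(-1,1)$ for $B_n$, $D_n$. For an integer $d\ge1$ let $$\mathfrak N_{n,d}=\{(i,j)\in\{1,\dots,n\}^2:1\le j-i\le d\},\qquad \widetilde{\mathfrak N}_{n,d}=\{(i,j)\in\{1,\dots,n\}^2:i<j,\ i+j\le d\}.$$ For $1\le d\le d_{\max}-1$ define $X_{\mathrm{inv}}^{(d)}=\sum_{(i,j)\in\mathfrak N_{n,d}}\mathbf 1\{Z_i>Z_j\}$ on $S_n$; $X_{\mathrm{inv}}^{(d)}=\sum_{(i,j)\in\mathfrak N_{n,d}}\mathbf 1\{Z_i>Z_j\}+\sum_{(i,j)\in\widetilde{\mathfrak N}_{n,d}}\mathbf 1\{-Z_i>Z_j\}+\sum_{i=1}^{\min(n,d)}\mathbf 1\{Z_i<0\}$ on $B_n$; $X_{\mathrm{inv}}^{(d)}=\sum_{(i,j)\in\mathfrak N_{n,d}}\mathbf 1\{Z_i>Z_j\}+\sum_{(i,j)\in\widetilde{\mathfrak N}_{n,d+2}}\mathbf 1\{-Z_i>Z_j\}$ on $D_n$. *)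

(* Defs.v *)
From HB Require Import structures.
From mathcomp Require Import all_boot all_order all_algebra.
From mathcomp Require Import all_classical all_reals all_analysis measurable_realfun.

Set Implicit Arguments.
Unset Strict Implicit.
Unset Printing Implicit Defensive.

Import Order.TTheory GRing.Theory Num.Theory.
Import numFieldNormedType.Exports.

Local Open Scope classical_set_scope.
Local Open Scope ring_scope.

Definition alpha {R : realType} (k : nat) : R := (Num.sqrt (2 * ln k%:R))^-1.

Definition beta {R : realType} (k : nat) : R :=
  (alpha k)^-1 - 2^-1 * alpha k * (ln (ln k%:R) + ln (4 * pi)).

(* The families S_n, B_n and D_n. *)
Inductive weyl_family := WeylS | WeylB | WeylD.

Definition dmax (W : weyl_family) (n : nat) : nat :=
  match W with
  | WeylS => n
  | WeylB => 2 * n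
  | WeylD => 2 * n - 2
  end.

(* Elements of 'I_n count from 0: i : 'I_n stands for the index i.+1 of
   {1, ..., n}. *)
Definition Npairs (n d : nat) : {set 'I_n * 'I_n} :=
  [set p : 'I_n * 'I_n | (1 <= p.2 - p.1 <= d)%N].

Definition Ntpairs (n d : nat) : {set 'I_n * 'I_n} :=
  [set p : 'I_n * 'I_n | (p.1 < p.2)%N && (p.1.+1 + p.2.+1 <= d)%N].

Section inversion_statistic.
Context {R : realType}.

Definition inv_stat (W : weyl_family) (n d : nat) (z : 'I_n -> R) : R :=
  let plain := \sum_(p in Npairs n d) (z p.1 > z p.2)%R%:R in
  match W with
  | WeylS => plain
  | WeylB => plain + \sum_(p in Ntpairs n d) (- z p.1 > z p.2)%R%:R
                  + \sum_(i < n | (i < minn n d)%N) (z i < 0)%R%:R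
  | WeylD => plain + \sum_(p in Ntpairs n d.+2) (- z p.1 > z p.2)%R%:R
  end.

Context {dT : measure_display} {T : measurableType dT} {P : probability T R}.

Definition Xinv (W : weyl_family) (n d : nat) (Z : 'I_n -> {RV P >-> R}) : T -> R :=
  fun t => inv_stat W d (fun i => Z i t).

Let measurable_ltR (f g : T -> R) : measurable_fun setT f ->
  measurable_fun setT g -> measurable_fun setT (fun t => (f t < g t)%R%:R : R).
Proof.
move=> mf mg.
apply: (@measurableT_comp _ _ _ _ _ _ (fun b : bool => b%:R : R)) => //.
exact: measurable_fun_ltr.
Qed.

Let measurable_sum_cond (I : finType) (D : pred I) (h : I -> T -> R) :
  (forall i, measurable_fun setT (h i)) ->
  measurable_fun setT (fun t => \sum_(i | D i) h i t).
Proof.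
move=> mh; under eq_fun do rewrite big_mkcond.
by apply: measurable_sum => i; case: (D i).
Qed.

Let measurable_Xinv W n d Z : measurable_fun setT (@Xinv W n d Z).
Proof.
have mplain (D : {set 'I_n * 'I_n}) : measurable_fun setT
    (fun t => \sum_(p in D) (Z p.1 t > Z p.2 t)%R%:R : R).
  by apply: measurable_sum_cond => p; exact: measurable_ltR.
have mtilde (D : {set 'I_n * 'I_n}) : measurable_fun setT
    (fun t => \sum_(p in D) (- Z p.1 t > Z p.2 t)%R%:R : R).
  apply: measurable_sum_cond => p; apply: measurable_ltR => //.
  exact: measurableT_comp.
rewrite /Xinv /inv_stat; case: W => //.
- apply: measurable_funD; first exact: measurable_funD.
  by apply: measurable_sum_cond => i; exact: measurable_ltR.
- exact: measurable_funD.
Qed.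

HB.instance Definition _ W n d Z :=
  @isMeasurableFun.Build _ _ T R (@Xinv W n d Z) (@measurable_Xinv W n d Z).

End inversion_statistic.

(* Measures are set functions on all of set R, hence the restriction to
   measurable sets when two laws are compared. *)
Definition same_law {R : realType} (mu nu : set R -> \bar R) : Prop :=
  forall A, measurable A -> mu A = nu A.

Definition mutually_independent {R : realType} {dT : measure_display}
    {T : measurableType dT} {P : probability T R} {I : finType}
    (X : I -> {RV P >-> R}) : Prop :=
  forall (J : {set I}) (A : I -> set R), (forall i, measurable (A i)) ->
    P (\bigcap_(i in [set` J]) (X i @^-1` A i)) =
    (\prod_(i in J) P (X i @^-1` A i))%E.

Definition iid_with_law {R : realType} {dT : measure_display}
    {T : measurableType dT} {P : probability T R} {I : finType}
    (X : I -> {RV P >-> R}) (mu : set R -> \bar R) : Prop :=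
  mutually_independent X /\ forall i, same_law (distribution P (X i)) mu.

Definition Zlow {R : realType} (W : weyl_family) : R :=
  if W is WeylS then 0 else -1.

Lemma Zlow_lt1 {R : realType} (W : weyl_family) : Zlow W < 1 :> R.
Proof. by case: W => /=; rewrite ?ltr01 ?ltrN10 ?(lt_trans (ltrN10 _)). Qed.

(* The maximum is taken in \bar R, where -oo is neutral; it is the usual
   maximum as soon as k > 0. *)
Definition row_max {R : realType} {T : Type} (k : nat) (X : 'I_k -> T -> R)
    (t : T) : \bar R :=
  (\big[maxe/-oo]_(j < k) (X j t)%:E)%E.

(* Main.v *)
(** Write [Y - E Y = S + Rm] where [S] is the Hajek projection, a weighted sum
    of the independent variables [F(Z_i) - 1/2] with [F] the distribution
    function of [Z_i], and [Rm] is a sum of degenerate kernels. Degenerate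
    kernels attached to distinct pairs are orthogonal, so [E Rm^2 = O(n d)],
    whereas [Var S] is of order at least [d^3]. Hence at the extremal scale
    Chebyshev's inequality makes the contribution of [Rm] to [k P(Y > b + a x)]
    of order [k (log k) n / d^2], which tends to [0] by hypothesis.

    For [S] a tail estimate with relative precision is needed. Lindeberg's
    replacement is run against the test function [Phi ((x - w) / sqrt rho)], a
    solution of the heat equation, so that exchanging one summand for heat flow
    only leaves fourth-order terms (the third moments vanish). The fourth
    derivative in [x] of that function is bounded by an exponential
    [exp (theta x)], whose expectation along the partial sums is of Gaussian
    size; with [theta = sqrt (2 log k)] the error is [1 / k] times a power of
    [log k] over [d]. The asymptotics of the Gaussian tail then give
    [k P(Y > b + a x) -> exp (- x)], and independence of the row turns
    [(1 - p)^k] into the Gumbel limit. *)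
From HB Require Import structures.
Require Import Defs.
From mathcomp Require Import all_boot all_order all_algebra.
From mathcomp Require Import all_classical all_reals all_analysis measurable_realfun.
From mathcomp Require Import ring lra zify.

Import Order.TTheory GRing.Theory Num.Theory.
Import numFieldNormedType.Exports.

Local Open Scope classical_set_scope.
Local Open Scope ring_scope.

Set Implicit Arguments.
Unset Strict Implicit.
Unset Printing Implicit Defensive.

(** The probabilities at stake are of order [1 / k], so an absolute error of Berry-Esseen type is
    useless: every error has to be small against [1 / k]. Hence the exponential weight
    [exp (theta x)] in the replacement argument. Its Gaussian expectation is [exp (theta^2 / 2)],
    the threshold [u] divides it by [exp (theta u)], and for [theta] close to [u] the quotient is
    again the Gaussian size [1 / k], up to a power of [log k]. The normalisation uses the variance
    of the whole statistic and not that of its projection. The ratio of the two is [1 + O(tau)] with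
    [tau = sqrt n / d]. As the squared threshold is about [2 log k], this multiplies the tail by
    [exp (O(tau log k))], so [tau log k -> 0] is required; it follows from the assumed rate. The
    indicator is smoothed at standard deviation [1 / (2 log k)], far below the slack
    [eta / sqrt (2 log k)], which moves [x] by a multiple of [eta]. First [n] tends to infinity with
    [eta] fixed, then [eta] tends to [0]. *)

Section mean_value.
Context {R : realType}.
Implicit Types (f df : R -> R) (a b : R).

Lemma MVT_closed f df a b : a <= b ->
  (forall x, a <= x <= b -> is_derive x 1 f (df x)) ->
  exists2 c, a <= c <= b & f b - f a = df c * (b - a).
Proof.
move=> ab dfE.
have [||c cab E] := @MVT_segment R f df a b ab.
- by move=> x xab; apply: dfE; rewrite !ltW ?(itvP xab).
- apply: derivable_within_continuous => x xab.
  by apply: ex_derive; apply: dfE; rewrite !(itvP xab).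
- by exists c => //; rewrite !(itvP cab).
Qed.

Lemma is_derive_inv (x : R) : x != 0 -> is_derive x 1 (fun y => y^-1) (- x ^- 2).
Proof.
by move=> x0; have := is_deriveV x0 (is_derive_id x 1); rewrite /GRing.scale /= mulr1.
Qed.

(** Reduces each Mills-ratio inequality to the sign of a derivative: the difference of the two sides
    vanishes at infinity. *)
Lemma nonincreasing_cvg0_ge0 f df a :
  (forall x, a <= x -> is_derive x 1 f (df x)) ->
  (forall x, a <= x -> df x <= 0) -> f x @[x --> +oo] --> (0 : R) -> 0 <= f a.
Proof.
move=> dfE df0 f0; apply: (cvgr_to_le f0); near=> y.
have ay : a <= y by near: y; apply: nbhs_pinfty_ge; exact: num_real.
have [x /andP[ax xy]|c /andP[ac _] E] := @MVT_closed f df a y ay; first exact: dfE.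
by rewrite -subr_le0 E; apply: mulr_le0_ge0; rewrite ?df0 ?subr_ge0.
Unshelve. all: by end_near. Qed.

End mean_value.

(** * The standard normal distribution function and its Mills ratio *)

Section gaussian_cdf.
Context {R : realType}.
Implicit Types x z : R.

Definition gpdf x : R := (Num.sqrt (2 * pi))^-1 * expR (- x ^+ 2 / 2).

Definition Phi x : R := fine (normal_prob 0 (1 : R) `]-oo, x]).

Lemma gpdfE : gpdf = normal_pdf 0 1.
Proof.
apply/funext => x; rewrite /normal_pdf oner_eq0 /normal_peak /normal_fun /gpdf.
by rewrite subr0 !expr1n mul1r -[pi *+ 2]mulr_natl.
Qed.

Lemma gpdf_gt0 x : 0 < gpdf x.
Proof. by rewrite mulr_gt0 ?expR_gt0// invr_gt0 sqrtr_gt0 mulr_gt0 ?pi_gt0. Qed.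

Lemma gpdf_even x : gpdf (- x) = gpdf x.
Proof. by rewrite /gpdf sqrrN. Qed.

Lemma continuous_gpdf : continuous gpdf.
Proof. by rewrite gpdfE; apply: continuous_normal_pdf; rewrite oner_neq0. Qed.

Lemma is_derive_Phi x : is_derive x 1 Phi (gpdf x).
Proof.
have xx1 : x < x + 1 by rewrite ltrDl.
have ig : lebesgue_measure.-integrable [set` Interval -oo%O (BRight (x + 1))] (EFin \o gpdf).
  by rewrite gpdfE; apply: (@integrableS _ _ _ _ setT) => //; exact: integrable_normal_pdf.
have := continuous_FTC1 xx1 ig (ltNyr _) (continuous_gpdf (x := x)).
have -> : (fun y : R => \int[lebesgue_measure]_(t in [set` Interval -oo%O (BRight y)]) gpdf t) = Phi.
  by apply/funext => y; rewrite gpdfE.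
by case=> d0 d1; apply: DeriveDef => //; rewrite -derive1E.
Qed.

(** The identity, viewed as a random variable under the normal law, has [Phi] as distribution
    function, whence the limits of [Phi] at both infinities. *)
Let idTR : measurableTypeR R -> R := idfun.
#[local] HB.instance Definition _ :=
  @isMeasurableFun.Build _ _ _ _ idTR (@measurable_id _ _ setT).

Lemma Phi_cvgy : Phi x @[x --> +oo] --> (1 : R).
Proof. by apply: fine_cvg; have := @cvg_cdfy1 _ _ _ (normal_prob 0 1) idTR; exact. Qed.

Lemma Phi_cvgNy : Phi x @[x --> -oo] --> (0 : R).
Proof. by apply: fine_cvg; have := @cvg_cdfNy0 _ _ _ (normal_prob 0 1) idTR; exact. Qed.

Lemma Phi_ge0 x : 0 <= Phi x.
Proof. by rewrite fine_ge0. Qed.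

Lemma Phi_le1 x : Phi x <= 1.
Proof. by rewrite -lee_fin fineK ?probability_le1// fin_num_measure. Qed.

(** The density is even, so [Phi t + Phi (- t)] has derivative zero; its limit at infinity
    identifies the constant. *)
Lemma PhiN x : Phi (- x) = 1 - Phi x.
Proof.
pose f t := Phi t + Phi (- t).
have df (t : R) : is_derive t 1 f 0.
  have H1 := is_derive_Phi t; have H2 := is_derive_Phi (- t).
  have -> : 0 = gpdf t + gpdf (- t) * -1 by rewrite gpdf_even mulrN1 subrr.
  by apply: is_deriveD; apply: is_derive1_comp.
have fE : f x = 1.
  have : f t @[t --> +oo] --> (1 + 0 : R).
    apply: cvgD; first exact: Phi_cvgy.
    by have := Phi_cvgNy; rewrite cvgNy_compNP.
  rewrite addr0 => /cvg_lim <- //.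
  apply/esym/cvg_lim => //.
  rewrite [X in X @ _ --> _](_ : _ = cst (f x)); first exact: cvg_cst.
  by apply/funext => t; exact: is_derive_0_is_cst.
by rewrite -fE /f addrC addKr.
Qed.

Lemma is_derive_gpdf x : is_derive x 1 gpdf (- x * gpdf x).
Proof.
rewrite /gpdf; apply: is_derive_eq.
rewrite /GRing.scale /= !mulr0 ?add0r ?addr0.
by set c := _^-1; set e := expR _; field.
Qed.

Lemma gpdf_le_expR x : gpdf x <= expR (- x ^+ 2 / 2).
Proof.
rewrite /gpdf ler_piMl ?expR_ge0// invf_le1 ?sqrtr_gt0 ?mulr_gt0 ?pi_gt0//.
rewrite -[leLHS]sqrtr1 ler_sqrt ?mulr_ge0 ?pi_ge0//.
by have := @pi_ge2 R; lra.
Qed.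

Lemma gpdf_leV x : 0 < x -> gpdf x <= x^-1.
Proof.
move=> x0; apply: le_trans (gpdf_le_expR x) _; rewrite mulNr expRN.
rewrite lef_pV2 ?posrE ?expR_gt0//; apply: le_trans (expR_ge1Dx _).
by have := sqr_ge0 (x - 1); lra.
Qed.

Lemma invr_cvgy : (x : R)^-1 @[x --> +oo] --> (0 : R).
Proof.
apply/gtr0_cvgV0; first by near=> x; near: x; apply: nbhs_pinfty_gt; exact: num_real.
exact: cvg_id.
Unshelve. all: by end_near. Qed.

Lemma gpdf_cvgy : gpdf x @[x --> +oo] --> (0 : R).
Proof.
apply: (@squeeze_cvgr _ _ _ _ (cst 0) (fun x => x^-1)); [|exact: cvg_cst|exact: invr_cvgy].
near=> x; rewrite ltW ?gpdf_gt0//= gpdf_leV//.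
Unshelve. all: by end_near. Qed.

Lemma Phi_tail_ub x : 0 < x -> 1 - Phi x <= gpdf x / x.
Proof.
move=> x0; rewrite -subr_ge0.
apply: (@nonincreasing_cvg0_ge0 _ (fun t => gpdf t / t - (1 - Phi t)) (fun t => - gpdf t / t ^+ 2)).
- move=> t xt; have t0 : t != 0 by rewrite gt_eqF// (lt_le_trans x0).
  have H1 := is_derive_gpdf t; have H2 := is_derive_Phi t.
  have H3 := is_derive_inv t0.
  apply: is_derive_eq; rewrite /GRing.scale /=; field. exact: t0.
- by move=> t xt; rewrite mulNr oppr_le0 divr_ge0 ?sqr_ge0// ltW// gpdf_gt0.
- have -> : 0 = 0 * 0 - (1 - 1) :> R by ring.
  apply: cvgB; first by apply: cvgM; [exact: gpdf_cvgy|exact: invr_cvgy].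
  by apply: cvgB; [exact: cvg_cst|exact: Phi_cvgy].
Qed.

(** With the first two terms of the asymptotic expansion of the Mills ratio, everything cancels in
    the derivative of the difference except [- 3 * gpdf t / t ^+ 4]. *)
Lemma Phi_tail_lb x : 0 < x -> gpdf x * (x^-1 - x^-1 ^+ 3) <= 1 - Phi x.
Proof.
move=> x0; rewrite -subr_ge0.
apply: (@nonincreasing_cvg0_ge0 _ (fun t => 1 - Phi t - gpdf t * (t^-1 - t^-1 ^+ 3))
  (fun t => - 3 * gpdf t / t ^+ 4)).
- move=> t xt; have t0 : t != 0 by rewrite gt_eqF// (lt_le_trans x0).
  have H1 := is_derive_gpdf t; have H2 := is_derive_Phi t.
  have H3 := is_derive_inv t0.
  apply: is_derive_eq; rewrite /GRing.scale /=; field. exact: t0.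
- by move=> t xt; rewrite -mulrA mulNr oppr_le0 mulr_ge0// divr_ge0 ?exprn_even_ge0// ltW// gpdf_gt0.
- have -> : 0 = (1 - 1) - 0 * (0 - 0 ^+ 3) :> R by ring.
  apply: cvgB; first by apply: cvgB; [exact: cvg_cst|exact: Phi_cvgy].
  apply: cvgM; first exact: gpdf_cvgy.
  apply: cvgB; first exact: invr_cvgy.
  exact: (cvg_comp _ _ invr_cvgy (@exprn_continuous _ 3 _)).
Qed.

Lemma Phi_tail_expR x : 1 <= x -> 1 - Phi x <= expR (- x ^+ 2 / 2).
Proof.
move=> x1; have x0 : 0 < x by rewrite (lt_le_trans _ x1).
apply: le_trans (Phi_tail_ub x0) _; apply: le_trans (gpdf_le_expR x).
by rewrite ler_pdivrMr// ler_peMr// ltW// gpdf_gt0.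
Qed.

End gaussian_cdf.

(** * Taylor expansions with explicit remainders *)

Section taylor.
Context {R : realType}.
Implicit Types (f g dg : R -> R) (s : R).

(** The bound involves [eta] rather than [|s|], so that the conclusion has the shape of the
    hypothesis and the lemma can be iterated. *)
Lemma MVT_bound g dg (B eta : R) :
  (forall s, `|s| <= eta -> is_derive s 1 g (dg s)) -> g 0 = 0 ->
  (forall s, `|s| <= eta -> `|dg s| <= B) ->
  forall s, `|s| <= eta -> `|g s| <= B * eta.
Proof.
move=> dgE g0 dgB s seta.
have B0 : 0 <= B by apply: le_trans (dgB s seta).
have [s0|s0] := leP 0 s.
  have [x /andP[x0 xs]|c /andP[c0 cs]] := @MVT_closed _ g dg _ _ s0.
    by apply: dgE; rewrite ger0_norm// (le_trans xs)// (le_trans _ seta)// ler_norm.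
  rewrite g0 !subr0 => ->; rewrite normrM ler_pM// dgB//.
  by rewrite ger0_norm// (le_trans cs)// (le_trans _ seta)// ler_norm.
have [x /andP[xs x0]|c /andP[cs c0]] := @MVT_closed _ g dg _ _ (ltW s0).
  by apply: dgE; rewrite ler0_norm// (le_trans _ seta)// ltr0_norm// lerN2.
rewrite g0 !sub0r mulrN => /oppr_inj ->; rewrite normrM ler_pM// dgB//.
by rewrite ler0_norm// (le_trans _ seta)// ltr0_norm// lerN2.
Qed.

(** Four applications of [MVT_bound], one per derivative. The factor [1 / 24] of the sharp remainder
    is lost on the way, which is harmless here. *)
Lemma taylor4 (f : nat -> R -> R) (B x h : R) :
  (forall i s, (i < 4)%N -> is_derive s 1 (f i) (f i.+1 s)) ->
  (forall s, `|s| <= `|h| -> `|f 4%N (x + s)| <= B) ->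
  `|f 0%N (x + h) - f 0%N x - h * f 1%N x - h ^+ 2 / 2 * f 2%N x
    - h ^+ 3 / 6 * f 3%N x| <= B * h ^+ 4.
Proof.
move=> df f4.
have D i s : (i < 4)%N -> is_derive s 1 (fun t => f i (x + t)) (f i.+1 (x + s)).
  move=> i4; rewrite -[X in is_derive _ _ _ X]mulr1.
  have := df i (x + s) i4 => H.
  by apply: is_derive1_comp; apply: is_derive_eq; rewrite add0r.
have g3 : forall s, `|s| <= `|h| -> `|f 3%N (x + s) - f 3%N x| <= B * `|h|.
  apply: (@MVT_bound _ (fun s => f 4%N (x + s))) => //; last by rewrite addr0 subrr.
  by move=> s _; have H := @D 3%N s isT; apply: is_derive_eq; rewrite subr0.
have g2 : forall s, `|s| <= `|h| -> `|f 2%N (x + s) - f 2%N x - s * f 3%N x| <= B * `|h| * `|h|.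
  apply: (@MVT_bound _ (fun s => f 3%N (x + s) - f 3%N x)) => //; last by rewrite addr0 subrr mul0r subr0.
  move=> s _; have H := @D 2%N s isT; apply: is_derive_eq.
  by rewrite /GRing.scale /= !(subr0, mulr0, mulr1, add0r, addr0).
have g1 : forall s, `|s| <= `|h| ->
    `|f 1%N (x + s) - f 1%N x - s * f 2%N x - s ^+ 2 / 2 * f 3%N x| <= B * `|h| * `|h| * `|h|.
  apply: (@MVT_bound _ (fun s => f 2%N (x + s) - f 2%N x - s * f 3%N x)) => //; last first.
    by rewrite addr0; ring.
  move=> s _; have H := @D 1%N s isT; apply: is_derive_eq.
  by rewrite /GRing.scale /=; field.
have g0 : forall s, `|s| <= `|h| ->
    `|f 0%N (x + s) - f 0%N x - s * f 1%N x - s ^+ 2 / 2 * f 2%N x - s ^+ 3 / 6 * f 3%N x|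
      <= B * `|h| * `|h| * `|h| * `|h|.
  apply: (@MVT_bound _ (fun s => f 1%N (x + s) - f 1%N x - s * f 2%N x - s ^+ 2 / 2 * f 3%N x)) => //; last first.
    by rewrite addr0; ring.
  move=> s _; have H := @D 0%N s isT; apply: is_derive_eq.
  by rewrite /GRing.scale /=; field.
have -> : B * h ^+ 4 = B * `|h| * `|h| * `|h| * `|h|.
  have E : `|h| * `|h| = h * h by rewrite -normrM ger0_norm// -expr2 sqr_ge0.
  by rewrite -!mulrA (mulrA `|h|) E; ring.
exact: g0.
Qed.

(** Used in the time variable, hence one-sided: derivatives are only asked for on [[x, x + h]],
    which stays inside the positive times. *)
Lemma taylor2 (f0 f1 f2 : R -> R) (B x h : R) : 0 <= h ->
  (forall s, x <= s <= x + h -> is_derive s 1 f0 (f1 s)) ->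
  (forall s, x <= s <= x + h -> is_derive s 1 f1 (f2 s)) ->
  (forall s, x <= s <= x + h -> `|f2 s| <= B) ->
  `|f0 (x + h) - f0 x - h * f1 x| <= B * h ^+ 2.
Proof.
move=> h0 df0 df1 f2B.
have xh : x <= x + h by rewrite lerDl.
have g1 s : x <= s <= x + h -> `|f1 s - f1 x| <= B * h.
  move=> /andP[xs sh].
  have [t /andP[t1 t2]|c /andP[c1 c2] ->] := @MVT_closed _ f1 f2 _ _ xs.
    by apply: df1; rewrite t1 (le_trans t2).
  rewrite normrM ler_pM ?f2B// ?c1 ?(le_trans c2)//.
  by rewrite ger0_norm ?subr_ge0//; lra.
have [t tx|c cx E] := @MVT_closed _ (fun t => f0 t - (t - x) * f1 x) (fun t => f1 t - f1 x) _ _ xh.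
  have H := df0 t tx; apply: is_derive_eq.
  by rewrite /GRing.scale /=; ring.
have -> : f0 (x + h) - f0 x - h * f1 x = (f1 c - f1 x) * h.
  by move: E; rewrite subrr mul0r; lra.
by rewrite normrM (ger0_norm h0) expr2 mulrA ler_wpM2r// g1.
Qed.

End taylor.

(** * The heat equation and bounds on its solution *)

Section heat.
Context {R : realType}.
Implicit Types (rho x z q theta h : R).

(* Successive space derivatives of the solution [Phi (x / sqrt rho)] of the
   heat equation [d/drho = (1/2) d^2/dx^2]. *)
Definition heat (i : nat) rho x : R :=
  let r := Num.sqrt rho in let z := x / r in
  match i with
  | 0 => Phi z
  | 1 => gpdf z / r
  | 2 => - z * gpdf z / r ^+ 2
  | 3 => (z ^+ 2 - 1) * gpdf z / r ^+ 3
  | _ => (3 * z - z ^+ 3) * gpdf z / r ^+ 4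
  end%N.

Lemma is_derive_heat_space rho i x : 0 < rho -> (i < 4)%N ->
  is_derive x 1 (heat i rho) (heat i.+1 rho x).
Proof.
move=> rho0 i4.
set r := Num.sqrt rho; have r0 : r != 0 by rewrite gt_eqF// sqrtr_gt0.
have D0 : is_derive x 1 (fun y => y / r) r^-1.
  by apply: is_derive_eq; rewrite /GRing.scale /= mulr0 add0r mulr1.
have D1 : is_derive x 1 (fun y => Phi (y / r)) (gpdf (x / r) / r).
  by apply: is_derive1_comp; exact: is_derive_Phi.
have D2 : is_derive x 1 (fun y => gpdf (y / r)) (- (x / r) * gpdf (x / r) / r).
  by apply: is_derive1_comp; exact: is_derive_gpdf.
rewrite /heat -/r; move: i i4 => [|[|[|[|//]]]] _; first exact: D1.
- by apply: is_derive_eq; rewrite /GRing.scale /=; field.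
- by apply: is_derive_eq; rewrite /GRing.scale /=; field.
- by apply: is_derive_eq; rewrite /GRing.scale /=; field.
Qed.

Let is_derive_time rho x : 0 < rho ->
  is_derive rho 1 (fun s => x / Num.sqrt s) (- (x / Num.sqrt rho) / (2 * Num.sqrt rho ^+ 2)).
Proof.
move=> rho0; have r0 : Num.sqrt rho != 0 by rewrite gt_eqF// sqrtr_gt0.
have D := is_derive1_sqrt rho0.
have D' := is_deriveV r0 D.
by apply: is_derive_eq; rewrite /GRing.scale /=; field.
Qed.

Lemma is_derive_heat0_time rho x : 0 < rho ->
  is_derive rho 1 (heat 0 ^~ x) (heat 2 rho x / 2).
Proof.
move=> rho0; have r0 : Num.sqrt rho != 0 by rewrite gt_eqF// sqrtr_gt0.
have D := is_derive_time x rho0; have D1 := is_derive_Phi (x / Num.sqrt rho).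
have H := @is_derive1_comp _ Phi (fun s => x / Num.sqrt s) _ _ _ D1 D.
rewrite [X in is_derive _ _ _ X](_ : _ =
  gpdf (x / Num.sqrt rho) * (- (x / Num.sqrt rho) / (2 * Num.sqrt rho ^+ 2))) //.
by rewrite /heat; field.
Qed.

(** A space derivative of a solution is again a solution. Together with [is_derive_heat0_time] this
    makes the second time derivative of [heat 0] a quarter of the fourth space derivative, so one
    bound on [heat 4] serves both expansions. *)
Lemma is_derive_heat2_time rho x : 0 < rho ->
  is_derive rho 1 (heat 2 ^~ x) (heat 4 rho x / 2).
Proof.
move=> rho0; have r0 : Num.sqrt rho != 0 by rewrite gt_eqF// sqrtr_gt0.
have D := is_derive_time x rho0; have D1 := is_derive_gpdf (x / Num.sqrt rho).
have D2 := @is_derive1_comp _ gpdf (fun s => x / Num.sqrt s) _ _ _ D1 D.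
have D3 := is_derive1_sqrt rho0.
have r20 : Num.sqrt rho ^+ 2 != 0 by rewrite expf_neq0.
have D4 : is_derive rho 1 (fun s => Num.sqrt s ^+ 2) 1.
  by apply: is_derive_eq; rewrite /GRing.scale /=; field.
have D5 := @is_deriveV _ (fun s => Num.sqrt s ^+ 2) _ _ _ r20 D4.
rewrite /heat; apply: is_derive_eq.
by rewrite /GRing.scale /=; field.
Qed.

Lemma heat_continuous rho i : 0 < rho -> (i < 4)%N -> continuous (heat i rho).
Proof.
move=> rho0 i4 x; apply: differentiable_continuous; apply/derivable1_diffP.
by apply: ex_derive; exact: is_derive_heat_space.
Qed.

Lemma heat0_bound rho x : 0 <= heat 0 rho x <= 1.
Proof. by rewrite /heat Phi_ge0 Phi_le1. Qed.

(* With [w = z + q], Gaussian decay in [w] pays for the polynomial factor: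
   this bounds the Hermite term by a pure exponential of the right rate. *)
Lemma hermite3_bound z q : 0 <= q ->
  `|3 * z - z ^+ 3| * expR (- z ^+ 2 / 2) <=
  256 * (1 + q) ^+ 3 * expR (q ^+ 2 / 2 + q * z).
Proof.
move=> q0; set w := z + q.
have -> : - z ^+ 2 / 2 = (q ^+ 2 / 2 + q * z) - w ^+ 2 / 2 by rewrite /w; field.
rewrite expRD mulrCA (mulrC _ (expR (_ + _))) ler_pM2l ?expR_gt0// expRN ler_pdivrMr ?expR_gt0//.
have wB : (1 + `|w|) ^+ 3 <= 64 * expR (w ^+ 2 / 2).
  (* Splitting the exponential in two factors and applying [1 + y <= expR y] to each produces a
     quartic, which dominates the cubic on the left. *)
  have -> : w ^+ 2 / 2 = w ^+ 2 / 4 + w ^+ 2 / 4 by field.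
  rewrite expRD.
  have e1 : 1 + w ^+ 2 / 4 <= expR (w ^+ 2 / 4) by exact: expR_ge1Dx.
  have e0 : 0 <= 1 + w ^+ 2 / 4 by have := sqr_ge0 w; lra.
  have : (1 + w ^+ 2 / 4) * (1 + w ^+ 2 / 4) <= expR (w ^+ 2 / 4) * expR (w ^+ 2 / 4) by exact: ler_pM.
  set E := expR _ * _ => hE; apply: le_trans (_ : 64 * ((1 + w ^+ 2 / 4) * (1 + w ^+ 2 / 4)) <= _); last first.
    by rewrite ler_wpM2l.
  have nw := normr_ge0 w.
  have -> : w ^+ 2 = `|w| ^+ 2 by rewrite real_normK ?num_real.
  set v := `|w| in nw *; nra.
have zB : `|z| <= (1 + `|w|) * (1 + q).
  have : `|z| <= `|w| + q.
    have {1}-> : z = w - q by rewrite /w addrK.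
    by rewrite (le_trans (ler_normB _ _))// (ger0_norm q0).
  by have := mulr_ge0 (normr_ge0 w) q0; lra.
set t := (1 + `|w|) * (1 + q) in zB.
have t1 : 1 <= t by rewrite /t; have := mulr_ge0 (normr_ge0 w) q0; have := normr_ge0 w; lra.
apply: le_trans (_ : 4 * t ^+ 3 <= _); last first.
  rewrite /t exprMn mulrA [leRHS]mulrAC; apply: ler_wpM2r; first by rewrite exprn_ge0// addr_ge0.
  by lra.
apply: le_trans (ler_normB _ _) _; rewrite normrM normrX ger0_norm//.
have a1 : `|z| <= t ^+ 3.
  by apply: le_trans zB _; rewrite -[leLHS]expr1 ler_weXn2l.
have a2 : `|z| ^+ 3 <= t ^+ 3 by rewrite lerXn2r ?nnegrE// (le_trans _ t1).
lra.
Qed.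

(** This is [hermite3_bound] at [q = theta * sqrt rho], the value that turns its exponent into
    [theta * x] plus the log-Laplace transform [theta ^+ 2 * rho / 2] of a Gaussian of variance
    [rho]. *)
Lemma heat4_bound rho x theta : 0 < rho -> 0 <= theta ->
  `|heat 4 rho x| <= 256 * (1 + theta * Num.sqrt rho) ^+ 3 / rho ^+ 2
                     * expR (theta ^+ 2 * rho / 2 + theta * x).
Proof.
move=> rho0 th0; rewrite /heat; set r := Num.sqrt rho; set z := x / r.
have r0 : 0 < r by rewrite sqrtr_gt0.
have rE : r ^+ 2 = rho by rewrite sqr_sqrtr// ltW.
rewrite (_ : r ^+ 4 = rho ^+ 2); last by rewrite -rE -exprM.
rewrite normrM normrM (ger0_norm (ltW (gpdf_gt0 _))) (@ger0_norm _ (rho ^+ 2)^-1) ?invr_ge0 ?sqr_ge0//.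
rewrite [leRHS]mulrAC ler_wpM2r ?invr_ge0 ?sqr_ge0//.
have -> : theta ^+ 2 * rho / 2 + theta * x = (theta * r) ^+ 2 / 2 + (theta * r) * z.
  by rewrite /z -rE; field; rewrite gt_eqF.
apply: le_trans (hermite3_bound _ _); last by rewrite mulr_ge0// ltW.
by rewrite ler_wpM2l// gpdf_le_expR.
Qed.

Variables (rho0 theta : R).
Hypotheses (rho0_gt0 : 0 < rho0) (theta_ge0 : 0 <= theta).

(** The worst prefactor of [heat4_bound] for times in [[rho0, 4]], where [sqrt rho <= 2]. *)
Definition heat_const : R := 256 * (1 + 2 * theta) ^+ 3 / rho0 ^+ 2.

Lemma heat_const_ge0 : 0 <= heat_const.
Proof. by rewrite divr_ge0 ?mulr_ge0 ?exprn_ge0 ?addr_ge0 ?mulr_ge0// ltW. Qed.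

Let heat4_le rho x : rho0 <= rho <= 4 ->
  `|heat 4 rho x| <= heat_const * expR (theta ^+ 2 * rho / 2 + theta * x).
Proof.
move=> /andP[rho0r r4]; have r0 : 0 < rho by exact: lt_le_trans rho0r.
apply: le_trans (heat4_bound x r0 theta_ge0) _.
rewrite ler_wpM2r ?expR_ge0// ler_pM ?invr_ge0 ?mulr_ge0 ?exprn_ge0 ?addr_ge0 ?mulr_ge0 ?sqrtr_ge0 ?(ltW r0)//.
  rewrite ler_wpM2l// lerXn2r ?nnegrE ?addr_ge0 ?mulr_ge0 ?sqrtr_ge0// lerD2l mulrC ler_wpM2r//.
  by rewrite -[leRHS](@ger0_norm R)// -sqrtr_sqr ler_sqrt ?exprn_ge0//; lra.
by rewrite lef_pV2 ?posrE ?exprn_gt0// lerXn2r ?nnegrE// ltW.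
Qed.

(** Since [theta * |h| <= 1], moving the exponential bound from an intermediate point back to [x]
    costs at most [1] in the exponent. *)
Lemma heat_space_step rho x h : rho0 <= rho <= 4 -> theta * `|h| <= 1 ->
  `|heat 0 rho (x + h) - heat 0 rho x - h * heat 1 rho x - h ^+ 2 / 2 * heat 2 rho x
    - h ^+ 3 / 6 * heat 3 rho x|
  <= heat_const * expR (theta ^+ 2 * rho / 2 + theta * x + 1) * h ^+ 4.
Proof.
move=> rhoB hB; have r0 : 0 < rho by case/andP: rhoB => + _; exact: lt_le_trans.
apply: (@taylor4 _ (heat ^~ rho)) => [i s i4|s sh]; first exact: is_derive_heat_space.
apply: le_trans (heat4_le _ rhoB) _; rewrite ler_wpM2l ?heat_const_ge0// ler_expR mulrDr addrA lerD2l.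
by apply: le_trans hB; rewrite ler_wpM2l// (le_trans (ler_norm _)).
Qed.

Lemma heat_time_step rho x h : rho0 <= rho -> 0 <= h -> rho + h <= 4 ->
  theta ^+ 2 * h <= 2 ->
  `|heat 0 (rho + h) x - heat 0 rho x - h * (heat 2 rho x / 2)|
  <= heat_const * expR (theta ^+ 2 * rho / 2 + theta * x + 1) * h ^+ 2.
Proof.
move=> rhoB h0 r4 hB.
apply: (@taylor2 _ (heat 0 ^~ x) (fun r => heat 2 r x / 2) (fun r => heat 4 r x / 4)) => //.
- by move=> s /andP[s0 _]; apply: is_derive_heat0_time; rewrite (lt_le_trans _ s0)// (lt_le_trans _ rhoB).
- move=> s /andP[s0 _].
  have H : is_derive s 1 (heat 2 ^~ x) (heat 4 s x / 2).
    by apply: is_derive_heat2_time; rewrite (lt_le_trans _ s0)// (lt_le_trans _ rhoB).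
  apply: is_derive_eq; rewrite /GRing.scale /=; field.
  by rewrite gt_eqF// sqrtr_gt0 (lt_le_trans _ s0)// (lt_le_trans _ rhoB).
- move=> s /andP[s0 s1].
  have sB : rho0 <= s <= 4 by rewrite (le_trans rhoB)//= (le_trans s1).
  rewrite normrM (ger0_norm (_ : 0 <= 4^-1))//.
  apply: le_trans (_ : `|heat 4 s x| <= _); first by have := normr_ge0 (heat 4 s x); lra.
  apply: le_trans (heat4_le _ sB) _; rewrite ler_wpM2l ?heat_const_ge0// ler_expR.
  (* Here [theta ^+ 2 * h <= 2] bounds the growth of the exponent between [rho] and [rho + h] by
     [1]. *)
  have : theta ^+ 2 * s <= theta ^+ 2 * (rho + h) by rewrite ler_wpM2l ?sqr_ge0.
  lra.
Qed.

End heat.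

(** * Bounded measurable functions and their expectations *)

Section bounded_measurable.
Context {R : realType} {d : measure_display} {T : measurableType d}.
Implicit Types (f g : T -> R) (c : R).

(** For fixed [n] every function integrated below is bounded. This class is stable under the
    operations used and contained in the integrable functions, so it settles all integrability
    conditions. *)
Definition bmeas f := measurable_fun setT f /\ exists M, forall t, `|f t| <= M.

Lemma bmeas_cst c : bmeas (fun=> c).
Proof. by split; [exact: measurable_cst|exists `|c|]. Qed.

Lemma bmeasD f g : bmeas f -> bmeas g -> bmeas (fun t => f t + g t).
Proof.
move=> [mf [M fM]] [mg [N gN]]; split; first exact: measurable_funD.
by exists (M + N) => t; rewrite (le_trans (ler_normD _ _))// lerD.
Qed.

Lemma bmeasM f g : bmeas f -> bmeas g -> bmeas (fun t => f t * g t).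
Proof.
move=> [mf [M fM]] [mg [N gN]]; split; first exact: measurable_funM.
by exists (M * N) => t; rewrite normrM ler_pM.
Qed.

Lemma bmeasZ c f : bmeas f -> bmeas (fun t => c * f t).
Proof. exact/bmeasM/bmeas_cst. Qed.

Lemma bmeasN f : bmeas f -> bmeas (fun t => - f t).
Proof.
move=> [mf [M fM]]; split; first exact: measurableT_comp.
by exists M => t; rewrite normrN.
Qed.

Lemma bmeasB f g : bmeas f -> bmeas g -> bmeas (fun t => f t - g t).
Proof. by move=> bf bg; apply: bmeasD => //; exact: bmeasN. Qed.

Lemma bmeasX f n : bmeas f -> bmeas (fun t => f t ^+ n).
Proof.
move=> bf; elim: n => [|n IH]; first exact: bmeas_cst.
by under eq_fun do rewrite exprS; exact: bmeasM.
Qed.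

Lemma bmeas_sum (I : Type) (s : seq I) (Q : pred I) (h : I -> T -> R) :
  (forall i, Q i -> bmeas (h i)) -> bmeas (fun t => \sum_(i <- s | Q i) h i t).
Proof.
move=> bh; elim: s => [|i s IH].
  by under eq_fun do rewrite big_nil; exact: bmeas_cst.
under eq_fun do rewrite big_cons.
by case Qi: (Q i) => //; apply: bmeasD => //; exact: bh.
Qed.

Lemma bmeas_bool (b : T -> bool) : measurable_fun setT b -> bmeas (fun t => (b t)%:R).
Proof.
move=> mb; split; last by exists 1 => t; case: (b t); rewrite ?normr1 ?normr0.
exact: (@measurableT_comp _ _ _ _ _ _ (fun b : bool => b%:R : R)).
Qed.

Lemma continuous_segment_bounded (g : R -> R) (a b : R) : continuous g ->
  exists M, forall x, a <= x <= b -> `|g x| <= M.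
Proof.
move=> cg; have [ab|ba] := leP a b; last first.
  by exists 0 => x /andP[ax xb]; have := le_trans ax xb; rewrite leNgt ba.
have [||c _ cM] := @EVT_max _ (fun x => `|g x|) a b.
- exact: ab.
- by apply: continuous_subspaceT => x; apply: cvg_norm; exact: cg.
- by exists `|g c| => x xab; apply: cM; rewrite in_itv/=.
Qed.

Lemma bmeas_continuous (g : R -> R) f : continuous g -> bmeas f ->
  bmeas (fun t => g (f t)).
Proof.
move=> cg [mf [M fM]]; split.
  by apply: measurableT_comp mf; exact: continuous_measurable_fun.
have [N gN] := continuous_segment_bounded (- M) M cg.
by exists N => t; apply: gN; rewrite -ler_norml.
Qed.

End bounded_measurable.

Section expectation.
Context {R : realType} {d : measure_display} {T : measurableType d}.
Variable P : probability T R.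
Implicit Types (f g : T -> R) (c : R).

Lemma bmeas_integrable f : bmeas f -> P.-integrable setT (EFin \o f).
Proof.
move=> [mf [M fM]]; apply: (@le_integrable _ _ _ P setT measurableT _ (cst M%:E)).
- exact/measurable_EFinP.
- by move=> t _ /=; rewrite lee_fin (le_trans (fM t))// ler_norm.
- exact: finite_measure_integrable_cst.
Qed.

Lemma Ex_cst c : \int[P]_t c = c.
Proof.
rewrite Rintegral_cst// -[RHS]mulr1; congr (c * _).
exact: (congr1 fine (probability_setT P)).
Qed.

Lemma ExD f g : bmeas f -> bmeas g ->
  \int[P]_t (f t + g t) = \int[P]_t f t + \int[P]_t g t.
Proof. by move=> bf bg; rewrite RintegralD//; exact: bmeas_integrable. Qed.

Lemma ExB f g : bmeas f -> bmeas g ->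
  \int[P]_t (f t - g t) = \int[P]_t f t - \int[P]_t g t.
Proof. by move=> bf bg; rewrite RintegralB//; exact: bmeas_integrable. Qed.

Lemma ExZ c f : bmeas f -> \int[P]_t (c * f t) = c * \int[P]_t f t.
Proof. by move=> bf; rewrite RintegralZl//; exact: bmeas_integrable. Qed.

Lemma Ex_sum (I : Type) (s : seq I) (Q : pred I) (h : I -> T -> R) :
  (forall i, Q i -> bmeas (h i)) ->
  \int[P]_t (\sum_(i <- s | Q i) h i t) = \sum_(i <- s | Q i) \int[P]_t h i t.
Proof.
move=> bh; elim: s => [|i s IH].
  by under eq_Rintegral do rewrite big_nil; rewrite big_nil Ex_cst.
under eq_Rintegral do rewrite big_cons; rewrite big_cons.
case Qi: (Q i) => //; rewrite ExD ?IH//; first exact: bh.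
exact: bmeas_sum.
Qed.

Lemma Ex_le f g : bmeas f -> bmeas g -> (forall t, f t <= g t) ->
  \int[P]_t f t <= \int[P]_t g t.
Proof. by move=> bf bg fg; apply: le_Rintegral => //; exact: bmeas_integrable. Qed.

Lemma Ex_ge0 f : (forall t, 0 <= f t) -> 0 <= \int[P]_t f t.
Proof. by move=> f0; apply: Rintegral_ge0. Qed.

Lemma Ex_norm f : bmeas f -> `|\int[P]_t f t| <= \int[P]_t `|f t|.
Proof. by move=> bf; apply: le_normr_Rintegral => //; exact: bmeas_integrable. Qed.

Lemma Ex_indic (A : set T) : measurable A -> \int[P]_t \1_A t = fine (P A).
Proof. by move=> mA; rewrite /Rintegral integral_indic// setIT. Qed.

End expectation.

(** * Integrating out one independent variable *)

Section freezing.
Context {R : realType} {d : measure_display} {T : measurableType d}.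
Context {P : probability T R} {I : finType} (Z : I -> {RV P >-> R}).
Hypothesis indZ : mutually_independent Z.
Variable j : I.

(** The pi-system generating the sigma-algebra of all variables other than [Z j]; independence is
    only given on such finite intersections. *)
Definition cylinders : set (set T) :=
  [set C | exists (J : {set I}) (A : I -> set R),
    [/\ j \notin J, forall i, measurable (A i) &
        C = \bigcap_(i in [set` J]) (Z i @^-1` A i)]].

Let mZ i (A : set R) : measurable A -> measurable (Z i @^-1` A).
Proof. by move=> mA; rewrite -[_ @^-1` _]setTI; exact: measurable_funP. Qed.

Lemma cylinders_measurable : cylinders `<=` measurable.
Proof.
move=> _ [J [A [_ mA ->]]]; apply: fin_bigcap_measurable => //.
by move=> i _; exact: mZ.
Qed.

Lemma cylinders_setI : setI_closed cylinders.
Proof.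
move=> _ _ [J [A [jJ mA ->]]] [K [B [jK mB ->]]].
(* Outside its own index set each family is padded with [setT], so that both can be indexed by the
   union. *)
exists (J :|: K)%SET, (fun i => (if i \in J then A i else setT) `&` (if i \in K then B i else setT)).
split; first by rewrite inE negb_or jJ.
  by move=> i; apply: measurableI; case: ifP.
apply/seteqP; split => [t [tA tB] i /= _|t tAB].
  by split; case: ifPn => // iJ; [exact: tA|exact: tB].
split => i /= iJ; have := tAB i; rewrite /= inE iJ ?orbT => /(_ isT) [];
  by rewrite ?iJ.
Qed.

Lemma cylinders_setT : cylinders setT.
Proof.
exists finset.set0, (fun=> setT); split => //; first by rewrite inE.
by apply/seteqP; split => // t _ i /=; rewrite inE.
Qed.

(** As functions of [E] both sides are finite measures that agree on the pi-system of cylinders,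
    hence on the sigma-algebra it generates. *)
Lemma indep_cylinders (E : set T) (A : set R) : <<s cylinders >> E -> measurable A ->
  P (E `&` Z j @^-1` A) = (P E * P (Z j @^-1` A))%E.
Proof.
move=> sE mA.
have mZA := mZ j mA.
have pf : P (Z j @^-1` A) \is a fin_num by rewrite fin_num_measure.
pose p : {nonneg R} := NngNum (fine_ge0 (measure_ge0 P (Z j @^-1` A))).
have pE : (p%:num)%:E = P (Z j @^-1` A) by exact: fineK.
pose m1 := mrestr P mZA; pose m2 := mscale p P.
have m1E B : m1 B = P (B `&` Z j @^-1` A) by [].
have m2E B : m2 B = (P B * P (Z j @^-1` A))%E by rewrite -pE muleC.
rewrite -m2E; apply: etrans (esym (m1E _)) _.
apply: (@g_sigma_algebra_measure_unique _ _ _ cylinders cylinders_measurable (fun=> setT) _ _ m1 m2) => //.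
- by move=> _; exact: cylinders_setT.
- by rewrite bigcup_const.
- exact: cylinders_setI.
- move=> _ [J [B [jJ mB ->]]].
  apply: etrans (m1E _) _; apply: etrans _ (esym (m2E _)).
  (* Independence over [j |: J] with this family adds exactly one factor, [P (Z j @^-1 A)], to
     independence over [J]. *)
  pose B' i := if i == j then A else B i.
  have mB' i : measurable (B' i) by rewrite /B'; case: ifP.
  have := indZ (j |: J)%SET mB'; have := indZ J mB.
  rewrite big_setU1//= {1 2}/B' eqxx.
  have -> : (\prod_(i in J) P (Z i @^-1` B' i))%E = (\prod_(i in J) P (Z i @^-1` B i))%E.
    by apply: eq_bigr => i iJ; rewrite /B'; case: eqP => // ij; move: jJ; rewrite -ij iJ.
  move=> <-; rewrite muleC => <-; congr (P _); apply/seteqP; split => [t [tB tA] i /=|t tB].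
    rewrite in_setU1 /B' => /predU1P[->|iJ]; first by rewrite eqxx.
    by case: eqP => [->//|_]; exact: tB.
  split; last by have := tB j; rewrite /= setU11 /B' eqxx; exact.
  move=> i /= iJ; have := tB i; rewrite /= setU1r// => /(_ isT).
  by rewrite /B'; case: eqP => // ij; move: jJ; rewrite -ij iJ.
- by move=> n; rewrite [X in (X < _)%E]m1E setTI ltey_eq pf.
Qed.

(** The same sample space with the coarser sigma-algebra: measurability on [T'] expresses that a
    function depends only on the variables other than [Z j]. *)
Let T' := g_sigma_algebraType cylinders.

Let toT' : T -> T' := id.

Let mtoT' : measurable_fun setT toT'.
Proof.
move=> _ A mA; rewrite setTI; apply: smallest_sub mA.
  exact: sigma_algebra_measurable.
exact: cylinders_measurable.
Qed.

#[local] HB.instance Definition _ := @isMeasurableFun.Build _ _ _ _ toT' mtoT'.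

Lemma measurable_cylinders (i : I) : i != j ->
  measurable_fun [set: T'] (Z i : T' -> R).
Proof.
move=> ij _ A mA; rewrite setTI; apply: sub_sigma_algebra.
exists [set i]%SET, (fun=> A); split => //; first by rewrite inE eq_sym.
apply/seteqP; split => [t Zt k /=|t Zt]; first by rewrite inE => /eqP ->.
by apply: Zt; rewrite /= inE.
Qed.

Let pair_toT' (t : T) : T' * R := (toT' t, Z j t).

Let mpair : measurable_fun setT pair_toT'.
Proof. by apply: measurable_fun_pair => //; exact: mtoT'. Qed.

#[local] HB.instance Definition _ := @isMeasurableFun.Build _ _ _ _ pair_toT' mpair.

Let P' := distribution P toT'.
Let Q := distribution P pair_toT'.
Let muj := distribution P (Z j).

Let product_law (X : set (T' * R)) : measurable X -> (P' \x muj)%E X = Q X.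
Proof.
by apply: product_measure_unique => A B mA mB; exact: indep_cylinders.
Qed.

(** The pair formed by the sample point, seen through the coarse sigma-algebra, and [Z j] has a
    product law by [indep_cylinders]; Fubini's theorem then integrates over [Z j] first. *)
Lemma freezing (f : T' * R -> R) : bmeas f ->
  \int[P]_t f (t, Z j t) = \int[P]_t (\int[muj]_z f (t, z)).
Proof.
move=> bf; have [mf [M fM]] := bf.
have mEf : measurable_fun setT (EFin \o f) by exact/measurable_EFinP.
have ibf : (P' \x muj)%E.-integrable setT (EFin \o f) by apply: (@bmeas_integrable _ _ _ (P' \x muj)%E).
congr fine.
transitivity (\int[Q]_x (f x)%:E)%E.
  rewrite /Q (integral_pushforward mpair mEf)//.
  rewrite preimage_setT; apply: bmeas_integrable.
  by split; [exact: measurableT_comp|exists M].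
transitivity (\int[(P' \x muj)%E]_x (f x)%:E)%E.
  by apply/esym; apply: eq_measure_integral => A mA _; exact: product_law.
have FE t : fubini_F muj (EFin \o f) t = (\int[muj]_z f (t, z))%:E.
  rewrite /Rintegral fineK//; apply: integrable_fin_num => //.
  apply: bmeas_integrable; split; last by exists M => z; exact: fM.
  exact: measurableT_comp.
rewrite -(integral12_prod_meas1 ibf) /P'.
have mF : measurable_fun setT (fubini_F muj (EFin \o f)) by exact: measurable_fubini_F ibf.
have bF : @bmeas _ _ T' (fun t => \int[muj]_z f (t, z)).
  split; first by apply/measurable_EFinP; move: mF; congr measurable_fun; apply/funext.
  exists M => t; apply: le_trans (Ex_norm _ _) _.
    split; last by exists M => z; exact: fM.
    exact: measurableT_comp.
  rewrite -[leRHS](Ex_cst muj); apply: Ex_le => //; last exact: bmeas_cst.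
  split; last by exists M => z; rewrite normr_id.
  by apply: measurableT_comp => //; exact: measurableT_comp.
rewrite (integral_pushforward mtoT' mF)//.
  by rewrite preimage_setT; apply: eq_integral => t _; rewrite /= FE.
rewrite preimage_setT.
have -> : fubini_F muj (EFin \o f) \o toT' = EFin \o (fun t => \int[muj]_z f (t, z)).
  by apply/funext => t; exact: FE.
apply: bmeas_integrable; have [mg [N gN]] := bF.
split; last by exists N.
exact: (@measurableT_comp _ _ _ _ _ _ (fun t : T' => \int[muj]_z f (t, z)) _ toT').
Qed.

Lemma indep_expectation (g : T -> R) (h : R -> R) :
  @bmeas _ _ T' g -> bmeas h ->
  \int[P]_t (g t * h (Z j t)) = (\int[P]_t g t) * \int[muj]_z h z.
Proof.
move=> [mg [M gM]] [mh [N hN]].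
have bh : @bmeas _ _ R h by split; last exists N.
rewrite (@freezing (fun x => g x.1 * h x.2)).
  under eq_Rintegral do rewrite /= ExZ//.
  under eq_Rintegral do rewrite mulrC.
  rewrite ExZ 1?mulrC//; split; last by exists M.
  exact: (@measurableT_comp _ _ _ _ _ _ (fun t : T' => g t) _ toT').
split; last by exists (M * N) => x; rewrite normrM ler_pM.
by apply: measurable_funM; exact: measurableT_comp.
Qed.

End freezing.

(** * Lindeberg's replacement for weighted sums *)

Section exp_taylor.
Context {R : realType}.

Lemma expR1_le4 : expR 1 <= 4 :> R.
Proof.
have h : expR (2^-1) <= 2 :> R.
  rewrite -[leLHS]invrK -expRN -[leRHS]invrK lef_pV2 ?posrE ?expR_gt0 ?invr_gt0//.
  by have := @expR_ge1Dx R (- 2^-1); lra.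
have -> : (1 : R) = 2^-1 + 2^-1 by field.
by rewrite expRD; have := ler_pM (expR_ge0 _) (expR_ge0 _) h h; lra.
Qed.

Lemma expR_taylor4 (y : R) : `|y| <= 1 ->
  expR y <= 1 + y + y ^+ 2 / 2 + y ^+ 3 / 6 + 4 * y ^+ 4.
Proof.
move=> y1; have := @taylor4 R (fun=> expR) 4 0 y (fun i s _ => is_derive_expR s).
rewrite !add0r expR0 !mulr1 => /(_ _)/ler_normlP[|_]; last by lra.
move=> s sy; rewrite add0r ger0_norm ?expR_ge0//; apply: le_trans expR1_le4.
by rewrite ler_expR (le_trans (ler_norm _))// (le_trans sy).
Qed.

End exp_taylor.

Section lindeberg.
Context {R : realType} {d : measure_display} {T : measurableType d}.
Context {P : probability T R} {n : nat} (Z : 'I_n -> {RV P >-> R}).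
Hypothesis indZ : mutually_independent Z.
Variable V : R -> R.
Hypotheses (mV : measurable_fun setT V) (V_le : forall z, `|V z| <= 2^-1).
Hypothesis EV1 : forall i, \int[distribution P (Z i)]_z V z = 0.
Hypothesis EV2 : forall i, \int[distribution P (Z i)]_z V z ^+ 2 = 12^-1.
Hypothesis EV3 : forall i, \int[distribution P (Z i)]_z V z ^+ 3 = 0.
Variable a : 'I_n -> R.

Let S (m : nat) (t : T) : R := \sum_(i < n | (i < m)%N) a i * V (Z i t).
Let past (F : 'I_n -> R) (m : nat) : R := \sum_(i < n | (i < m)%N) F i.

Let pastS F (j : 'I_n) : past F j.+1 = past F j + F j.
Proof.
rewrite /past (bigD1 j)//= addrC; congr (_ + _).
by apply: eq_bigl => i; rewrite ltnS ltn_neqAle andbC.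
Qed.

Let past0 F : past F 0 = 0.
Proof. by rewrite /past big_pred0. Qed.

Let bV : bmeas V.
Proof. by split => //; exists 2^-1. Qed.

Let bVZ i : bmeas (fun t => V (Z i t)).
Proof. by split; [exact: measurableT_comp|exists 2^-1]. Qed.

Let bS m : bmeas (S m).
Proof. by apply: bmeas_sum => i _; apply: bmeasZ; exact: bVZ. Qed.

(** Only indices strictly below [j] enter [S j], so it may be frozen while [Z j] is averaged. *)
Let bS_past (j : 'I_n) : @bmeas _ _ (g_sigma_algebraType (cylinders Z j)) (S j).
Proof.
apply: bmeas_sum => i ij; apply: bmeasZ; split; last by exists 2^-1.
apply: (@measurableT_comp _ _ _ _ _ _ V) => //.
by apply: measurable_cylinders; rewrite -val_eqE /= ltn_eqF.
Qed.

Let E_VX (j : 'I_n) (g : R -> R) (k : nat) : continuous g ->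
  \int[P]_t (g (S j t) * V (Z j t) ^+ k) =
  \int[P]_t g (S j t) * \int[distribution P (Z j)]_z V z ^+ k.
Proof.
move=> cg; apply: (@indep_expectation _ _ _ _ _ Z indZ j (fun t => g (S j t)) (fun z => V z ^+ k)).
  exact: bmeas_continuous.
exact: bmeasX.
Qed.

Let SS (j : 'I_n) t : S j.+1 t = S j t + a j * V (Z j t).
Proof. exact: (pastS (fun i => a i * V (Z i t))). Qed.

(** Vanishing first and third moments leave only the even terms. Both the moment bound and the
    replacement step are cubic expansions evaluated in this way. *)
Let E_cubic (j : 'I_n) (g0 g1 g2 g3 : R -> R) :
  continuous g0 -> continuous g1 -> continuous g2 -> continuous g3 ->
  \int[P]_t (g0 (S j t) + g1 (S j t) * V (Z j t) ^+ 1 + g2 (S j t) * V (Z j t) ^+ 2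
     + g3 (S j t) * V (Z j t) ^+ 3) =
  \int[P]_t g0 (S j t) + \int[P]_t g2 (S j t) / 12.
Proof.
move=> c0 c1 c2 c3.
have bg (g : R -> R) : continuous g -> bmeas (fun t => g (S j t)) by move=> cg; exact: (bmeas_continuous cg (bS j)).
have bgV (g : R -> R) k : continuous g -> bmeas (fun t => g (S j t) * V (Z j t) ^+ k).
  by move=> cg; apply: bmeasM; [exact: bg|exact: bmeasX].
rewrite ExD; [|by do !apply: bmeasD; auto|exact: bgV].
rewrite ExD; [|by do !apply: bmeasD; auto|exact: bgV].
rewrite ExD; [|exact: bg|exact: bgV].
rewrite !E_VX//; have -> : \int[distribution P (Z j)]_z V z ^+ 1 = 0 by exact: EV1.
by rewrite EV2 EV3 !mulr0 !addr0.
Qed.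

Variable theta : R.
Hypothesis theta_ge0 : 0 <= theta.
Hypothesis theta_a : forall i, theta * `|a i| <= 1.

Let theta_aV i t : theta * `|a i * V (Z i t)| <= 2^-1.
Proof.
rewrite normrM mulrA -[leRHS]mul1r; apply: ler_pM => //.
by rewrite mulr_ge0.
Qed.

Let cont_expR c : continuous (fun x : R => expR (c * x)).
Proof.
move=> x; apply: continuous_comp; last exact: continuous_expR.
exact: mulrl_continuous.
Qed.

Let bexpS m : bmeas (fun t => expR (theta * S m t)).
Proof. exact: (bmeas_continuous (@cont_expR theta)). Qed.

(** As [12^-1] is the variance of [V (Z i)], the first term of the exponent is the Gaussian one,
    [theta ^+ 2 / 2] times the variance of [S m]; the quartic term pays for the Taylor remainder. *)
Let expR_moment (m : nat) : (m <= n)%N ->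
  \int[P]_t expR (theta * S m t) <=
  expR (theta ^+ 2 / 24 * past (fun i => a i ^+ 2) m + theta ^+ 4 * past (fun i => a i ^+ 4) m).
Proof.
elim: m => [|m IH] mn.
  rewrite !past0 !mulr0 addr0 expR0.
  under eq_Rintegral do rewrite /S big_pred0// mulr0 expR0.
  by rewrite Ex_cst.
pose j := Ordinal mn; have Sj := @SS j; rewrite !(pastS _ j)/=.
(* The quartic remainder [4 * y ^+ 4] of [expR_taylor4] becomes deterministic through [|V| <= 2^-1],
   which gives the last coefficient [1 / 4]. *)
apply: le_trans (_ : \int[P]_t (expR (theta * S m t) *
   (1 + theta * a j * V (Z j t) + (theta * a j) ^+ 2 / 2 * V (Z j t) ^+ 2
     + (theta * a j) ^+ 3 / 6 * V (Z j t) ^+ 3 + (theta * a j) ^+ 4 / 4)) <= _).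
  apply: Ex_le => //.
    apply: bmeasM => //; repeat (apply: bmeasD || exact: bmeas_cst || apply: bmeasZ || exact: bVZ || apply: bmeasX).
  move=> t; rewrite Sj mulrDr expRD ler_wpM2l ?expR_ge0//.
  apply: le_trans (expR_taylor4 _) _.
    by rewrite normrM (ger0_norm theta_ge0) (le_trans (theta_aV _ _))//; lra.
  have V4 : V (Z j t) ^+ 4 <= 2^-1 ^+ 4.
    by rewrite -[leLHS]ger0_norm ?exprn_even_ge0// normrX lerXn2r ?nnegrE// V_le.
  have t4 : 0 <= (theta * a j) ^+ 4 by rewrite exprn_even_ge0.
  have := ler_wpM2l t4 V4; set v := V _; set th := theta; set aj := a j.
  have -> : (th * (aj * v)) = th * aj * v by rewrite mulrA.
  by rewrite !exprMn; lra.
pose e := \int[P]_t expR (theta * S m t).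
have ce c : continuous (fun x => c * expR (theta * x)).
  by move=> x; apply: cvgM; [exact: cvg_cst|exact: cont_expR].
have -> : \int[P]_t (expR (theta * S m t) *
   (1 + theta * a j * V (Z j t) + (theta * a j) ^+ 2 / 2 * V (Z j t) ^+ 2
     + (theta * a j) ^+ 3 / 6 * V (Z j t) ^+ 3 + (theta * a j) ^+ 4 / 4)) =
   e * (1 + (theta * a j) ^+ 2 / 24 + (theta * a j) ^+ 4 / 4).
  transitivity (\int[P]_t ((1 + (theta * a j) ^+ 4 / 4) * expR (theta * S j t)
    + (theta * a j) * expR (theta * S j t) * V (Z j t) ^+ 1
    + ((theta * a j) ^+ 2 / 2) * expR (theta * S j t) * V (Z j t) ^+ 2
    + ((theta * a j) ^+ 3 / 6) * expR (theta * S j t) * V (Z j t) ^+ 3)).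
    by apply: eq_Rintegral => t _; rewrite /=; ring.
  rewrite (@E_cubic j (fun x => (1 + (theta * a j) ^+ 4 / 4) * expR (theta * x))
    (fun x => (theta * a j) * expR (theta * x)) (fun x => ((theta * a j) ^+ 2 / 2) * expR (theta * x))
    (fun x => ((theta * a j) ^+ 3 / 6) * expR (theta * x)))// !ExZ//=.
  by rewrite -/e; field.
apply: (@le_trans _ _ (e * expR ((theta * a j) ^+ 2 / 24 + (theta * a j) ^+ 4))).
  apply: ler_wpM2l; first by apply: Ex_ge0 => t; exact: expR_ge0.
  apply: le_trans (expR_ge1Dx _); have : 0 <= (theta * a j) ^+ 4 by rewrite exprn_even_ge0.
  lra.
have IH' := IH (ltnW mn).
apply: le_trans (ler_wpM2r (expR_ge0 _) IH') _.
by rewrite -expRD ler_expR !exprMn; lra.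
Qed.

Variables (delta2 w : R).
Hypothesis delta2_gt0 : 0 < delta2.
Let vr := (\sum_(i < n) a i ^+ 2) / 12.
Hypothesis vr_le : delta2 + vr <= 4.
Hypothesis theta4_le : theta ^+ 4 * (\sum_(i < n) a i ^+ 4) <= 1.

Let pastn F : past F n = \sum_(i < n) F i.
Proof. by apply: eq_bigl => i; rewrite ltn_ord. Qed.

Let past_le F m : (forall i, 0 <= F i) -> past F m <= past F n.
Proof.
move=> F0; rewrite /past [leRHS](bigID (fun i : 'I_n => (i < m)%N))/=.
rewrite [X in _ <= X + _](eq_bigl (fun i : 'I_n => (i < m)%N)); last by move=> i; rewrite ltn_ord.
by rewrite lerDl sumr_ge0.
Qed.

(** The smoothing variance plus the variances of the summands not yet inserted: the total variance
    of [S m] and the Gaussian part stays constant along the replacement. *)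
Let rho m := delta2 + (past (fun i => a i ^+ 2) n - past (fun i => a i ^+ 2) m) / 12.

Let rho_ge m : delta2 <= rho m.
Proof.
by rewrite lerDl divr_ge0// subr_ge0 past_le// => i; rewrite sqr_ge0.
Qed.

Let past_ge0 F m : (forall i, 0 <= F i) -> 0 <= past F m.
Proof. by move=> F0; rewrite sumr_ge0. Qed.

Let rho_le m : rho m <= 4.
Proof.
apply: le_trans vr_le; rewrite /rho /vr -pastn lerD2l ler_wpM2r// gerBl past_ge0// => i.
by rewrite sqr_ge0.
Qed.

Let rho_gt0 m : 0 < rho m.
Proof. exact: lt_le_trans (rho_ge m). Qed.

Let Kc := heat_const delta2 theta.
Let Kc_ge0 : 0 <= Kc.
Proof. exact: heat_const_ge0. Qed.

(** The exponent is the Gaussian Chernoff exponent for the total variance. Of the extra [2], one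
    unit comes from the heat steps and one from the quartic term in [expR_moment]. *)
Let Kt := Kc * expR (theta ^+ 2 / 2 * (delta2 + vr) - theta * w + 2).

Let cont_heat i r c : (i < 4)%N -> 0 < r -> continuous (fun x : R => c * heat i r (x - w)).
Proof.
move=> i4 r0 x; apply: cvgM; first exact: cvg_cst.
apply: (@continuous_comp _ _ _ (fun x => x - w) (heat i r)); last exact: heat_continuous.
by apply: cvgB; [exact: cvg_id|exact: cvg_cst].
Qed.

Let bheat r m : 0 < r -> bmeas (fun t => heat 0 r (S m t - w)).
Proof.
move=> r0; have := bmeas_continuous (@cont_heat 0 r 1 isT r0) (bS m).
by under eq_fun do rewrite mul1r.
Qed.

(* Exchanging the [j]-th summand for the time [a_j^2 / 12] of heat flow: the
   second-order terms cancel by the heat equation. *)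
Let step (j : 'I_n) :
  `|\int[P]_t heat 0 (rho j.+1) (S j.+1 t - w) - \int[P]_t heat 0 (rho j) (S j t - w)|
   <= Kt * a j ^+ 4.
Proof.
set r := rho j.+1; set kap := a j ^+ 2 / 12.
have rE : rho j = r + kap by rewrite /r /rho pastS /kap; lra.
have r0 : 0 < r := rho_gt0 _.
rewrite -ExB; [|exact: bheat|exact: bheat].
pose C t := - (kap / 2) * heat 2 r (S j t - w) + a j * heat 1 r (S j t - w) * V (Z j t) ^+ 1
   + a j ^+ 2 / 2 * heat 2 r (S j t - w) * V (Z j t) ^+ 2
   + a j ^+ 3 / 6 * heat 3 r (S j t - w) * V (Z j t) ^+ 3.
have bh i c : (i < 4)%N -> bmeas (fun t => c * heat i r (S j t - w)).
  by move=> i4; exact: (bmeas_continuous (@cont_heat i r c i4 r0)).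
have bC : bmeas C.
  have bhV i c k : (i < 4)%N -> bmeas (fun t => c * heat i r (S j t - w) * V (Z j t) ^+ k).
    by move=> i4; apply: (bmeasM (bh _ _ i4)); exact: bmeasX.
  by apply: bmeasD (bhV 3%N _ _ isT); apply: bmeasD (bhV 2%N _ _ isT);
    apply: bmeasD (bhV 1%N _ _ isT); exact: bh.
have EC : \int[P]_t C t = 0.
  rewrite (@E_cubic j (fun x => - (kap / 2) * heat 2 r (x - w)) (fun x => a j * heat 1 r (x - w))
    (fun x => a j ^+ 2 / 2 * heat 2 r (x - w)) (fun x => a j ^+ 3 / 6 * heat 3 r (x - w)));
    try exact: cont_heat.
  have b2 : bmeas (fun t => heat 2 r (S j t - w)).
    by have := bh 2%N 1 isT; under eq_fun do rewrite mul1r.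
  by rewrite !ExZ//= /kap; field.
pose D t := heat 0 r (S j.+1 t - w) - heat 0 (rho j) (S j t - w) - C t.
have bD : bmeas D by apply: bmeasB => //; apply: bmeasB; exact: bheat.
have -> : \int[P]_t (heat 0 r (S j.+1 t - w) - heat 0 (rho j) (S j t - w)) = \int[P]_t D t.
  by rewrite [RHS]ExB ?EC ?subr0//; apply: bmeasB; exact: bheat.
apply: le_trans (Ex_norm _ bD) _.
have bexp c : bmeas (fun t => c * expR (theta * S j t)) by exact: bmeasZ.
pose c := Kc * expR (theta ^+ 2 * r / 2 - theta * w + 1) * a j ^+ 4.
apply: le_trans (_ : \int[P]_t (c * expR (theta * S j t)) <= _).
  apply: Ex_le => //.
    by have [mD [M DM]] := bD; split; [exact: measurableT_comp|exists M => t; rewrite normr_id].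
  move=> t; set x := S j t - w; set X := a j * V (Z j t).
  have X4 : X ^+ 4 <= a j ^+ 4 / 16.
    rewrite exprMn; have a4 : 0 <= a j ^+ 4 by rewrite exprn_even_ge0.
    have V4 : V (Z j t) ^+ 4 <= 2^-1 ^+ 4.
      by rewrite -[leLHS]ger0_norm ?exprn_even_ge0// normrX lerXn2r ?nnegrE// V_le.
    by have := ler_wpM2l a4 V4; set v := V _; lra.
  have s1 : `|heat 0 r (x + X) - heat 0 r x - X * heat 1 r x - X ^+ 2 / 2 * heat 2 r x
    - X ^+ 3 / 6 * heat 3 r x| <= Kc * expR (theta ^+ 2 * r / 2 + theta * x + 1) * X ^+ 4.
    apply: heat_space_step => //; first by rewrite rho_ge rho_le.
    by rewrite (le_trans (theta_aV _ _))//; lra.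
  have s2 : `|heat 0 (r + kap) x - heat 0 r x - kap * (heat 2 r x / 2)|
     <= Kc * expR (theta ^+ 2 * r / 2 + theta * x + 1) * kap ^+ 2.
    apply: heat_time_step => //; first exact: rho_ge.
    - by rewrite divr_ge0// sqr_ge0.
    - by rewrite -rE rho_le.
    - have : (theta * `|a j|) ^+ 2 <= 1 by rewrite expr_le1// mulr_ge0.
      by rewrite exprMn real_normK ?num_real// /kap; lra.
  have -> : D t = (heat 0 r (x + X) - heat 0 r x - X * heat 1 r x - X ^+ 2 / 2 * heat 2 r x
    - X ^+ 3 / 6 * heat 3 r x) - (heat 0 (r + kap) x - heat 0 r x - kap * (heat 2 r x / 2)).
    rewrite /D /C SS rE (_ : S j t + a j * V (Z j t) - w = x + X); last by rewrite /x /X; ring.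
    by rewrite -/x /X; field.
  apply: le_trans (ler_normB _ _) _; apply: le_trans (lerD s1 s2) _.
  have -> : c * expR (theta * S j t) = Kc * expR (theta ^+ 2 * r / 2 + theta * x + 1) * a j ^+ 4.
    rewrite /c (_ : theta ^+ 2 * r / 2 + theta * x + 1 = (theta ^+ 2 * r / 2 - theta * w + 1) + theta * S j t).
      by rewrite [in RHS]expRD; ring.
    by rewrite /x; ring.
  rewrite -mulrDr ler_wpM2l ?(mulr_ge0 Kc_ge0 (expR_ge0 _))//.
  have a4 : 0 <= a j ^+ 4 by rewrite exprn_even_ge0.
  (* The space error is at most [a j ^+ 4 / 16] and the time error is [a j ^+ 4 / 144]; together
     they stay below [a j ^+ 4]. *)
  have -> : kap ^+ 2 = a j ^+ 4 / 144 by rewrite /kap; field.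
  by move: X4 a4; set u := X ^+ 4; set v := a j ^+ 4; lra.
rewrite ExZ// /c mulrAC ler_wpM2r ?exprn_even_ge0// /Kt -[leLHS]mulrA ler_wpM2l ?Kc_ge0//.
apply: le_trans (ler_wpM2l (expR_ge0 _) (expR_moment (ltnW (ltn_ord j)))) _.
rewrite -expRD ler_expR.
have t4 : theta ^+ 4 * past (fun i => a i ^+ 4) j <= 1.
  apply: le_trans theta4_le; rewrite -pastn ler_wpM2l ?exprn_even_ge0// past_le// => i.
  by rewrite exprn_even_ge0.
(* The time [r] left after step [j] and the variance of [S j] add up to the total minus
   [a j ^+ 2 / 12]. *)
suff : theta ^+ 2 * (r + past (fun i => a i ^+ 2) j / 12) <= theta ^+ 2 * (delta2 + vr) by lra.
rewrite ler_wpM2l ?sqr_ge0// /r /rho /vr -pastn pastS.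
have := sqr_ge0 (a j); lra.
Qed.

(** Telescopes [step]: at [m = 0] nothing is random and all the variance is heat, at [m = n] only
    the smoothing [delta2] is left. *)
Lemma lindeberg :
  `|\int[P]_t heat 0 delta2 (\sum_(i < n) a i * V (Z i t) - w) - heat 0 (delta2 + vr) (- w)|
  <= heat_const delta2 theta * expR (theta ^+ 2 / 2 * (delta2 + vr) - theta * w + 2)
     * \sum_(i < n) a i ^+ 4.
Proof.
have main m : (m <= n)%N ->
    `|\int[P]_t heat 0 (rho m) (S m t - w) - heat 0 (delta2 + vr) (- w)|
    <= Kt * past (fun i => a i ^+ 4) m.
  elim: m => [|m IH] mn.
    rewrite past0 mulr0 /rho past0 subr0 pastn.
    have S0 t : S 0 t = 0 by exact: past0.
    under eq_Rintegral do rewrite S0 sub0r.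
    by rewrite Ex_cst subrr normr0.
  rewrite (pastS _ (Ordinal mn)) mulrDr [leRHS]addrC.
  apply: le_trans (ler_distD (\int[P]_t heat 0 (rho m) (S m t - w)) _ _) _.
  by apply: lerD; [exact: (step (Ordinal mn))|exact: IH (ltnW mn)].
have := main n (leqnn n).
rewrite /rho subrr mul0r addr0 pastn.
under eq_Rintegral do rewrite /S (eq_bigl _ _ (@ltn_ord n)).
exact.
Qed.

Lemma expR_moment_sum :
  \int[P]_t expR (theta * \sum_(i < n) a i * V (Z i t)) <= expR (theta ^+ 2 / 2 * vr + 1).
Proof.
have := expR_moment (leqnn n); rewrite !pastn.
under eq_Rintegral do rewrite /S (eq_bigl _ _ (@ltn_ord n)).
by move=> h; apply: le_trans h _; rewrite ler_expR /vr; move: theta4_le; lra.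
Qed.

End lindeberg.

(** * From smooth test functions to tail probabilities *)

Section tail_sandwich.
Context {R : realType}.
Implicit Types v x s theta : R.

(* The two-sided comparison of an indicator with a Gaussian distribution
   function of small variance; the exponential absorbs both tails of the latter. *)
Lemma indicator_le_heat (delta2 v s theta x : R) : 0 < delta2 -> 0 <= theta ->
  Num.sqrt delta2 <= s ->
  (v < x)%R%:R <= heat 0 delta2 (x - (v - s))
     + expR (- s ^+ 2 / (2 * delta2)) * expR (theta * (x - v)).
Proof.
move=> d0 th0 ds; have sd0 : 0 < Num.sqrt delta2 by rewrite sqrtr_gt0.
case: ltP => [vx|_]; last first.
  by rewrite addr_ge0 ?mulr_ge0 ?expR_ge0//; case/andP: (heat0_bound delta2 (x - (v - s))).
rewrite -lerBlDl /heat; set y := _ / _.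
have ys : s / Num.sqrt delta2 <= y.
  by rewrite ler_wpM2r ?invr_ge0 ?(ltW sd0)//; lra.
have s1 : 1 <= s / Num.sqrt delta2 by rewrite ler_pdivlMr// mul1r.
apply: le_trans (Phi_tail_expR (le_trans s1 ys)) _.
rewrite -[leLHS]mulr1 ler_pM ?expR_ge0//; last first.
  by rewrite -[leLHS]expR0 ler_expR mulr_ge0// subr_ge0 ltW.
have -> : - s ^+ 2 / (2 * delta2) = - (s / Num.sqrt delta2) ^+ 2 / 2.
  by rewrite exprMn exprVn sqr_sqrtr ?(ltW d0)//; field; rewrite gt_eqF.
rewrite !mulNr ler_expR lerN2 ler_wpM2r// lerXn2r ?nnegrE//.
  by rewrite (le_trans _ s1).
by rewrite (le_trans _ ys)// (le_trans _ s1).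
Qed.

Lemma heat_le_indicator (delta2 v s theta x : R) : 0 < delta2 -> 0 <= theta ->
  Num.sqrt delta2 <= s -> theta * delta2 <= s ->
  heat 0 delta2 (x - (v + s)) <= (v < x)%R%:R
     + expR (- s ^+ 2 / (2 * delta2)) * expR (theta * (x - v)).
Proof.
move=> d0 th0 ds ths; have sd0 : 0 < Num.sqrt delta2 by rewrite sqrtr_gt0.
case: ltP => [vx|xv].
  have /andP[_ h] := heat0_bound delta2 (x - (v + s)).
  by apply: le_trans h _; rewrite lerDl mulr_ge0 ?expR_ge0.
rewrite add0r /heat -[_ / _]opprK PhiN -mulNr opprB; set y := _ / _.
have s0 : 0 <= s by rewrite (le_trans _ ds)// ltW.
have y1 : 1 <= y by rewrite ler_pdivlMr// mul1r (le_trans ds)//; lra.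
apply: le_trans (Phi_tail_expR y1) _; rewrite -expRD ler_expR.
have -> : - y ^+ 2 / 2 = - (v + s - x) ^+ 2 / (2 * delta2).
  by rewrite /y exprMn exprVn sqr_sqrtr ?(ltW d0)//; field; rewrite gt_eqF.
(* For [x <= v] the completed square shows what [theta * delta2 <= s] is for: from the edge of the
   slack on, the Gaussian tail decays faster than the exponential of rate [theta]. *)
rewrite -subr_ge0.
have -> : - s ^+ 2 / (2 * delta2) + theta * (x - v) - - (v + s - x) ^+ 2 / (2 * delta2)
  = ((v - x) ^+ 2 + 2 * (v - x) * (s - theta * delta2)) / (2 * delta2).
  by field; rewrite gt_eqF.
by rewrite divr_ge0 ?addr_ge0 ?sqr_ge0 ?mulr_ge0 ?subr_ge0// ltW.
Qed.

End tail_sandwich.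

Section tail_bound.
Context {R : realType} {d : measure_display} {T : measurableType d}.
Context {P : probability T R} {n : nat} (Z : 'I_n -> {RV P >-> R}).
Hypothesis indZ : mutually_independent Z.
Variable V : R -> R.
Hypotheses (mV : measurable_fun setT V) (V_le : forall z, `|V z| <= 2^-1).
Hypothesis EV1 : forall i, \int[distribution P (Z i)]_z V z = 0.
Hypothesis EV2 : forall i, \int[distribution P (Z i)]_z V z ^+ 2 = 12^-1.
Hypothesis EV3 : forall i, \int[distribution P (Z i)]_z V z ^+ 3 = 0.
Variables (a : 'I_n -> R) (theta delta2 vr s : R).
Hypotheses (theta_ge0 : 0 <= theta) (theta_a : forall i, theta * `|a i| <= 1).
Hypothesis delta2_gt0 : 0 < delta2.
Hypothesis vrE : vr = (\sum_(i < n) a i ^+ 2) / 12.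
Hypothesis vr_le : delta2 + vr <= 4.
Hypothesis theta4_le : theta ^+ 4 * (\sum_(i < n) a i ^+ 4) <= 1.
Hypotheses (delta_le : Num.sqrt delta2 <= s) (theta_s : theta * delta2 <= s).

(** The first summand is the replacement error, with [expR (theta * s)] for shifting the threshold
    by [s]; the second comes from smoothing the indicator. The common factor is the Chernoff bound
    at [v]. *)
Definition tail_error v : R :=
  (heat_const delta2 theta * (\sum_(i < n) a i ^+ 4) * expR (theta * s + 2)
    + expR (1 - s ^+ 2 / (2 * delta2)))
  * expR (theta ^+ 2 / 2 * (delta2 + vr) - theta * v).

Let tail_errorE v : tail_error v =
  heat_const delta2 theta * (\sum_(i < n) a i ^+ 4) * expR (theta * s + 2)
   * expR (theta ^+ 2 / 2 * (delta2 + vr) - theta * v)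
  + expR (1 - s ^+ 2 / (2 * delta2)) * expR (theta ^+ 2 / 2 * (delta2 + vr) - theta * v).
Proof. exact: mulrDl. Qed.

Let Sn t : R := \sum_(i < n) a i * V (Z i t).

Let bSn : bmeas Sn.
Proof.
apply: bmeas_sum => i _; apply: bmeasZ; split; last by exists 2^-1.
exact: measurableT_comp.
Qed.

Let s_ge0 : 0 <= s.
Proof. by rewrite (le_trans _ delta_le)// sqrtr_ge0. Qed.

Let bheat w : bmeas (fun t => heat 0 delta2 (Sn t - w)).
Proof.
apply: (@bmeas_continuous _ _ _ (fun x : R => heat 0 delta2 (x - w))) bSn.
move=> x; apply: (@continuous_comp _ _ _ (fun x => x - w) (heat 0 delta2)); last exact: heat_continuous.
by apply: cvgB; [exact: cvg_id|exact: cvg_cst].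
Qed.

Let bexp v c : bmeas (fun t => c * expR (theta * (Sn t - v))).
Proof.
apply: (@bmeas_continuous _ _ _ (fun x : R => c * expR (theta * (x - v)))) bSn.
move=> x; apply: cvgM; first exact: cvg_cst.
apply: (continuous_comp (f := fun x => theta * (x - v)) (g := expR)); last exact: continuous_expR.
apply: cvgM; first exact: cvg_cst.
by apply: cvgB; [exact: cvg_id|exact: cvg_cst].
Qed.

Let bind v : bmeas (fun t => (v < Sn t)%R%:R : R).
Proof. by apply: bmeas_bool; apply: measurable_fun_ltr => //; case: bSn. Qed.

Let Eexp v : \int[P]_t (expR (- s ^+ 2 / (2 * delta2)) * expR (theta * (Sn t - v)))
  <= expR (1 - s ^+ 2 / (2 * delta2)) * expR (theta ^+ 2 / 2 * (delta2 + vr) - theta * v).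
Proof.
have := expR_moment_sum indZ mV V_le EV1 EV2 EV3 theta_ge0 theta_a theta4_le.
rewrite -vrE -/(Sn _) => h.
have bS1 : bmeas (fun t => expR (theta * Sn t)).
  by have := bexp 0 1; under eq_fun do rewrite mul1r subr0.
under eq_Rintegral do rewrite mulrBr expRD mulrA mulrAC.
rewrite ExZ//; apply: le_trans (ler_wpM2l _ h) _; first by rewrite mulr_ge0 ?expR_ge0.
rewrite -!expRD ler_expR.
have := mulr_ge0 (sqr_ge0 theta) (ltW delta2_gt0).
by rewrite mulNr; lra.
Qed.

Let Eheat w v : v - s <= w ->
  `|\int[P]_t heat 0 delta2 (Sn t - w) - heat 0 (delta2 + vr) (- w)| <=
  heat_const delta2 theta * (\sum_(i < n) a i ^+ 4) * expR (theta * s + 2)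
   * expR (theta ^+ 2 / 2 * (delta2 + vr) - theta * v).
Proof.
move=> vw; have := @lindeberg _ _ _ _ _ _ indZ _ mV V_le EV1 EV2 EV3 a theta theta_ge0 theta_a delta2 w delta2_gt0.
rewrite -vrE => /(_ vr_le theta4_le) h; apply: le_trans h _.
rewrite mulrAC -[leRHS]mulrA -expRD; apply: ler_wpM2l.
  apply: mulr_ge0; first exact: heat_const_ge0.
  by apply: sumr_ge0 => i _; rewrite exprn_even_ge0.
rewrite ler_expR; have := ler_wpM2l theta_ge0 vw; lra.
Qed.

Lemma tail_upper v : \int[P]_t (v < Sn t)%R%:R <=
  1 - Phi ((v - s) / Num.sqrt (delta2 + vr)) + tail_error v.
Proof.
have h := Eheat (lexx (v - s)).
apply: le_trans (_ : \int[P]_t (heat 0 delta2 (Sn t - (v - s))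
    + expR (- s ^+ 2 / (2 * delta2)) * expR (theta * (Sn t - v))) <= _).
  by apply: Ex_le => //; [exact: bmeasD|move=> t; exact: indicator_le_heat].
have hE : heat 0 (delta2 + vr) (- (v - s)) = Phi (- ((v - s) / Num.sqrt (delta2 + vr))).
  by rewrite /heat mulNr.
rewrite ExD// -PhiN -hE; have := Eexp v; move: h => /ler_normlP[_].
by rewrite tail_errorE; lra.
Qed.

Lemma tail_lower v :
  1 - Phi ((v + s) / Num.sqrt (delta2 + vr)) - tail_error v <= \int[P]_t (v < Sn t)%R%:R.
Proof.
have h : v - s <= v + s by have := s_ge0; lra.
move: (Eheat h) => {}h.
have : \int[P]_t heat 0 delta2 (Sn t - (v + s)) <= \int[P]_t ((v < Sn t)%R%:R
    + expR (- s ^+ 2 / (2 * delta2)) * expR (theta * (Sn t - v))).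
  by apply: Ex_le => //; [exact: bmeasD|move=> t; exact: heat_le_indicator].
have hE : heat 0 (delta2 + vr) (- (v + s)) = Phi (- ((v + s) / Num.sqrt (delta2 + vr))).
  by rewrite /heat mulNr.
rewrite ExD// -PhiN -hE; have := Eexp v; move: h => /ler_normlP[].
by rewrite tail_errorE; lra.
Qed.

End tail_bound.

(** * Moments and indicators under a uniform law *)

Section uniform_law.
Context {R : realType} (a b : R) (ab : a < b).

(* Distribution function of the uniform law on [a, b], centered. *)
Definition ucdf (z : R) : R := (Num.min b (Num.max a z) - a) / (b - a) - 2^-1.

Let ba0 : 0 < b - a.
Proof. by rewrite subr_gt0. Qed.

Let clamp_ge z : a <= Num.min b (Num.max a z).
Proof. by rewrite le_min ltW//= le_max lexx. Qed.

Let clamp_le z : Num.min b (Num.max a z) <= b.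
Proof. by rewrite ge_min lexx. Qed.

Let clamp_itv z : a <= z <= b -> Num.min b (Num.max a z) = z.
Proof. by move=> /andP[az zb]; rewrite max_r// min_r. Qed.

Lemma ucdf_le z : `|ucdf z| <= 2^-1.
Proof.
have h0 : 0 <= (Num.min b (Num.max a z) - a) / (b - a).
  by rewrite divr_ge0 ?(ltW ba0)// subr_ge0.
have h1 : (Num.min b (Num.max a z) - a) / (b - a) <= 1.
  by rewrite ler_pdivrMr// mul1r lerD2r.
by rewrite ler_norml /ucdf; lra.
Qed.

Lemma measurable_ucdf : measurable_fun setT ucdf.
Proof.
apply: measurable_funB => //; apply: measurable_funM => //; apply: measurable_funB => //.
by apply: measurable_minr => //; exact: measurable_maxr.
Qed.

Lemma bmeas_ucdf : bmeas ucdf.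
Proof. by split; [exact: measurable_ucdf|exists 2^-1 => z; exact: ucdf_le]. Qed.

Variable nu : probability R R.
Hypothesis nuE : same_law nu (uniform_prob ab).

Let idTR : measurableTypeR R -> R := idfun.

Let midTR : measurable_fun setT idTR.
Proof. exact: (@measurable_id _ _ setT). Qed.

#[local] HB.instance Definition _ := @isMeasurableFun.Build _ _ _ _ idTR midTR.

(* [uniform_prob] lives on [measurableTypeR R], whose display differs from the
   one of [R]: the two are related through the identity. *)
Let law_expectation (f : R -> R) : bmeas f ->
  \int[nu]_z f z = \int[uniform_prob ab]_z f z.
Proof.
move=> bf; have [mf [M fM]] := bf; congr fine.
transitivity (\int[distribution (uniform_prob ab) idTR]_z (f z)%:E)%E.
  by apply: eq_measure_integral => A mA _; exact: nuE.
rewrite (integral_pushforward midTR)//; first exact/measurable_EFinP.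
rewrite preimage_setT; apply: bmeas_integrable; split; last by exists M.
exact: (measurableT_comp mf midTR).
Qed.

(** The distribution function evaluated at its own variable is uniform on [[0, 1]], whatever [a] and
    [b] are; this treats both supports at once. *)
Lemma uniform_moment (k : nat) : \int[nu]_z (ucdf z + 2^-1) ^+ k = k.+1%:R^-1.
Proof.
have mf : measurable_fun setT (fun z => ((ucdf z + 2^-1) ^+ k)%:E).
  apply/measurable_EFinP.
  by have [] := bmeasX k (bmeasD bmeas_ucdf (bmeas_cst (2^-1 : R))).
have f0 z : (0 <= ((ucdf z + 2^-1) ^+ k)%:E)%E.
  by rewrite lee_fin exprn_ge0//; have /ler_normlP[] := ucdf_le z; lra.
rewrite law_expectation; last exact/bmeasX/(bmeasD bmeas_ucdf)/bmeas_cst.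
rewrite /Rintegral integral_uniform//.
pose F z := (b - a) / k.+1%:R * ((z - a) / (b - a)) ^+ k.+1.
have dF (z : R) : is_derive z 1 F (((z - a) / (b - a)) ^+ k).
  have D0 : is_derive z 1 (fun z => (z - a) / (b - a)) (b - a)^-1.
    by apply: is_derive_eq; rewrite /GRing.scale /= mulr0 add0r subr0 mulr1.
  have D1 : is_derive z 1 (fun z => ((z - a) / (b - a)) ^+ k.+1)
      (k.+1%:R * ((z - a) / (b - a)) ^+ k * (b - a)^-1).
    have := is_deriveX k.+1 D0; rewrite /GRing.scale /=.
    rewrite (_ : (fun z => (z - a) / (b - a)) ^+ k.+1 =
       (fun z => ((z - a) / (b - a)) ^+ k.+1)) //.
    by apply/funext => y; rewrite fctE.
  rewrite /F; apply: is_derive_eq.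
  rewrite /GRing.scale /=.
  by set q := _ ^+ k; field; rewrite ?nat1r ?pnatr_eq0 ?(gt_eqF ba0).
under eq_integral.
  move=> z; rewrite inE /= in_itv/= => zab.
  rewrite /ucdf subrK clamp_itv//.
  over.
rewrite (@continuous_FTC2 _ (fun x => ((x - a) / (b - a)) ^+ k) F)//.
- rewrite -EFinB -EFinM /= /F subrr mul0r expr0n/= mulr0 subr0 divff ?gt_eqF//.
  by rewrite expr1n mulr1; field; rewrite ?nat1r ?pnatr_eq0 ?(gt_eqF ba0).
- apply: continuous_subspaceT => x; apply: (@continuous_comp _ _ _ (fun x => (x - a) / (b - a)) (fun y => y ^+ k)); last exact: exprn_continuous.
  by apply: cvgM; [apply: cvgB; [exact: cvg_id|exact: cvg_cst]|exact: cvg_cst].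
- have cF : continuous F.
    move=> x; apply: differentiable_continuous; apply/derivable1_diffP.
    by apply: ex_derive; exact: dF.
  split; [|apply: cvg_at_right_filter; exact: cF|apply: cvg_at_left_filter; exact: cF].
  by move=> x _; apply: ex_derive; exact: dF.
- by move=> x _; rewrite derive1E; have [_] := dF x.
Qed.

Let bu k : bmeas (fun z => (ucdf z + 2^-1) ^+ k).
Proof. exact/bmeasX/(bmeasD bmeas_ucdf)/bmeas_cst. Qed.

Let bZ c k : bmeas (fun z => c * (ucdf z + 2^-1) ^+ k).
Proof. exact/bmeasZ/bu. Qed.

Let bD c1 c2 k l : bmeas (fun z => c1 * (ucdf z + 2^-1) ^+ k + c2 * (ucdf z + 2^-1) ^+ l).
Proof. exact: bmeasD. Qed.

Let Eu k l c1 c2 : \int[nu]_z (c1 * (ucdf z + 2^-1) ^+ k + c2 * (ucdf z + 2^-1) ^+ l)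
  = c1 / k.+1%:R + c2 / l.+1%:R.
Proof. by rewrite ExD// !ExZ// !uniform_moment. Qed.

Lemma ucdf_mean : \int[nu]_z ucdf z = 0.
Proof.
transitivity (\int[nu]_z (1 * (ucdf z + 2^-1) ^+ 1 + (- 2^-1) * (ucdf z + 2^-1) ^+ 0)).
  by apply: eq_Rintegral => z _; ring.
by rewrite Eu; field.
Qed.

Lemma ucdf_var : \int[nu]_z ucdf z ^+ 2 = 12^-1.
Proof.
transitivity (\int[nu]_z (1 * (1 * (ucdf z + 2^-1) ^+ 2 + (- 1) * (ucdf z + 2^-1) ^+ 1)
   + 4^-1 * (ucdf z + 2^-1) ^+ 0)).
  by apply: eq_Rintegral => z _; field.
rewrite ExD; [|exact/bmeasZ/bD|exact: bZ].
rewrite ExZ; last exact: bD.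
by rewrite Eu ExZ// uniform_moment; field.
Qed.

Lemma ucdf_third : \int[nu]_z ucdf z ^+ 3 = 0.
Proof.
transitivity (\int[nu]_z ((1 * (ucdf z + 2^-1) ^+ 3 + (- 3 / 2) * (ucdf z + 2^-1) ^+ 2)
   + ((3 / 4) * (ucdf z + 2^-1) ^+ 1 + (- 8^-1) * (ucdf z + 2^-1) ^+ 0))).
  by apply: eq_Rintegral => z _; field.
rewrite ExD; try exact: bD.
by rewrite !Eu; field.
Qed.

Let Eind (A : set R) : measurable A ->
  \int[nu]_y \1_A y = (b - a)^-1 * fine (lebesgue_measure (A `&` `[a, b])).
Proof.
move=> mA; rewrite law_expectation; last first.
  by split; [exact: measurable_indic|exists 1 => y; rewrite indicE; case: (_ \in _); rewrite ?normr1 ?normr0].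
rewrite /Rintegral integral_uniform//; last first.
  by apply/measurable_EFinP; exact: measurable_indic.
rewrite integral_indic// fineM// ge0_fin_numE//.
apply: (@le_lt_trans _ _ (lebesgue_measure `[a, b]%classic)); last first.
  by rewrite lebesgue_measure_itv/= lte_fin ab -EFinB ltry.
by apply: le_measure; rewrite ?inE//; exact: measurableI.
Qed.

(** Clamping makes this true for every real [x], also outside the support, so the kernels built from
    it are centered everywhere and not only almost everywhere. *)
Lemma uniform_lt x : \int[nu]_y (y < x)%R%:R = ucdf x + 2^-1.
Proof.
transitivity (\int[nu]_y \1_`]-oo, x[ y).
  apply: eq_Rintegral => y _; rewrite indicE.
  by congr ((nat_of_bool _)%:R); apply/idP/idP; rewrite inE /= in_itv.
rewrite Eind// /ucdf subrK mulrC; congr (_ * _).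
have [xa|ax] := leP x a.
  rewrite ?max_l// min_r ?(ltW ab)// subrr (_ : _ `&` _ = set0) ?measure0//.
  by apply/seteqP; split => // y [/=]; rewrite !in_itv/= => yx /andP[ay _]; lra.
rewrite ?max_r ?(ltW ax)//; have [bx|xb] := ltP b x.
  rewrite ?min_l ?(ltW bx)// (_ : _ `&` _ = `[a, b]%classic).
    by rewrite lebesgue_measure_itv/= lte_fin ab.
  by apply/seteqP; split => y /=; rewrite !in_itv/=; lra.
rewrite ?min_r// (_ : _ `&` _ = `[a, x[%classic).
  by rewrite lebesgue_measure_itv/= lte_fin ax.
by apply/seteqP; split => y /=; rewrite !in_itv/=; lra.
Qed.

Lemma uniform_gt y : \int[nu]_x (y < x)%R%:R = 2^-1 - ucdf y.
Proof.
transitivity (\int[nu]_x \1_`]y, +oo[ x).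
  apply: eq_Rintegral => x _; rewrite indicE.
  by congr ((nat_of_bool _)%:R); apply/idP/idP; rewrite inE /= in_itv/= andbT.
rewrite Eind//.
have -> : 2^-1 - ucdf y = (b - a)^-1 * (b - Num.min b (Num.max a y)).
  by rewrite /ucdf; field; rewrite gt_eqF.
congr (_ * _).
have [ya|ay] := ltP y a.
  rewrite ?max_l ?(ltW ya)// min_r ?(ltW ab)// (_ : _ `&` _ = `[a, b]%classic).
    by rewrite lebesgue_measure_itv/= lte_fin ab.
  by apply/seteqP; split => x /=; rewrite !in_itv/=; lra.
rewrite ?max_r//; have [bx|xb] := leP b y.
  rewrite ?min_l// subrr (_ : _ `&` _ = set0) ?measure0//.
  by apply/seteqP; split => // x /=; rewrite !in_itv/=; lra.
rewrite ?min_r ?(ltW xb)// (_ : _ `&` _ = `]y, b]%classic).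
  by rewrite lebesgue_measure_itv/= lte_fin xb.
by apply/seteqP; split => x /=; rewrite !in_itv/=; lra.
Qed.

(** The reason why both variables of [neg_kernel] are projected with the same sign. *)
Lemma ucdfN x : a = - b -> ucdf (- x) = - ucdf x.
Proof.
move=> aE; have b0 : 0 < b by move: ab; rewrite aE; lra.
rewrite /ucdf aE.
have -> : Num.min b (Num.max (- b) (- x)) = - Num.min b (Num.max (- b) x).
  by rewrite /Order.min /Order.max; do ![case: ifPn]; rewrite -?leNgt; lra.
rewrite (_ : b - - b = 2 * b); last by ring.
by field; rewrite gt_eqF.
Qed.

End uniform_law.

(** * Orthogonality of degenerate kernels *)

Section orthogonal_sum.
Context {R : realType} {d : measure_display} {T : measurableType d}.
Variable P : probability T R.

Lemma orthogonal_sum_le (J : finType) (D : {set J}) (xi : J -> T -> R) (B : R) :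
  (forall p, bmeas (xi p)) -> (forall p t, `|xi p t| <= B) ->
  (forall p q, p \in D -> q \in D -> p != q -> \int[P]_t (xi p t * xi q t) = 0) ->
  \int[P]_t (\sum_(p in D) xi p t) ^+ 2 <= B ^+ 2 * #|D|%:R.
Proof.
move=> bxi xiB orth.
have bM p q : bmeas (fun t => xi p t * xi q t) by exact: bmeasM.
have -> : \int[P]_t (\sum_(p in D) xi p t) ^+ 2 =
    \sum_(p in D) \sum_(q in D) \int[P]_t (xi p t * xi q t).
  transitivity (\int[P]_t \sum_(p in D) \sum_(q in D) (xi p t * xi q t)).
    apply: eq_Rintegral => t _; rewrite expr2 mulr_suml.
    by apply: eq_bigr => p _; rewrite mulr_sumr.
  rewrite Ex_sum; last by move=> p _; apply: bmeas_sum => q _.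
  by apply: eq_bigr => p _; rewrite Ex_sum.
rewrite -sum1_card natr_sum mulr_sumr; apply: ler_sum => p pD.
rewrite (bigD1 p)//= big1 ?addr0 => [|q /andP[qD qp]]; last by rewrite orth// eq_sym.
rewrite mulr1 -[leRHS](Ex_cst P); apply: Ex_le => //; first exact: bmeas_cst.
move=> t; rewrite -expr2 -real_normK ?num_real// lerXn2r ?nnegrE//.
by rewrite (le_trans _ (xiB p t)).
Qed.

End orthogonal_sum.

Section degenerate_kernels.
Context {R : realType} {d : measure_display} {T : measurableType d}.
Context {P : probability T R} {I : finType} (Z : I -> {RV P >-> R}).
Hypothesis indZ : mutually_independent Z.

(** Everything except [Z j] is frozen, [G] included; the inner integral is then a multiple of the
    partial mean of [h]. *)
Lemma degenerate2_zero (h : R -> R -> R) (i j : I) (G : T -> R) :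
  bmeas (fun x : R * R => h x.1 x.2) -> i != j ->
  (forall x, \int[distribution P (Z j)]_y h x y = 0) ->
  @bmeas _ _ (g_sigma_algebraType (cylinders Z j)) G ->
  \int[P]_t (h (Z i t) (Z j t) * G t) = 0.
Proof.
move=> [mh [M hM]] ij h0 [mG [N GN]].
rewrite (@freezing _ _ _ _ _ _ indZ j (fun x => h (Z i x.1) x.2 * G x.1)).
  rewrite -[RHS](Ex_cst P); apply: eq_Rintegral => t _ /=.
  under eq_Rintegral do rewrite mulrC.
  rewrite ExZ ?h0 ?mulr0//; split; last by exists M => y; exact: (hM (Z i t, y)).
  exact: (measurableT_comp mh (measurable_fun_pair (measurable_cst _) (@measurable_id _ _ setT))).
split; last by exists (M * N) => x; rewrite normrM ler_pM//; exact: (hM (Z i x.1, x.2)).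
apply: measurable_funM; last exact: measurableT_comp.
apply: (measurableT_comp mh (measurable_fun_pair _ _)) => //.
by apply: measurableT_comp => //; exact: measurable_cylinders.
Qed.

Lemma degenerate1_zero (h : R -> R -> R) (i j : I) (G : T -> R) :
  bmeas (fun x : R * R => h x.1 x.2) -> i != j ->
  (forall y, \int[distribution P (Z i)]_x h x y = 0) ->
  @bmeas _ _ (g_sigma_algebraType (cylinders Z i)) G ->
  \int[P]_t (h (Z i t) (Z j t) * G t) = 0.
Proof.
move=> [mh [M hM]] ij h0 bG.
apply: (@degenerate2_zero (fun x y => h y x)) => //; last by rewrite eq_sym.
split; last by exists M => x; exact: (hM (x.2, x.1)).
exact: (measurableT_comp mh (measurable_fun_pair measurable_snd measurable_fst)).
Qed.

End degenerate_kernels.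

Section inversion_kernels.
Context {R : realType} {d : measure_display} {T : measurableType d}.
Context {P : probability T R} {n : nat} (Z : 'I_n -> {RV P >-> R}).
Hypothesis indZ : mutually_independent Z.
Let bpair (h : R -> R -> R) (i j : 'I_n) : bmeas (fun x : R * R => h x.1 x.2) ->
  bmeas (fun t => h (Z i t) (Z j t)).
Proof.
move=> [mh [M hM]]; split; last by exists M => t; exact: (hM (Z i t, Z j t)).
exact: (measurableT_comp mh (measurable_fun_pair _ _)).
Qed.

Let bpair_past (h : R -> R -> R) (k i j : 'I_n) : bmeas (fun x : R * R => h x.1 x.2) ->
  i != k -> j != k ->
  @bmeas _ _ (g_sigma_algebraType (cylinders Z k)) (fun t => h (Z i t) (Z j t)).
Proof.
move=> [mh [M hM]] ik jk; split; last by exists M => t; exact: (hM (Z i t, Z j t)).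
apply: (measurableT_comp mh (measurable_fun_pair _ _)); exact: measurable_cylinders.
Qed.

Definition degenerate (h : R -> R -> R) : Prop :=
  [/\ bmeas (fun x : R * R => h x.1 x.2),
      forall j x, \int[distribution P (Z j)]_y h x y = 0 &
      forall i y, \int[distribution P (Z i)]_x h x y = 0].

Lemma degenerate_mean h i j : degenerate h -> i != j ->
  \int[P]_t h (Z i t) (Z j t) = 0.
Proof.
move=> [bh h2 h1] ij.
have := @degenerate2_zero _ _ _ _ _ _ indZ h i j (fun=> 1) bh ij (h2 j) (bmeas_cst _).
by under eq_Rintegral do rewrite mulr1.
Qed.

Lemma degenerate_pairs_le h (B : R) (D : {set 'I_n * 'I_n}) : degenerate h ->
  (forall x y, `|h x y| <= B) -> (forall p, p \in D -> (p.1 < p.2)%N) ->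
  \int[P]_t (\sum_(p in D) h (Z p.1 t) (Z p.2 t)) ^+ 2 <= B ^+ 2 * #|D|%:R.
Proof.
move=> [bh h2 h1] hB Dlt.
apply: (@orthogonal_sum_le _ _ _ P _ D (fun p t => h (Z p.1 t) (Z p.2 t))).
- by move=> p; exact: bpair.
- by move=> p t; exact: hB.
move=> [i j] [k l] pD qD; have /= ij := Dlt _ pD; have /= kl := Dlt _ qD => pq /=.
have ij' : i != j by rewrite -val_eqE /= ltn_eqF.
(* Two distinct increasing pairs differ as sets, so [i] or [j] is missing from the other pair and
   can be integrated out. The last case contradicts this. *)
have [/andP[ik il]|ikl] := boolP ((k != i) && (l != i)).
  exact: (degenerate1_zero indZ bh ij' (h1 i) (bpair_past bh ik il)).
have [/andP[jk jl]|jkl] := boolP ((k != j) && (l != j)).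
  exact: (degenerate2_zero indZ bh ij' (h2 j) (bpair_past bh jk jl)).
move: pq ikl jkl ij kl; rewrite xpair_eqE -!val_eqE /=; lia.
Qed.

Variables (a b : R) (ab : a < b).
Hypothesis lawZ : forall i, same_law (distribution P (Z i)) (uniform_prob ab).

Let V := ucdf a b.

(* The two indicators minus their mean and their projections on each variable. *)
Definition inv_kernel (x y : R) : R := (y < x)%R%:R - 2^-1 - (V x - V y).

Definition neg_kernel (x y : R) : R := (y < - x)%R%:R - 2^-1 + (V x + V y).

Let mV : measurable_fun setT V.
Proof. exact: measurable_ucdf. Qed.

Let bV' : bmeas V.
Proof. exact: bmeas_ucdf. Qed.

Lemma inv_kernel_le x y : `|inv_kernel x y| <= 2.
Proof.
have := @ucdf_le _ _ _ ab x; have := @ucdf_le _ _ _ ab y; rewrite -/V !ler_norml /inv_kernel.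
by move=> /andP[? ?] /andP[? ?]; case: (y < x)%R => /=; apply/andP; split; lra.
Qed.

Lemma neg_kernel_le x y : `|neg_kernel x y| <= 2.
Proof.
have := @ucdf_le _ _ _ ab x; have := @ucdf_le _ _ _ ab y; rewrite -/V !ler_norml /neg_kernel.
by move=> /andP[? ?] /andP[? ?]; case: (y < - x)%R => /=; apply/andP; split; lra.
Qed.

Let EV i : \int[distribution P (Z i)]_z V z = 0.
Proof. exact: (ucdf_mean (lawZ i)). Qed.

Let blt (f g : R -> R) : measurable_fun setT f -> measurable_fun setT g ->
  bmeas (fun x : R => (f x < g x)%R%:R : R).
Proof. by move=> mf mg; apply: bmeas_bool; exact: measurable_fun_ltr. Qed.

Lemma inv_kernel_degenerate : degenerate inv_kernel.
Proof.
split.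
- split; last by exists 2 => x; exact: inv_kernel_le.
  apply: measurable_funB; first apply: measurable_funB => //.
    by case: (@bmeas_bool R _ (R * R)%type (fun x => x.2 < x.1)%R) => //; exact: measurable_fun_ltr.
  by apply: measurable_funB; exact: measurableT_comp.
- move=> j x; transitivity (\int[distribution P (Z j)]_y (((y < x)%R%:R + V y) + (- 2^-1 - V x))).
    by apply: eq_Rintegral => y _; rewrite /inv_kernel; ring.
  rewrite ExD; [|by apply: bmeasD => //; exact: blt|exact: bmeas_cst].
  rewrite ExD//; last exact: blt.
  by rewrite (uniform_lt (lawZ j)) EV Ex_cst /V; ring.
- move=> i y; transitivity (\int[distribution P (Z i)]_x (((y < x)%R%:R - V x) + (- 2^-1 + V y))).
    by apply: eq_Rintegral => x _; rewrite /inv_kernel; ring.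
  rewrite ExD; [|by apply: bmeasB => //; exact: blt|exact: bmeas_cst].
  rewrite ExB//; last exact: blt.
  by rewrite (uniform_gt (lawZ i)) EV Ex_cst /V; ring.
Qed.

Hypothesis aNb : a = - b.

Lemma neg_kernel_sym x y : neg_kernel x y = neg_kernel y x.
Proof. by rewrite /neg_kernel ltrNr; ring. Qed.

Lemma neg_kernel_degenerate : degenerate neg_kernel.
Proof.
have h j x : \int[distribution P (Z j)]_y neg_kernel x y = 0.
  transitivity (\int[distribution P (Z j)]_y (((y < - x)%R%:R + V y) + (- 2^-1 + V x))).
    by apply: eq_Rintegral => y _; rewrite /neg_kernel; ring.
  rewrite ExD; [|by apply: bmeasD => //; exact: blt|exact: bmeas_cst].
  rewrite ExD//; last exact: blt.
  by rewrite (uniform_lt (lawZ j)) EV Ex_cst ucdfN// -/V; ring.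
split => //; last by move=> i y; under eq_Rintegral do rewrite neg_kernel_sym; exact: h.
split; last by exists 2 => x; exact: neg_kernel_le.
apply: measurable_funD; first apply: measurable_funB => //.
  case: (@bmeas_bool R _ (R * R)%type (fun x => x.2 < - x.1)%R) => //.
  by apply: measurable_fun_ltr => //; exact: measurableT_comp.
by apply: measurable_funD; exact: measurableT_comp.
Qed.

Let g (z : R) : R := (z < 0)%R%:R - 2^-1.

Let bg : bmeas g.
Proof. by apply: bmeasB; [exact: blt|exact: bmeas_cst]. Qed.

Let g_mean i : \int[distribution P (Z i)]_z g z = 0.
Proof.
rewrite /g ExB; [|exact: blt|exact: bmeas_cst].
rewrite (uniform_lt (lawZ i)) Ex_cst.
by have := ucdfN ab 0 aNb; rewrite oppr0; lra.
Qed.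

Lemma neg_mean i : \int[P]_t ((Z i t < 0)%R%:R - 2^-1) = 0.
Proof.
have := @indep_expectation _ _ _ _ _ _ indZ i (fun=> 1) _ (bmeas_cst _) bg.
rewrite g_mean mulr0 => h; apply: etrans h; apply: eq_Rintegral => t _.
by rewrite /g mul1r.
Qed.

Lemma neg_sum_le (D : {set 'I_n}) :
  \int[P]_t (\sum_(i in D) ((Z i t < 0)%R%:R - 2^-1)) ^+ 2 <= #|D|%:R.
Proof.
rewrite -[leRHS]mul1r -[X in X * _](expr1n _ 2).
apply: (@orthogonal_sum_le _ _ _ P _ D (fun i t => g (Z i t))).
- move=> i; have [mg [M gM]] := bg; split; last by exists M => t; exact: gM.
  exact: (measurableT_comp mg).
- by move=> i t; rewrite ler_norml /g; case: (_ < _)%R => /=; apply/andP; split; lra.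
- move=> i j _ _ ij.
  rewrite (@indep_expectation _ _ _ _ _ _ indZ j (fun t => g (Z i t)) g) ?g_mean ?mulr0//.
  have [mg [M gM]] := bg; split; last by exists M => t; exact: gM.
  by apply: (measurableT_comp mg); exact: measurable_cylinders.
Qed.

End inversion_kernels.

Lemma leq_nat_of_bool (a b : bool) : (a -> b) -> (a <= b)%N.
Proof. by case: a; case: b => // /(_ isT). Qed.

(** * Degrees in the graphs of compared indices *)

Section degrees.
Local Open Scope nat_scope.
Variable n : nat.
Implicit Types (D : {set 'I_n * 'I_n}) (i j : 'I_n).

Definition odeg D i : nat := \sum_(j < n) ((i, j) \in D).

Definition ideg D i : nat := \sum_(j < n) ((j, i) \in D).

Lemma sum_ord_itv lo hi : \sum_(j < n) (lo <= j < hi) = minn hi n - lo.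
Proof.
elim: n => [|m IH]; first by rewrite big_ord0; lia.
by rewrite big_ord_recr/= IH; case: leqP; case: ltnP => /=; lia.
Qed.

Lemma card_pairs D : #|D| = \sum_(i < n) odeg D i.
Proof.
rewrite -sum1_card big_mkcond/= /odeg pair_bigA/=.
by apply: eq_bigr => -[i j] _ /=; case: (_ \in _).
Qed.

Lemma odeg_Npairs d i : odeg (Npairs n d) i <= minn d (n - i.+1).
Proof.
apply: (@leq_trans (\sum_(j < n) (i.+1 <= j < i.+1 + d))).
  by apply: leq_sum => j _; rewrite inE /=; apply: leq_nat_of_bool; have := ltn_ord j; lia.
by rewrite sum_ord_itv; lia.
Qed.

(** An equality, where out-degrees are only bounded above: the lower bound on the variance needs
    large in-degrees. *)
Lemma ideg_Npairs d i : ideg (Npairs n d) i = minn i d.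
Proof.
transitivity (\sum_(j < n) (i - d <= j < i)).
  by apply: eq_bigr => j _; rewrite inE /=; congr nat_of_bool; lia.
by rewrite sum_ord_itv; have := ltn_ord i; lia.
Qed.

Lemma odeg_Ntpairs d i : odeg (Ntpairs n d) i <= d.
Proof.
apply: (@leq_trans (\sum_(j < n) (0 <= j < d))); last by rewrite sum_ord_itv; lia.
by apply: leq_sum => j _; rewrite inE /=; apply: leq_nat_of_bool; have := ltn_ord j; lia.
Qed.

Lemma ideg_Ntpairs d i : ideg (Ntpairs n d) i <= d.
Proof.
apply: (@leq_trans (\sum_(j < n) (0 <= j < d))); last by rewrite sum_ord_itv; lia.
by apply: leq_sum => j _; rewrite inE /=; apply: leq_nat_of_bool; have := ltn_ord j; lia.
Qed.

Lemma odeg_set0 i : odeg finset.set0 i = 0.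
Proof. by rewrite /odeg big1// => j _; rewrite inE. Qed.

Lemma ideg_set0 i : ideg finset.set0 i = 0.
Proof. by rewrite /ideg big1// => j _; rewrite inE. Qed.

Lemma card_Npairs d : #|Npairs n d| <= n * d.
Proof.
rewrite card_pairs -[n in n * d]card_ord -sum_nat_const.
by apply: leq_sum => i _; apply: leq_trans (odeg_Npairs d i) _; lia.
Qed.

Lemma card_Ntpairs d : #|Ntpairs n d| <= n * d.
Proof.
rewrite card_pairs -[n in n * d]card_ord -sum_nat_const.
by apply: leq_sum => i _; exact: odeg_Ntpairs.
Qed.

End degrees.

Section linearization.
Context {R : realType} {n : nat}.
Implicit Types (D : {set 'I_n * 'I_n}) (v : 'I_n -> R).

Lemma sum_pairs_fst D v : \sum_(p in D) v p.1 = \sum_i (odeg D i)%:R * v i.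
Proof.
transitivity (\sum_i \sum_j (if (i, j) \in D then v i else 0)).
  by rewrite pair_bigA big_mkcond/=; apply: eq_bigr => -[i j].
apply: eq_bigr => i _; rewrite /odeg natr_sum mulr_suml.
by apply: eq_bigr => j _; case: (_ \in _); rewrite ?mul1r ?mul0r.
Qed.

Lemma sum_pairs_snd D v : \sum_(p in D) v p.2 = \sum_i (ideg D i)%:R * v i.
Proof.
transitivity (\sum_i \sum_j (if (i, j) \in D then v j else 0)).
  by rewrite pair_bigA big_mkcond/=; apply: eq_bigr => -[i j].
rewrite exchange_big; apply: eq_bigr => i _; rewrite /ideg natr_sum mulr_suml.
by apply: eq_bigr => j _; case: (_ \in _); rewrite ?mul1r ?mul0r.
Qed.

Variables (W : weyl_family) (d : nat).

(** Empty sets stand for the missing sums, so that one formula covers the three families. *)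
Definition neg_pairs : {set 'I_n * 'I_n} :=
  match W with
  | WeylS => finset.set0
  | WeylB => Ntpairs n d
  | WeylD => Ntpairs n d.+2
  end.

Definition neg_singles : {set 'I_n} :=
  if W is WeylB then [set i : 'I_n | (i < minn n d)%N]%SET else finset.set0.

(** The weights of the projection: a pair [Z_i > Z_j] contributes [V (Z_i) - V (Z_j)], a pair
    [- Z_i > Z_j] contributes [- V (Z_i) - V (Z_j)]. *)
Definition coef (i : 'I_n) : R :=
  (odeg (Npairs n d) i)%:R - (ideg (Npairs n d) i)%:R
  - (odeg neg_pairs i)%:R - (ideg neg_pairs i)%:R.

Lemma inv_statE (z : 'I_n -> R) : inv_stat W d z =
  \sum_(p in Npairs n d) (z p.2 < z p.1)%R%:R
  + \sum_(p in neg_pairs) (z p.2 < - z p.1)%R%:R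
  + \sum_(i in neg_singles) (z i < 0)%R%:R.
Proof.
rewrite /inv_stat /neg_pairs /neg_singles; case: W.
- by rewrite !big_set0 !addr0.
- by congr (_ + _); apply: eq_bigl => i; rewrite inE.
- by rewrite big_set0 addr0.
Qed.

Hypotheses (d_gt0 : (0 < d)%N) (d_le : (d <= 2 * n)%N).

(** The factor [3] absorbs the shift to [d + 2] for [D_n], as [d] is positive. *)
Let neg_deg i : (odeg neg_pairs i <= 3 * d)%N && (ideg neg_pairs i <= 3 * d)%N.
Proof.
rewrite /neg_pairs; case: W; rewrite ?odeg_set0 ?ideg_set0//.
  by rewrite !(leq_trans (odeg_Ntpairs _ _)) ?(leq_trans (ideg_Ntpairs _ _))//; lia.
by rewrite !(leq_trans (odeg_Ntpairs _ _)) ?(leq_trans (ideg_Ntpairs _ _))//; lia.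
Qed.

Lemma card_neg_pairs : (#|neg_pairs| <= 3 * (n * d))%N.
Proof.
rewrite /neg_pairs; case: W; rewrite ?cards0//.
  by apply: leq_trans (card_Ntpairs _ _) _; lia.
by apply: leq_trans (card_Ntpairs _ _) _; nia.
Qed.

(** The extreme case is negative: one in-degree up to [d] and two negated degrees up to [3 * d]
    each. *)
Lemma coef_le i : `|coef i| <= 7 * d%:R.
Proof.
have /andP[] := neg_deg i; have := odeg_Npairs d i; have := ideg_Npairs d i.
rewrite /coef; set a := odeg _ _; set b := ideg _ _; set a' := odeg _ _; set b' := ideg _ _.
move=> hb ha ha' hb'.
have {}hb : (b%:R : R) <= d%:R by rewrite ler_nat hb; lia.
have {}ha : (a%:R : R) <= d%:R by rewrite ler_nat; lia.
have {}hb' : (b'%:R : R) <= 3 * d%:R by rewrite -natrM ler_nat.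
have {}ha' : (a'%:R : R) <= 3 * d%:R by rewrite -natrM ler_nat.
have := ler0n R a; have := ler0n R b; have := ler0n R a'; have := ler0n R b'.
by rewrite ler_norml => *; apply/andP; split; lra.
Qed.

(* The last d/8 indices have out-degree below d/8 and in-degree above 3d/8. *)
Lemma sum_coef_ge : (8 <= d)%N -> d%:R ^+ 3 / 1024 <= \sum_i coef i ^+ 2.
Proof.
move=> d8; pose q := (d %/ 8)%N.
(* For [8 <= d] rounding down loses at most half. With [q] indices of weight at least [2 * q] the
   sum is at least [4 * q ^+ 3], and [4 / 16 ^+ 3] is [1 / 1024]. *)
have q1 : (16 * q >= d)%N by rewrite /q; lia.
have q2 : (8 * q <= d)%N by rewrite /q; lia.
apply: (@le_trans _ _ (\sum_(i < n) (n - q <= i < n)%N%:R * (2 * q%:R) ^+ 2)).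
  rewrite -mulr_suml -natr_sum sum_ord_itv.
  have -> : (minn n n - (n - q) = q)%N by lia.
  have q3 : (d%:R : R) <= 16 * q%:R by rewrite -natrM ler_nat.
  have -> : q%:R * (2 * q%:R) ^+ 2 = (16 * q%:R) ^+ 3 / 1024 :> R by field.
  have : d%:R ^+ 3 <= (16 * q%:R) ^+ 3 :> R by apply: lerXn2r q3; rewrite nnegrE ?mulr_ge0 ?ler0n.
  by lra.
apply: ler_sum => i _; case: andP => [[ni _]|_]; last by rewrite mul0r sqr_ge0.
(* The negated degrees enter with the same sign as the in-degree and can only enlarge [- coef i]. *)
have h : 2 * q%:R <= - coef i.
  have /= := odeg_Npairs d i; have /= := ideg_Npairs d i.
  rewrite /coef; set a := odeg _ _; set b := ideg _ _; set a' := odeg _ _; set b' := ideg _ _.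
  move=> hb ha.
  have : ((2 * q + a)%N%:R : R) <= b%:R by rewrite ler_nat hb; lia.
  by rewrite natrD natrM; have := ler0n R a'; have := ler0n R b'; lra.
rewrite mul1r -[leRHS]sqrrN lerXn2r ?nnegrE ?mulr_ge0//.
by rewrite (le_trans _ h)// mulr_ge0.
Qed.

End linearization.

Arguments neg_pairs : clear implicits.
Arguments neg_singles : clear implicits.

(** * Hajek decomposition of the inversion statistic *)

Section decomposition.
Context {R : realType} {dT : measure_display} {T : measurableType dT}.
Context {P : probability T R} {n : nat} (Z : 'I_n -> {RV P >-> R}).
Variables (W : weyl_family) (d : nat).
Hypothesis indZ : mutually_independent Z.
Hypothesis lawZ : forall i, same_law (distribution P (Z i)) (uniform_prob (Zlow_lt1 W)).
Hypotheses (d_gt0 : (0 < d)%N) (d_le : (d <= 2 * n)%N).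

Let V : R -> R := ucdf (Zlow W) 1.
Let Y : T -> R := Xinv W d Z.

Definition linear_part (t : T) : R := \sum_(i < n) coef W d i * V (Z i t).

Definition half_count : R :=
  (#|Npairs n d|%:R + #|neg_pairs n W d|%:R + #|neg_singles n W d|%:R) / 2.

Definition remainder (t : T) : R := Y t - half_count - linear_part t.

Let k1 := inv_kernel (Zlow W : R) 1.
Let k2 := neg_kernel (Zlow W : R) 1.

(** The sign indicators of single variables are not projected but kept here: the second moment of
    their centered sum is at most [n], within the order [n d] of the pair kernels. *)
Lemma remainderE t : remainder t =
  \sum_(p in Npairs n d) k1 (Z p.1 t) (Z p.2 t)
  + \sum_(p in neg_pairs n W d) k2 (Z p.1 t) (Z p.2 t)
  + \sum_(i in neg_singles n W d) ((Z i t < 0)%R%:R - 2^-1).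
Proof.
have cst_sum (J : finType) (D : {set J}) : \sum_(p in D) (2^-1 : R) = #|D|%:R / 2.
  by rewrite sumr_const -[LHS]mulr_natl.
rewrite /remainder /Y /Xinv inv_statE.
have -> : \sum_(p in Npairs n d) k1 (Z p.1 t) (Z p.2 t) =
    \sum_(p in Npairs n d) (Z p.2 t < Z p.1 t)%R%:R - #|Npairs n d|%:R / 2
    - (\sum_(i < n) (odeg (Npairs n d) i)%:R * V (Z i t)
       - \sum_(i < n) (ideg (Npairs n d) i)%:R * V (Z i t)).
  rewrite -(@sum_pairs_fst R n _ (fun i => V (Z i t))) -(@sum_pairs_snd R n _ (fun i => V (Z i t))).
  by rewrite -cst_sum -!sumrB; apply: eq_bigr.
have -> : \sum_(p in neg_pairs n W d) k2 (Z p.1 t) (Z p.2 t) =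
    \sum_(p in neg_pairs n W d) (Z p.2 t < - Z p.1 t)%R%:R - #|neg_pairs n W d|%:R / 2
    + (\sum_(i < n) (odeg (neg_pairs n W d) i)%:R * V (Z i t)
       + \sum_(i < n) (ideg (neg_pairs n W d) i)%:R * V (Z i t)).
  rewrite -(@sum_pairs_fst R n _ (fun i => V (Z i t))) -(@sum_pairs_snd R n _ (fun i => V (Z i t))).
  by rewrite -cst_sum -sumrB -!big_split; apply: eq_bigr.
have -> : linear_part t = \sum_(i < n) (odeg (Npairs n d) i)%:R * V (Z i t)
     - \sum_(i < n) (ideg (Npairs n d) i)%:R * V (Z i t)
     - \sum_(i < n) (odeg (neg_pairs n W d) i)%:R * V (Z i t)
     - \sum_(i < n) (ideg (neg_pairs n W d) i)%:R * V (Z i t).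
  rewrite -!sumrB; apply: eq_bigr => i _; rewrite /coef; ring.
by rewrite sumrB cst_sum /half_count; field.
Qed.

Let bV : bmeas V.
Proof. exact: (bmeas_ucdf (Zlow_lt1 W)). Qed.

Let bVZ i : bmeas (fun t => V (Z i t)).
Proof.
have [mV [M VM]] := bV; split; last by exists M => t; exact: VM.
exact: (measurableT_comp mV).
Qed.

Lemma bmeas_linear_part : bmeas linear_part.
Proof. by apply: bmeas_sum => i _; apply: bmeasZ; exact: bVZ. Qed.

Lemma bmeas_Xinv : bmeas Y.
Proof.
split; first exact: measurable_funP.
exists (\sum_(p in Npairs n d) 1 + \sum_(p in neg_pairs n W d) 1 + \sum_(i in neg_singles n W d) 1) => t.
rewrite /Y /Xinv inv_statE.
have le1 (J : finType) (D : {set J}) (b : J -> bool) : `|\sum_(p in D) (b p)%:R| <= \sum_(p in D) (1 : R).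
  apply: le_trans (ler_norm_sum _ _ _) _; apply: ler_sum => p _.
  by case: (b p); rewrite ?normr1 ?normr0.
by do ![apply: le_trans (ler_normD _ _) _; apply: lerD]; exact: le1.
Qed.

Lemma bmeas_remainder : bmeas remainder.
Proof.
apply: bmeasB; last exact: bmeas_linear_part.
by apply: bmeasB; [exact: bmeas_Xinv|exact: bmeas_cst].
Qed.

Let EVZ i k : \int[P]_t V (Z i t) ^+ k = \int[distribution P (Z i)]_z V z ^+ k.
Proof.
have := @indep_expectation _ _ _ _ _ _ indZ i (fun=> 1) _ (bmeas_cst _) (bmeasX k bV).
rewrite Ex_cst mul1r => <-; apply: eq_Rintegral => t _.
by rewrite mul1r.
Qed.

Lemma linear_part_mean : \int[P]_t linear_part t = 0.
Proof.
rewrite Ex_sum; last by move=> i _; exact: bmeasZ.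
rewrite big1// => i _; rewrite ExZ//.
by rewrite (EVZ i 1) (ucdf_mean (lawZ i)) mulr0.
Qed.

Lemma linear_part_var : \int[P]_t linear_part t ^+ 2 = (\sum_(i < n) coef W d i ^+ 2) / 12.
Proof.
pose xi i t := coef W d i * V (Z i t).
have bxi i : bmeas (xi i) by exact: bmeasZ.
have bM i j : bmeas (fun t => xi i t * xi j t) by exact: bmeasM.
transitivity (\int[P]_t \sum_(i < n) \sum_(j < n) (xi i t * xi j t)).
  apply: eq_Rintegral => t _; rewrite expr2 mulr_suml.
  by apply: eq_bigr => p _; rewrite mulr_sumr.
rewrite Ex_sum; last by move=> p _; apply: bmeas_sum => q _.
rewrite mulr_suml; apply: eq_bigr => i _; rewrite Ex_sum// (bigD1 i)//= big1 ?addr0 => [|j ji].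
  transitivity (\int[P]_t (coef W d i ^+ 2 * V (Z i t) ^+ 2)).
    by apply: eq_Rintegral => t _; rewrite /xi; ring.
  by rewrite ExZ ?EVZ ?(ucdf_var (lawZ i))//; exact: bmeasX.
transitivity (\int[P]_t (coef W d i * coef W d j * (V (Z i t) * V (Z j t)))).
  by apply: eq_Rintegral => t _; rewrite /xi; ring.
rewrite ExZ; last exact: bmeasM.
rewrite (@indep_expectation _ _ _ _ _ _ indZ j (fun t => V (Z i t)) V) ?(ucdf_mean (lawZ j)) ?mulr0//.
have [mV [M VM]] := bV; split; last by exists M => t; exact: VM.
by apply: (measurableT_comp mV); apply: measurable_cylinders; rewrite eq_sym.
Qed.

Let neg_low : W <> WeylS -> Zlow W = - 1 :> R.
Proof. by case: W. Qed.

Let neg_pairs_lt p : p \in neg_pairs n W d -> (p.1 < p.2)%N.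
Proof. by rewrite /neg_pairs; case: W; rewrite inE// => /andP[]. Qed.

Let Npairs_lt p : p \in Npairs n d -> (p.1 < p.2)%N.
Proof. by rewrite inE subn_gt0 => /andP[]. Qed.

Let k1_deg : degenerate Z k1 := inv_kernel_degenerate lawZ.

(** For [S_n] the interval is not symmetric and [k2] is not degenerate; there the sum over
    [neg_pairs] is empty. *)
Let k2_deg : W <> WeylS -> degenerate Z k2.
Proof. by move=> /neg_low h; exact: (neg_kernel_degenerate lawZ h). Qed.

Let A t := \sum_(p in Npairs n d) k1 (Z p.1 t) (Z p.2 t).
Let B t := \sum_(p in neg_pairs n W d) k2 (Z p.1 t) (Z p.2 t).
Let C t := \sum_(i in neg_singles n W d) ((Z i t < 0)%R%:R - 2^-1) : R.

Let bk1 p : bmeas (fun t => k1 (Z p.1 t) (Z p.2 t)).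
Proof.
have [[mh [M hM]] _ _] := k1_deg; split; last by exists M => t; exact: (hM (Z p.1 t, Z p.2 t)).
exact: (measurableT_comp mh (measurable_fun_pair _ _)).
Qed.

Let k2_bmeas : bmeas (fun x : R * R => k2 x.1 x.2).
Proof.
split; last by exists 2 => x; exact: neg_kernel_le (Zlow_lt1 W) _ _.
have mV : measurable_fun setT V by case: bV.
apply: measurable_funD; first apply: measurable_funB => //.
  case: (@bmeas_bool R _ (R * R)%type (fun x => x.2 < - x.1)%R) => //.
  by apply: measurable_fun_ltr => //; exact: measurableT_comp.
by apply: measurable_funD; exact: measurableT_comp.
Qed.

Let bk2 p : bmeas (fun t => k2 (Z p.1 t) (Z p.2 t)).
Proof.
have [mh [M hM]] := k2_bmeas; split; last by exists M => t; exact: (hM (Z p.1 t, Z p.2 t)).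
exact: (measurableT_comp mh (measurable_fun_pair _ _)).
Qed.

Let bsingle i : bmeas (fun t => (Z i t < 0)%R%:R - 2^-1 : R).
Proof.
apply: bmeasB; last exact: bmeas_cst.
by apply: bmeas_bool; exact: measurable_fun_ltr.
Qed.

Let bA : bmeas A. Proof. by apply: bmeas_sum => p _; exact: bk1. Qed.
Let bB : bmeas B. Proof. by apply: bmeas_sum => p _; exact: bk2. Qed.
Let bC : bmeas C. Proof. by apply: bmeas_sum => i _; exact: bsingle. Qed.

Let W_cases : W = WeylS \/ W <> WeylS.
Proof. by case: W; [left|right|right]. Qed.

Lemma remainder_mean : \int[P]_t remainder t = 0.
Proof.
transitivity (\int[P]_t (A t + B t + C t)).
  by apply: eq_Rintegral => t _; rewrite remainderE.
rewrite ExD//; last exact: bmeasD.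
rewrite ExD//.
have -> : \int[P]_t A t = 0.
  rewrite Ex_sum// big1// => p /Npairs_lt lt_p; apply: degenerate_mean => //.
  by rewrite -val_eqE /= ltn_eqF.
have -> : \int[P]_t B t = 0.
  rewrite Ex_sum//; case: W_cases => [->|WS]; first by rewrite /neg_pairs big_set0.
  rewrite big1// => p /neg_pairs_lt lt_p; apply: degenerate_mean => //; first exact: k2_deg.
  by rewrite -val_eqE /= ltn_eqF.
have -> : \int[P]_t C t = 0; last by rewrite !addr0.
rewrite Ex_sum//; case: W_cases => [->|WS]; first by rewrite /neg_singles big_set0.
by rewrite big1// => i _; apply: (neg_mean indZ lawZ); exact: neg_low.
Qed.

(** The constant is [3 * (4 + 12 + 1)]: a square of three terms, kernels bounded by [2], at most
    [n d] and [3 n d] pairs, and at most [n] signs. *)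
Lemma remainder_var : \int[P]_t remainder t ^+ 2 <= 51 * (n%:R * d%:R).
Proof.
have hA : \int[P]_t A t ^+ 2 <= 4 * (n%:R * d%:R).
  have := degenerate_pairs_le indZ k1_deg (inv_kernel_le (Zlow_lt1 W)) Npairs_lt.
  move=> h; apply: le_trans h _; rewrite (_ : 2 ^+ 2 = 4); last by ring.
  by rewrite ler_wpM2l// -natrM ler_nat card_Npairs.
have hB : \int[P]_t B t ^+ 2 <= 12 * (n%:R * d%:R).
  case: W_cases => [WE|WS].
    rewrite [leLHS](_ : _ = 0) ?mulr_ge0//.
    rewrite -[RHS](Ex_cst P); apply: eq_Rintegral => t _.
    by rewrite /B WE /neg_pairs big_set0 expr0n.
  have := degenerate_pairs_le indZ (k2_deg WS) (neg_kernel_le (Zlow_lt1 W)) neg_pairs_lt.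
  move=> h; apply: le_trans h _.
  have := card_neg_pairs W d_gt0 d_le; rewrite -(ler_nat R) !natrM; lra.
have hC : \int[P]_t C t ^+ 2 <= n%:R * d%:R.
  apply: (@le_trans _ _ n%:R); last by rewrite -natrM ler_nat leq_pmulr.
  case: W_cases => [WE|WS].
    rewrite [leLHS](_ : _ = 0)//.
    rewrite -[RHS](Ex_cst P); apply: eq_Rintegral => t _.
    by rewrite /C WE /neg_singles big_set0 expr0n.
  apply: le_trans (neg_sum_le indZ lawZ (neg_low WS) _) _.
  by rewrite ler_nat -[leqRHS]card_ord max_card.
have b2 f : bmeas f -> bmeas (fun t : T => f t ^+ 2 : R) by exact: bmeasX.
apply: (@le_trans _ _ (\int[P]_t (3 * (A t ^+ 2 + B t ^+ 2 + C t ^+ 2)))).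
  apply: Ex_le; first exact/b2/bmeas_remainder.
    by apply: bmeasZ; apply: bmeasD; [apply: bmeasD|]; exact: b2.
  move=> t; rewrite remainderE -/(A t) -/(B t) -/(C t).
  by have := sqr_ge0 (A t - B t); have := sqr_ge0 (A t - C t); have := sqr_ge0 (B t - C t); lra.
rewrite ExZ; last by apply: bmeasD; [apply: bmeasD|]; exact: b2.
rewrite ExD; [|by apply: bmeasD; exact: b2|exact: b2].
rewrite ExD; [|exact: b2|exact: b2].
lra.
Qed.

Lemma Xinv_mean : fine 'E_P[Y] = half_count.
Proof.
transitivity (\int[P]_t Y t); first by rewrite unlock.
have : \int[P]_t remainder t = 0 := remainder_mean.
rewrite /remainder ExB; [|by apply: bmeasB; [exact: bmeas_Xinv|exact: bmeas_cst]|exact: bmeas_linear_part].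
rewrite ExB; [|exact: bmeas_Xinv|exact: bmeas_cst].
rewrite Ex_cst linear_part_mean; lra.
Qed.

Lemma Xinv_var : fine 'V_P[Y] = \int[P]_t (linear_part t + remainder t) ^+ 2.
Proof.
rewrite /variance unlock Xinv_mean unlock; apply: eq_Rintegral => t _.
have -> : linear_part t + remainder t = Y t - half_count by rewrite /remainder addrC subrK.
by rewrite expr2.
Qed.

(** Young's inequality on the cross term. The parameter is later set to [sqrt n / d], which balances
    the two contributions. *)
Lemma Xinv_var_close (lam : R) : 0 < lam ->
  `|fine 'V_P[Y] - (\sum_(i < n) coef W d i ^+ 2) / 12| <=
   lam * ((\sum_(i < n) coef W d i ^+ 2) / 12) + (1 + lam^-1) * (51 * (n%:R * d%:R)).
Proof.
move=> l0; set s2 := _ / 12.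
have bS := bmeas_linear_part; have bR := bmeas_remainder.
rewrite Xinv_var.
have E1 : \int[P]_t (linear_part t + remainder t) ^+ 2 = s2 + \int[P]_t (2 * (linear_part t * remainder t))
    + \int[P]_t remainder t ^+ 2.
  rewrite /s2 -linear_part_var -ExD; [|exact: bmeasX|by apply: bmeasZ; exact: bmeasM].
  rewrite -ExD; [|by apply: bmeasD; [exact: bmeasX|by apply: bmeasZ; exact: bmeasM]|exact: bmeasX].
  by apply: eq_Rintegral => t _; ring.
rewrite E1 [X in `|X|](_ : _ = \int[P]_t (2 * (linear_part t * remainder t))
  + \int[P]_t remainder t ^+ 2); last by ring.
have R0 : 0 <= \int[P]_t remainder t ^+ 2 by apply: Ex_ge0 => t; exact: sqr_ge0.
have key t : `|2 * (linear_part t * remainder t)| <= lam * linear_part t ^+ 2 + lam^-1 * remainder t ^+ 2.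
  set u := linear_part t; set v := remainder t.
  have h1 : 0 <= lam^-1 * (lam * u - v) ^+ 2 by rewrite mulr_ge0 ?sqr_ge0// invr_ge0 ltW.
  have h2 : 0 <= lam^-1 * (lam * u + v) ^+ 2 by rewrite mulr_ge0 ?sqr_ge0// invr_ge0 ltW.
  have e1 : lam^-1 * (lam * u - v) ^+ 2 = lam * u ^+ 2 + lam^-1 * v ^+ 2 - 2 * (u * v) by field; rewrite gt_eqF.
  have e2 : lam^-1 * (lam * u + v) ^+ 2 = lam * u ^+ 2 + lam^-1 * v ^+ 2 + 2 * (u * v) by field; rewrite gt_eqF.
  by rewrite ler_norml; apply/andP; split; lra.
have bcross : bmeas (fun t => 2 * (linear_part t * remainder t)) by apply: bmeasZ; exact: bmeasM.
apply: le_trans (ler_normD _ _) _; rewrite (ger0_norm R0).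
apply: le_trans (lerD (Ex_norm P bcross) (lexx _)) _.
have : \int[P]_t `|2 * (linear_part t * remainder t)| <= lam * s2 + lam^-1 * \int[P]_t remainder t ^+ 2.
  rewrite /s2 -linear_part_var -!ExZ; try exact: bmeasX.
  rewrite -ExD; try by apply: bmeasZ; exact: bmeasX.
  apply: Ex_le => //; last by apply: bmeasD; apply: bmeasZ; exact: bmeasX.
  by have [mc [M cM]] := bcross; split; [exact: measurableT_comp|exists M => t; rewrite normr_id].
have := remainder_var; set r2 := Rintegral _ _ _ => hr h.
have l1 : lam^-1 * r2 <= lam^-1 * (51 * (n%:R * d%:R)) by rewrite ler_wpM2l// invr_ge0 ltW.
lra.
Qed.

End decomposition.

Arguments half_count {R} n W d.

(** * Limits of sequences and the Gaussian tail at the extremal threshold *)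

Section sequences_at_infinity.
Context {R : realType}.
Implicit Types (u v L M : nat -> R).

Lemma cvg0_norm_le u v : (\forall n \near \oo, `|u n| <= v n) ->
  v n @[n --> \oo] --> (0 : R) -> u n @[n --> \oo] --> (0 : R).
Proof.
move=> uv v0; apply: (@squeeze_cvgr _ _ _ _ (fun n => - v n) v) => //.
  by apply: filterS uv => n; rewrite ler_norml.
by rewrite -[X in _ --> X]oppr0; exact: cvgN.
Qed.

Lemma cvgV_infty L : L n @[n --> \oo] --> +oo -> (L n)^-1 @[n --> \oo] --> (0 : R).
Proof.
move=> Ly; apply/gtr0_cvgV0 => //.
by move/cvgryPgt : Ly => /(_ 0).
Qed.

Lemma ln_cvg_infty L : L n @[n --> \oo] --> +oo -> ln (L n) @[n --> \oo] --> +oo.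
Proof.
move=> /cvgryPge Ly; apply/cvgryPge => A.
apply: filterS (Ly (expR A)) => n h.
by rewrite -[leLHS]expRK ler_ln ?posrE ?expR_gt0// (lt_le_trans _ h)// expR_gt0.
Qed.

Lemma exprn_div_expR_cvg0 M (j : nat) : M n @[n --> \oo] --> +oo ->
  M n ^+ j / expR (M n) @[n --> \oo] --> (0 : R).
Proof.
move=> My; apply: (@cvg0_norm_le _ (fun n => (j.+1)`!%:R * (M n)^-1)); last first.
  by rewrite -[X in _ --> X](mulr0 ((j.+1)`!%:R : R)); apply: cvgM; [exact: cvg_cst|exact: cvgV_infty].
move/cvgryPgt : My => /(_ 0); apply: filterS => n M0.
rewrite ger0_norm ?divr_ge0 ?exprn_ge0 ?expR_ge0 ?(ltW M0)//.
rewrite ler_pdivrMr ?expR_gt0// mulrAC ler_pdivlMr// -exprSr.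
have h := expR_ge1Dxn j (ltW M0).
have f0 : 0 < (j.+1)`!%:R :> R by rewrite ltr0n fact_gt0.
rewrite -ler_pdivrMl//; apply: le_trans h; rewrite mulrC; lra.
Qed.

End sequences_at_infinity.

Section gaussian_tail_asymptotics.
Context {R : realType}.
Variables (L gam : nat -> R) (y : R).
Hypothesis Ly : L n @[n --> \oo] --> +oo.
Hypothesis gamL : gam n * L n @[n --> \oo] --> (0 : R).

Let v n : R := Num.sqrt (2 * L n).
(** Chosen so that [expR (q n)] equals [sqrt (2 pi) * v n * expR (- y)], which cancels the prefactor
    of the Mills ratio. The threshold [w] is [v (1 - q / (2 L))] divided by the standard deviation,
    so [w ^+ 2 / 2] is about [L - q]. *)
Let q n : R := 2^-1 * (ln (L n) + ln (4 * pi)) - y.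
Let w n : R := (v n - 2^-1 * (v n)^-1 * (ln (L n) + ln (4 * pi)) + (v n)^-1 * y)
                 / Num.sqrt (1 + gam n).

Let L_gt : forall A : R, \forall n \near \oo, A < L n.
Proof. by move/cvgryPgt : Ly. Qed.

Let gam0 : gam n @[n --> \oo] --> (0 : R).
Proof.
apply: (@cvg0_norm_le _ _ (fun n => `|gam n * L n|)).
  apply: filterS (L_gt 1) => n L1; rewrite normrM ler_peMr// ger0_norm//; lra.
by rewrite -[X in _ --> X](normr0 R); exact: cvg_norm.
Qed.

Let VL0 : (L n)^-1 @[n --> \oo] --> (0 : R).
Proof. exact: cvgV_infty. Qed.

Let lnL0 j : ln (L n) ^+ j / L n @[n --> \oo] --> (0 : R).
Proof.
have h := @exprn_div_expR_cvg0 _ _ j (ln_cvg_infty Ly).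
apply: cvg_trans h; apply: near_eq_cvg.
by apply: filterS (L_gt 0) => n L0; rewrite lnK.
Qed.

Let cM c (u : nat -> R) : u n @[n --> \oo] --> (0 : R) -> c * u n @[n --> \oo] --> (0 : R).
Proof.
by move=> u0; rewrite -[X in _ --> X](mulr0 c); apply: cvgM => //; exact: cvg_cst.
Qed.

Let cD (u u' : nat -> R) : u n @[n --> \oo] --> (0 : R) -> u' n @[n --> \oo] --> (0 : R) ->
  u n + u' n @[n --> \oo] --> (0 : R).
Proof. by move=> h h'; rewrite -[X in _ --> X](addr0 (0 : R)); exact: cvgD. Qed.

Let qL0 : q n / L n @[n --> \oo] --> (0 : R).
Proof.
have -> : (fun n => q n / L n) = (fun n => 2^-1 * (ln (L n) ^+ 1 / L n) + (2^-1 * ln (4 * pi) - y) * (L n)^-1).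
  by apply/funext => n; rewrite /q; ring.
by apply: cD; exact: cM.
Qed.

Let q2L0 : q n ^+ 2 / L n @[n --> \oo] --> (0 : R).
Proof.
pose c : R := 2^-1 * ln (4 * pi) - y.
have -> : (fun n => q n ^+ 2 / L n) = (fun n => (4^-1 * (ln (L n) ^+ 2 / L n)
    + c * (ln (L n) ^+ 1 / L n)) + c ^+ 2 * (L n)^-1).
  by apply/funext => n; rewrite /q /c; set i := (L n)^-1; field.
by do ![apply: cD]; exact: cM.
Qed.

(** The exact errors: [L - w ^+ 2 / 2 = q + r] and [1 / w = g / v]. The leading part of [r] is
    [gam n * L n], whence the assumption on that product. *)
Let r n : R := (gam n * L n - (gam n * L n) * (q n / L n) - 4^-1 * (q n ^+ 2 / L n)) / (1 + gam n).
Let g n : R := Num.sqrt (1 + gam n) / (1 - 2^-1 * (q n / L n)).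

Let r0 : r n @[n --> \oo] --> (0 : R).
Proof.
have E : (0 - 0 * 0 - 4^-1 * 0) / (1 + 0) = 0 :> R by ring.
rewrite -[X in _ --> X]E.
apply: cvgM; last first.
  apply: cvgV; first by rewrite addr0 oner_neq0.
  by apply: cvgD => //; exact: cvg_cst.
apply: cvgB; first by apply: cvgB => //; exact: cvgM.
by apply: cvgM => //; exact: cvg_cst.
Qed.

Let g1 : g n @[n --> \oo] --> (1 : R).
Proof.
have E : Num.sqrt (1 + 0) / (1 - 2^-1 * 0) = 1 :> R.
  by rewrite addr0 sqrtr1 mulr0 subr0 divr1.
rewrite -[X in _ --> X]E.
apply: cvgM; last first.
  apply: cvgV; first by rewrite mulr0 subr0 oner_neq0.
  by apply: cvgB; [exact: cvg_cst|apply: cvgM => //; exact: cvg_cst].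
apply: (cvg_comp (fun n => 1 + gam n) Num.sqrt); last exact: sqrt_continuous.
by apply: cvgD => //; exact: cvg_cst.
Qed.

Let near_good : \forall n \near \oo, [/\ 0 < L n, 0 < 1 + gam n & 0 < 1 - 2^-1 * (q n / L n)].
Proof.
near=> n; split; first by near: n; exact: L_gt.
  have : `|gam n| < 1 by near: n; move/cvgr0Pnorm_lt : gam0; apply.
  by rewrite ltr_norml => /andP[? ?]; lra.
have : `|q n / L n| < 1 by near: n; move/cvgr0Pnorm_lt : qL0; apply.
by rewrite ltr_norml => /andP[? ?]; lra.
Unshelve. all: by end_near. Qed.

Let wE n : 0 < L n -> w n = v n * (1 - 2^-1 * (q n / L n)) / Num.sqrt (1 + gam n).
Proof.
move=> L0; have v0 : v n != 0 by rewrite gt_eqF// sqrtr_gt0 mulr_gt0.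
have LE : L n = v n ^+ 2 / 2 by rewrite sqr_sqrtr ?mulr_ge0 ?(ltW L0)//; field.
have LV : (L n)^-1 = 2 * (v n)^-1 ^+ 2 by rewrite LE; field.
rewrite /w /q LV; set c := ln (L n) + _; set vn := v n in v0 *.
by congr (_ / _); field.
Qed.

Let pdf_wE n : 0 < L n -> 0 < 1 + gam n -> 0 < 1 - 2^-1 * (q n / L n) ->
  expR (L n) * (gpdf (w n) / w n) = expR (- y) * expR (r n) * g n.
Proof.
move=> L0 gm0 q0; have v0 : 0 < v n by rewrite sqrtr_gt0 mulr_gt0.
have s0 : 0 < Num.sqrt (1 + gam n) by rewrite sqrtr_gt0.
have vv : v n ^+ 2 = 2 * L n by rewrite sqr_sqrtr// mulr_ge0// ltW.
have ss : Num.sqrt (1 + gam n) ^+ 2 = 1 + gam n by rewrite sqr_sqrtr// ltW.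
have Ln0 : L n != 0 by rewrite gt_eqF.
have gn0 : 1 + gam n != 0 by rewrite gt_eqF.
have ww : L n + - w n ^+ 2 / 2 = q n + r n.
  rewrite (wE L0) exprMn exprVn ss exprMn vv /r; field.
  by rewrite Ln0 gn0.
have eq : expR (q n) = Num.sqrt (2 * pi) * v n * expR (- y).
  rewrite /q expRD; congr (_ * _).
  rewrite -lnM ?posrE ?mulr_gt0 ?pi_gt0//.
  have e : 0 < L n * (4 * pi) by rewrite !mulr_gt0 ?pi_gt0.
  rewrite /v -sqrtrM ?mulr_ge0 ?pi_ge0// (_ : 2 * pi * (2 * L n) = L n * (4 * pi)); last by ring.
  apply/eqP; rewrite -(@eqrXn2 _ 2)// ?expR_ge0 ?sqrtr_ge0// sqr_sqrtr ?(ltW e)//.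
  have -> l : expR (2^-1 * l) ^+ 2 = expR l :> R by rewrite expr2 -expRD; congr expR; field.
  by rewrite lnK.
have p0 : 0 < Num.sqrt (2 * pi) :> R by rewrite sqrtr_gt0 mulr_gt0 ?pi_gt0.
transitivity ((Num.sqrt (2 * pi))^-1 * expR (L n + - w n ^+ 2 / 2) / w n).
  by rewrite expRD /gpdf; ring.
rewrite ww expRD eq (wE L0) /g; move: q0; set Q := 1 - _ => q0.
by field; rewrite !gt_eqF.
Qed.

Lemma gaussian_tail_limit :
  expR (L n) * (1 - Phi (w n)) @[n --> \oo] --> expR (- y).
Proof.
have h1 : expR (L n) * (gpdf (w n) / w n) @[n --> \oo] --> expR (- y).
  have H : expR (- y) * expR (r n) * g n @[n --> \oo] --> expR (- y) * expR 0 * 1.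
    apply: cvgM => //; apply: cvgM; first exact: cvg_cst.
    exact: (cvg_comp _ _ r0 (@continuous_expR R 0)).
  rewrite expR0 !mulr1 in H; apply: cvg_trans H; apply: near_eq_cvg.
  by apply: filterS near_good => n [L0 gm0 q0]; rewrite pdf_wE.
have h2 : (w n)^-1 ^+ 2 @[n --> \oo] --> (0 : R).
  have H : g n ^+ 2 * (2^-1 * (L n)^-1) @[n --> \oo] --> (1 ^+ 2 * 0 : R).
    apply: cvgM; last exact: cM.
    exact: (cvg_comp _ _ g1 (@exprn_continuous _ 2 _)).
  rewrite mulr0 in H; apply: cvg_trans H; apply: near_eq_cvg.
  apply: filterS near_good => n [L0 gm0 q0]; rewrite (wE L0) /g.
  have vv : v n ^+ 2 = 2 * L n by rewrite sqr_sqrtr// mulr_ge0// ltW.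
  have -> : 2^-1 * (L n)^-1 = (v n ^+ 2)^-1 by rewrite vv invfM.
  have v0 : v n != 0 by rewrite gt_eqF// sqrtr_gt0 mulr_gt0.
  have s0 : Num.sqrt (1 + gam n) != 0 by rewrite gt_eqF// sqrtr_gt0.
  move: q0; set Q := 1 - _ => q0; have {q0} : Q != 0 by rewrite gt_eqF.
  by move=> Q0; field; rewrite s0 v0 Q0.
apply: (@squeeze_cvgr _ _ _ _ (fun n => expR (L n) * (gpdf (w n) / w n) * (1 - (w n)^-1 ^+ 2)) (fun n => expR (L n) * (gpdf (w n) / w n))) => //; last first.
  by rewrite -[X in _ --> X]mulr1 -[X in _ * X](subr0 (1 : R)); apply: cvgM => //; apply: cvgB => //; exact: cvg_cst.
apply: filterS near_good => n [L0 gm0 q0].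
have w0 : 0 < w n.
  by rewrite (wE L0) divr_gt0 ?mulr_gt0 ?sqrtr_gt0// mulr_gt0.
apply/andP; split.
  rewrite -mulrA ler_wpM2l ?expR_ge0//; apply: le_trans (Phi_tail_lb w0).
  by rewrite le_eqVlt; apply/orP; left; apply/eqP; ring.
by rewrite ler_wpM2l ?expR_ge0// Phi_tail_ub.
Qed.

End gaussian_tail_asymptotics.

(** * Tail bounds for the inversion statistic *)

Section Xinv_tail.
Context {R : realType} {dT : measure_display} {T : measurableType dT}.
Context {P : probability T R} {n : nat} (Z : 'I_n -> {RV P >-> R}).
Variables (W : weyl_family) (d : nat).
Hypothesis indZ : mutually_independent Z.
Hypothesis lawZ : forall i, same_law (distribution P (Z i)) (uniform_prob (Zlow_lt1 W)).
Hypotheses (d_gt0 : (0 < d)%N) (d_le : (d <= 2 * n)%N).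

Variables (sigma theta delta2 vr s : R).
Hypothesis sigma_gt0 : 0 < sigma.
Hypotheses (theta_ge0 : 0 <= theta) (theta_a : forall i : 'I_n, theta * `|coef W d i / sigma| <= 1).
Hypothesis delta2_gt0 : 0 < delta2.
Hypothesis vrE : vr = (\sum_(i < n) (coef W d i / sigma) ^+ 2) / 12.
Hypothesis vr_le : delta2 + vr <= 4.
Hypothesis theta4_le : theta ^+ 4 * (\sum_(i < n) (coef W d i / sigma) ^+ 4) <= 1.
Hypotheses (delta_le : Num.sqrt delta2 <= s) (theta_s : theta * delta2 <= s).

Let Y := Xinv W d Z.
Let V : R -> R := ucdf (Zlow W) 1.
Let Sn t : R := \sum_(i < n) coef W d i / sigma * V (Z i t).
Let err v := tail_error (fun i : 'I_n => coef W d i / sigma) theta delta2 vr s v.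

Let SnE t : linear_part Z W d t = sigma * Sn t.
Proof.
rewrite /Sn mulr_sumr; apply: eq_bigr => i _.
by rewrite mulrA (mulrC sigma) divfK ?gt_eqF.
Qed.

Let s_gt0 : 0 < s.
Proof. by rewrite (lt_le_trans _ delta_le)// sqrtr_gt0. Qed.

(** Chebyshev's inequality in pointwise form: nonnegative, and at least [1] once the remainder
    exceeds [sigma * s] in absolute value, so it can be added to an indicator before integrating. *)
Let rest t : R := remainder Z W d t ^+ 2 / (sigma * s) ^+ 2.

Let ss_gt0 : 0 < (sigma * s) ^+ 2.
Proof. by rewrite exprn_gt0// mulr_gt0. Qed.

Let brest : bmeas rest.
Proof. by apply: bmeasM; [apply: bmeasX; exact: bmeas_remainder|exact: bmeas_cst]. Qed.

Let Erest : \int[P]_t rest t <= 51 * (n%:R * d%:R) / (sigma * s) ^+ 2.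
Proof.
rewrite /rest; under eq_Rintegral do rewrite mulrC.
rewrite ExZ; last by apply: bmeasX; exact: bmeas_remainder.
rewrite mulrC ler_wpM2r ?invr_ge0 ?(ltW ss_gt0)//.
exact: remainder_var.
Qed.

Let bYgt v : bmeas (fun t => (v < Y t)%R%:R : R).
Proof. by apply: bmeas_bool; apply: measurable_fun_ltr => //; exact: measurable_funP. Qed.

Let bSgt v : bmeas (fun t => (v < Sn t)%R%:R : R).
Proof.
apply: bmeas_bool; apply: measurable_fun_ltr => //.
have [mS _] := bmeas_linear_part Z W d.
have -> : Sn = (fun t => sigma^-1 * linear_part Z W d t).
  by apply/funext => t; rewrite SnE mulKf ?gt_eqF.
exact: measurable_funM.
Qed.

Let YE t : Y t = half_count n W d + sigma * Sn t + remainder Z W d t.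
Proof. by rewrite -SnE /remainder -/Y; ring. Qed.

Let mV : measurable_fun setT V.
Proof. by case: (bmeas_ucdf (Zlow_lt1 W : Zlow W < 1 :> R)). Qed.

Let upper := @tail_upper _ _ _ _ _ _ indZ V mV (ucdf_le (Zlow_lt1 W))
  (fun i => ucdf_mean (lawZ i)) (fun i => ucdf_var (lawZ i)) (fun i => ucdf_third (lawZ i))
  _ _ _ _ _ theta_ge0 theta_a delta2_gt0 vrE vr_le theta4_le delta_le.

Let lower := @tail_lower _ _ _ _ _ _ indZ V mV (ucdf_le (Zlow_lt1 W))
  (fun i => ucdf_mean (lawZ i)) (fun i => ucdf_var (lawZ i)) (fun i => ucdf_third (lawZ i))
  _ _ _ _ _ theta_ge0 theta_a delta2_gt0 vrE vr_le theta4_le delta_le theta_s.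

(** The slack is spent twice, once on the remainder and once on smoothing, which explains [2 * s] in
    the Gaussian term. *)
Lemma Xinv_tail_upper u :
  \int[P]_t (sigma * u + half_count n W d < Y t)%R%:R <=
  1 - Phi ((u - 2 * s) / Num.sqrt (delta2 + vr)) + err (u - s)
  + 51 * (n%:R * d%:R) / (sigma * s) ^+ 2.
Proof.
have h1 := upper (u - s).
have -> : u - 2 * s = u - s - s by ring.
apply: le_trans (lerD h1 Erest).
rewrite -ExD//; apply: Ex_le => //; first exact: bmeasD.
move=> t; rewrite YE -/(Sn t).
have r0 : 0 <= rest t by rewrite divr_ge0 ?sqr_ge0// ltW.
have [_|] := leP; first by rewrite addr_ge0.
move=> hlt; have [hle|_] := leP (Sn t) (u - s); last by rewrite lerDl.
rewrite add0r /rest ler_pdivlMr// mul1r lerXn2r ?nnegrE ?mulr_ge0 ?(ltW sigma_gt0) ?(ltW s_gt0)//.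
  have := ler_wpM2l (ltW sigma_gt0) hle; rewrite mulrBr.
  have := mulr_gt0 sigma_gt0 s_gt0; lra.
have := ler_wpM2l (ltW sigma_gt0) hle; rewrite mulrBr; lra.
Qed.

Lemma Xinv_tail_lower u :
  1 - Phi ((u + 2 * s) / Num.sqrt (delta2 + vr)) - err (u + s)
  - 51 * (n%:R * d%:R) / (sigma * s) ^+ 2
  <= \int[P]_t (sigma * u + half_count n W d < Y t)%R%:R.
Proof.
have h1 := lower (u + s).
have -> : u + 2 * s = u + s + s by ring.
apply: le_trans (lerB h1 Erest) _.
rewrite -ExB//; apply: Ex_le => //; first exact: bmeasB.
move=> t; rewrite YE -/(Sn t).
have r0 : 0 <= rest t by rewrite divr_ge0 ?sqr_ge0// ltW.
have [hlt|_] := ltP (u + s) (Sn t); last first.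
  by rewrite sub0r (le_trans _ (ler0n _ _))// oppr_le0.
have [_|hle] := ltP (sigma * u + _); first by rewrite gerBl.
rewrite subr_le0 /rest ler_pdivlMr// mul1r -[leRHS]sqrrN.
have := ltr_pM2l sigma_gt0 (u + s) (Sn t); rewrite hlt mulrDr => hlt'.
have := mulr_gt0 sigma_gt0 s_gt0 => ss0.
by rewrite lerXn2r ?nnegrE; lra.
Qed.

End Xinv_tail.

Section tail_error_bound.
Context {R : realType}.
Variables (L eta y g S4 D : R).
Hypotheses (L_ge1 : 1 <= L) (eta_gt0 : 0 < eta) (D_gt0 : 0 < D).

Let v : R := Num.sqrt (2 * L).
Let al : R := v^-1.

Let v_gt0 : 0 < v.
Proof. by rewrite sqrtr_gt0; have := L_ge1; lra. Qed.

Let vv : v ^+ 2 = 2 * L.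
Proof. by rewrite sqr_sqrtr//; have := L_ge1; lra. Qed.

(* The exponential factor of [tail_error], evaluated at the threshold
   [beta + alpha y]. *)
Lemma tilt_factorE :
  expR L * expR (v ^+ 2 / 2 * (1 + g)
     - v * (v - 2^-1 * al * (ln L + ln (4 * pi)) + al * y))
  = Num.sqrt (4 * pi * L) * expR (- y) * expR (g * L).
Proof.
have v0 : v != 0 by rewrite gt_eqF.
have L0 : 0 < L by have := L_ge1; lra.
have p0 : 0 < 4 * pi :> R by rewrite mulr_gt0 ?pi_gt0.
have -> : Num.sqrt (4 * pi * L) = expR (2^-1 * (ln L + ln (4 * pi))).
  have e : expR (2^-1 * (ln L + ln (4 * pi))) ^+ 2 = 4 * pi * L.
    rewrite expr2 -expRD (_ : _ + _ = ln L + ln (4 * pi)); last by field.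
    by rewrite expRD !lnK// mulrC.
  by rewrite -e sqrtr_sqr ger0_norm ?expR_ge0.
rewrite -!expRD; congr expR.
rewrite (_ : v * (_ - _ + _) = v ^+ 2 - 2^-1 * (ln L + ln (4 * pi)) + y); last first.
  by rewrite /al; field.
by rewrite vv; field.
Qed.

(** The power [al ^- 8] is [16 * L ^+ 4], and [1 + 2 * v <= 5 * L]; hence [2000 = 125 * 16]. *)
Lemma heat_const_bound : heat_const (al ^+ 4) v <= 256 * 2000 * L ^+ 7.
Proof.
have vL : v <= 2 * L.
  have : 1 <= v.
    by rewrite -[leLHS]sqrtr1 ler_sqrt; have := L_ge1; lra.
  by move=> v1; rewrite -vv expr2 ler_peMl// ltW.
have L0 : 0 <= L by have := L_ge1; lra.
rewrite /heat_const /al.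
have -> : (v^-1 ^+ 4 ^+ 2)^-1 = 16 * L ^+ 4.
  have v0 : v != 0 by rewrite gt_eqF.
  have -> : 16 * L ^+ 4 = (2 * L) ^+ 4 by ring.
  by rewrite -vv; field.
have h : (1 + 2 * v) ^+ 3 <= (5 * L) ^+ 3.
  apply: lerXn2r; rewrite ?nnegrE; have := L_ge1; have := v_gt0; lra.
have L4 : 0 <= 16 * L ^+ 4 by rewrite mulr_ge0// exprn_ge0.
rewrite -mulrA; have := ler_wpM2r L4 h; have -> : (5 * L) ^+ 3 * (16 * L ^+ 4) = 2000 * L ^+ 7 by ring.
by set u := _ * (16 * _); set t := L ^+ 7; lra.
Qed.

Hypothesis S4_ge0 : 0 <= S4.
Variable A : R.
Hypothesis S4_le : S4 <= A / D.

(** This is [k] times [tail_error], as [expR L] is [k]. With smoothing variance [al ^+ 4] and slack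
    [eta * al] the smoothing exponent becomes [eta ^+ 2 * L], which beats every power of [L]. The
    factor [sqrt (4 pi L)] left by the tilt is weakened to [4 pi L]. *)
Lemma tail_error_bound :
  expR L * ((heat_const (al ^+ 4) v * S4 * expR (v * (eta * al) + 2)
     + expR (1 - (eta * al) ^+ 2 / (2 * al ^+ 4)))
   * expR (v ^+ 2 / 2 * (1 + g) - v * (v - 2^-1 * al * (ln L + ln (4 * pi)) + al * y)))
  <= 4 * pi * expR (- y) * expR (g * L) * (256 * 2000 * A * expR (eta + 2) * (L ^+ 8 / D)
     + expR 1 * (L / expR (eta ^+ 2 * L))).
Proof.
have v0 : v != 0 by rewrite gt_eqF.
have L0 : 0 <= L by have := L_ge1; lra.
have L1 := L_ge1.
rewrite mulrCA tilt_factorE.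
have -> : v * (eta * al) = eta by rewrite /al; field.
have -> : (eta * al) ^+ 2 / (2 * al ^+ 4) = eta ^+ 2 * L.
  have -> : L = v ^+ 2 / 2 by rewrite vv; field.
  by rewrite /al; field.
rewrite expRB.
have q1 : Num.sqrt (4 * pi * L) <= 4 * pi * L.
  have pL : 1 <= 4 * pi * L.
    by have := ler_pM (ler01 : 0 <= 1 :> R) ler01 (_ : 1 <= 4 * pi) L1; rewrite mulr1; apply; have := @pi_ge2 R; lra.
  rewrite -[leRHS]ger0_norm ?(le_trans _ pL)// -sqrtr_sqr ler_sqrt; last by rewrite exprn_ge0// (le_trans _ pL).
  by rewrite expr2 ler_peMl// (le_trans _ pL).
set E := expR (- y) ; set G := expR (g * L); set H := heat_const _ _.
have H0 : 0 <= H by apply: heat_const_ge0; rewrite ?exprn_gt0 ?invr_gt0 ?(ltW v_gt0).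
have HS : H * S4 <= 256 * 2000 * A * (L ^+ 7 / D).
  by apply: le_trans (ler_pM H0 S4_ge0 heat_const_bound S4_le) _; rewrite le_eqVlt; apply/orP; left; apply/eqP; ring.
have EG : 0 <= E * G by rewrite mulr_ge0 ?expR_ge0.
apply: (@le_trans _ _ ((256 * 2000 * A * (L ^+ 7 / D) * expR (eta + 2) + expR 1 / expR (eta ^+ 2 * L))
   * (4 * pi * L * E * G))).
  rewrite -[X in _ * X <= _]mulrA -[X in _ <= _ * X]mulrA; apply: ler_pM.
  - apply: addr_ge0; first by apply: mulr_ge0; [exact: mulr_ge0|exact: expR_ge0].
    by rewrite divr_ge0 ?expR_ge0.
  - by rewrite mulr_ge0 ?sqrtr_ge0.
  - by rewrite lerD2r ler_wpM2r ?expR_ge0.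
  - by rewrite ler_wpM2r.
rewrite le_eqVlt; apply/orP; left; apply/eqP; ring.
Qed.

End tail_error_bound.

(** * Variance of the statistic against that of its projection *)

Section variance_ratio.
Context {R : realType}.
Variables (sig2 s2 D N : R).
Hypotheses (D_gt0 : 0 < D) (N_gt0 : 0 < N).
Let tau : R := Num.sqrt N / D.
Hypothesis s2_ge : D ^+ 3 / (1024 * 12) <= s2.
Hypothesis close : `|sig2 - s2| <= tau * s2 + (1 + tau^-1) * (51 * (N * D)).
Hypothesis tau_le1 : tau <= 1.

(** The [1] is the Young parameter [tau] itself; the rest is the remainder bound [51 * N * D]
    measured against [D ^+ 3 / (1024 * 12)], with [tau ^+ 2 + tau <= 2 * tau]. *)
Definition ratio_const : R := 1 + 2 * 51 * (1024 * 12).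

Let tau_gt0 : 0 < tau.
Proof. by rewrite divr_gt0// sqrtr_gt0. Qed.

Let s2_gt0 : 0 < s2.
Proof. by apply: lt_le_trans s2_ge; apply: divr_gt0; [exact: exprn_gt0|lra]. Qed.

Lemma variance_close : `|sig2 - s2| <= ratio_const * tau * s2.
Proof.
apply: le_trans close _.
have -> : (1 + tau^-1) * (51 * (N * D)) = 51 * (tau ^+ 2 + tau) * D ^+ 3.
  have -> : N = tau ^+ 2 * D ^+ 2.
    by rewrite /tau exprMn sqr_sqrtr ?(ltW N_gt0)// exprVn divfK// expf_neq0// gt_eqF.
  by field; rewrite gt_eqF.
have t2 : tau ^+ 2 + tau <= 2 * tau by have := ler_wpM2l (ltW tau_gt0) tau_le1; lra.
have D3 : D ^+ 3 <= 1024 * 12 * s2 by have := s2_ge; lra.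
have t0 : 0 <= tau ^+ 2 + tau by rewrite addr_ge0 ?sqr_ge0// ltW.
have := ler_pM t0 (exprn_ge0 3 (ltW D_gt0)) t2 D3.
by rewrite /ratio_const; lra.
Qed.

Hypothesis tau_small : ratio_const * tau <= 2^-1.

Lemma variance_ge : s2 / 2 <= sig2.
Proof.
have := variance_close; rewrite ler_norml => /andP[h _].
by have := ler_wpM2r (ltW s2_gt0) tau_small; lra.
Qed.

Lemma variance_ratio_close : `|s2 / sig2 - 1| <= 2 * ratio_const * tau.
Proof.
have g := variance_ge; have sg : 0 < sig2 by have := s2_gt0; lra.
have -> : s2 / sig2 - 1 = (s2 - sig2) / sig2 by field; rewrite gt_eqF.
rewrite normrM (gtr0_norm (_ : 0 < sig2^-1)) ?invr_gt0// ler_pdivrMr// distrC.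
apply: le_trans variance_close _.
have c0 : 0 <= ratio_const * tau by apply: mulr_ge0 (ltW tau_gt0); rewrite /ratio_const; lra.
by have := ler_wpM2l c0 g; lra.
Qed.

End variance_ratio.

(** * The tail bounds with all parameters chosen *)

Section Xinv_tail_bounds.
Context {R : realType} {dT : measure_display} {T : measurableType dT}.
Context {P : probability T R} {n : nat} (Z : 'I_n -> {RV P >-> R}).
Variables (W : weyl_family) (d : nat).
Hypothesis indZ : mutually_independent Z.
Hypothesis lawZ : forall i, same_law (distribution P (Z i)) (uniform_prob (Zlow_lt1 W)).
Hypotheses (d_ge8 : (8 <= d)%N) (d_le : (d <= 2 * n)%N).
Variables (L eta x : R).
Hypotheses (L_ge1 : 1 <= L) (eta_gt0 : 0 < eta).

Let D : R := d%:R.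
Let N : R := n%:R.
Let tau : R := Num.sqrt N / D.
Let v : R := Num.sqrt (2 * L).
Let al : R := v^-1.
Let s2 : R := (\sum_(i < n) coef W d i ^+ 2) / 12.
Let Y := Xinv W d Z.
Let sig2 : R := fine 'V_P[Y].
Let sigma : R := Num.sqrt sig2.

(** From [coef ^+ 2 <= (7 D) ^+ 2] divided by the lower bound [D ^+ 3 / (1024 * 24)] on the
    variance; the [24] is [12] times the factor [2] of [variance_ge]. *)
Definition coef_const : R := 49 * (1024 * 24).

Let coef_const_ge0 : 0 <= coef_const.
Proof. by rewrite /coef_const; lra. Qed.

Hypotheses (tau_le1 : tau <= 1) (tau_small : ratio_const * tau <= 2^-1).
Hypotheses (al_eta : al <= eta) (al2_eta : al ^+ 2 <= eta).
Hypothesis L1D : 2 * L * (coef_const / D) <= 1.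
Hypothesis L2D : (2 * L) ^+ 2 * (24 * coef_const / D) <= 1.

Let d_gt0 : (0 < d)%N. Proof. exact: leq_trans d_ge8. Qed.
Let D_gt0 : 0 < D. Proof. by rewrite ltr0n. Qed.
Let N_gt0 : 0 < N.
Proof. by rewrite ltr0n -(ltn_pmul2l (ltn0Sn 1)) muln0 (leq_trans _ d_le). Qed.

Let v_gt0 : 0 < v.
Proof. by rewrite sqrtr_gt0; have := L_ge1; lra. Qed.

Let vv : v ^+ 2 = 2 * L.
Proof. by rewrite sqr_sqrtr//; have := L_ge1; lra. Qed.

Let tau_gt0 : 0 < tau.
Proof. by rewrite divr_gt0// sqrtr_gt0. Qed.

Let s2_ge : D ^+ 3 / (1024 * 12) <= s2.
Proof. by have := sum_coef_ge (R := R) W d_gt0 d_le d_ge8; rewrite /s2 -/D; lra. Qed.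

Let close := Xinv_var_close indZ lawZ d_gt0 d_le tau_gt0.

Let sig2_ge : s2 / 2 <= sig2.
Proof. exact: (@variance_ge _ _ _ D N). Qed.

Let sig2_geD : D ^+ 3 / (1024 * 24) <= sig2.
Proof. by have := sig2_ge; have := s2_ge; lra. Qed.

Let sig2_gt0 : 0 < sig2.
Proof. by apply: lt_le_trans sig2_geD; apply: divr_gt0; [exact: exprn_gt0|lra]. Qed.

Let sigma_gt0 : 0 < sigma. Proof. by rewrite sqrtr_gt0. Qed.

Let sigma2 : sigma ^+ 2 = sig2. Proof. by rewrite sqr_sqrtr// ltW. Qed.

Let vr : R := s2 / sig2.

Let vrE : vr = (\sum_(i < n) (coef W d i / sigma) ^+ 2) / 12.
Proof.
rewrite /vr /s2 mulrAC; congr (_ / _); rewrite mulr_suml; apply: eq_bigr => i _.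
by rewrite exprMn exprVn sigma2.
Qed.

Let vr_close : `|vr - 1| <= 2 * ratio_const * tau.
Proof. exact: variance_ratio_close. Qed.

Let vr_le2 : vr <= 2.
Proof. by have := vr_close; rewrite ler_norml => /andP[_]; have := tau_small; lra. Qed.

Let coef2_le (i : 'I_n) : (coef W d i / sigma) ^+ 2 <= coef_const / D.
Proof.
rewrite exprMn exprVn sigma2 ler_pdivrMr//.
have c2 : coef W d i ^+ 2 <= 49 * D ^+ 2 :> R.
  have := coef_le (R := R) W d_gt0 d_le i; rewrite -/D => h.
  rewrite -real_normK ?num_real//; have -> : 49 * D ^+ 2 = (7 * D) ^+ 2 by ring.
  by rewrite lerXn2r ?nnegrE// mulr_ge0// ltW.
apply: le_trans c2 _; have e : 49 * D ^+ 2 = coef_const / D * (D ^+ 3 / (1024 * 24)).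
  by rewrite /coef_const; field; rewrite gt_eqF.
by rewrite e; apply: ler_wpM2l => //; exact: divr_ge0 (ltW D_gt0).
Qed.

Let S4 : R := \sum_(i < n) (coef W d i / sigma) ^+ 4.

Let S4_ge0 : 0 <= S4.
Proof. by rewrite sumr_ge0// => i _; rewrite exprn_even_ge0. Qed.

(** The largest squared weight times the sum of squares, which is [12 * vr <= 24]. *)
Let S4_le : S4 <= 24 * coef_const / D.
Proof.
have h : S4 <= coef_const / D * (12 * vr).
  rewrite vrE [12 * _]mulrC divfK ?pnatr_eq0// mulr_sumr; apply: ler_sum => i _.
  by rewrite (exprM _ 2 2) expr2 ler_wpM2r ?sqr_ge0.
apply: le_trans h _.
have c0 : 0 <= coef_const / D by apply: divr_ge0 (ltW D_gt0).
by have := ler_wpM2l c0 vr_le2; rewrite mulrAC; lra.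
Qed.

Let al_gt0 : 0 < al. Proof. by rewrite invr_gt0. Qed.

Let al4_gt0 : 0 < al ^+ 4. Proof. by rewrite exprn_gt0. Qed.

Let al2E : al ^+ 2 = (2 * L)^-1. Proof. by rewrite /al exprVn vv. Qed.

Let al4_le : al ^+ 4 <= 4^-1.
Proof.
have L0 := L_ge1; rewrite (exprM _ 2 2) al2E exprVn lef_pV2 ?posrE; first by rewrite expr2; nra.
  by rewrite exprn_gt0//; lra.
by lra.
Qed.

Let theta_a (i : 'I_n) : v * `|coef W d i / sigma| <= 1.
Proof.
rewrite -(@ler_pXn2r _ 2) ?nnegrE ?mulr_ge0 ?(ltW v_gt0)// expr1n exprMn vv.
rewrite real_normK ?num_real//; apply: le_trans L1D.
by rewrite ler_wpM2l ?coef2_le//; have := L_ge1; lra.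
Qed.

Let theta4_le : v ^+ 4 * S4 <= 1.
Proof.
apply: le_trans L2D; rewrite (exprM _ 2 2) vv ler_wpM2l ?sqr_ge0//.
Qed.

(* The tail estimate is used with tilt [v], smoothing variance [al ^+ 4] and
   slack [s]; the latter is [eta] on the extremal scale. *)
Let s := eta * al.

Let delta_le : Num.sqrt (al ^+ 4) <= s.
Proof.
rewrite (exprM _ 2 2) sqrtr_sqr ger0_norm ?sqr_ge0// expr2 /s.
by rewrite ler_wpM2r// ltW.
Qed.

Let theta_s : v * al ^+ 4 <= s.
Proof.
have -> : v * al ^+ 4 = al ^+ 2 * al by rewrite /al; field; rewrite gt_eqF.
by rewrite /s ler_wpM2r// ltW.
Qed.

Let thr y := v - 2^-1 * al * (ln L + ln (4 * pi)) + al * y.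

Let g := al ^+ 4 + vr - 1.

Let B y := 4 * pi * expR (- y) * expR (g * L) *
   (256 * 2000 * (24 * coef_const) * expR (eta + 2) * (L ^+ 8 / D)
    + expR 1 * (L / expR (eta ^+ 2 * L))).

Let err_le y : expR L * tail_error (fun i : 'I_n => coef W d i / sigma) v (al ^+ 4) vr s (thr y) <= B y.
Proof.
rewrite /tail_error /s /thr (_ : al ^+ 4 + vr = 1 + g); last by rewrite /g; ring.
exact: tail_error_bound.
Qed.

Let rest_le : expR L * (51 * (N * D) / (sigma * s) ^+ 2)
  <= 51 * 2 * (1024 * 24) / eta ^+ 2 * (expR L * L * N / D ^+ 2).
Proof.
have -> : (sigma * s) ^+ 2 = sig2 * eta ^+ 2 / (2 * L).
  by rewrite /s !exprMn sigma2 al2E; ring.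
have L0 : 0 < L by have := L_ge1; lra.
have h : sig2^-1 <= 1024 * 24 / D ^+ 3.
  have D3 : 0 < D ^+ 3 / (1024 * 24) by apply: divr_gt0; [exact: exprn_gt0|lra].
  by rewrite -[leRHS]invf_div lef_pV2 ?posrE.
have -> : expR L * (51 * (N * D) / (sig2 * eta ^+ 2 / (2 * L)))
   = (51 * 2 * expR L * N * D * L / eta ^+ 2) * sig2^-1.
  by field; rewrite (gt_eqF L0) (gt_eqF eta_gt0) (gt_eqF sig2_gt0).
have c0 : 0 <= 51 * 2 * expR L * N * D * L / eta ^+ 2.
  by rewrite divr_ge0 ?sqr_ge0// !mulr_ge0 ?expR_ge0 ?(ltW N_gt0) ?(ltW D_gt0) ?(ltW L0).
apply: le_trans (ler_wpM2l c0 h) _.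
rewrite le_eqVlt; apply/orP; left; apply/eqP; field.
by rewrite (gt_eqF D_gt0) (gt_eqF eta_gt0).
Qed.

Let rho := 51 * 2 * (1024 * 24) / eta ^+ 2 * (expR L * L * N / D ^+ 2).

(** The deviation of the total variance from [1] is hidden behind an existential [g], so that the
    passage to the limit deals with real sequences only. *)
Lemma Xinv_tail_bounds :
  exists g : R, [/\ `|g| <= al ^+ 4 + 2 * ratio_const * tau,
   expR L * (\int[P]_t (sigma * thr x + fine 'E_P[Y] < Y t)%R%:R)
    <= expR L * (1 - Phi (thr (x - 2 * eta) / Num.sqrt (1 + g)))
       + 4 * pi * expR (- (x - eta)) * expR (g * L) *
         (256 * 2000 * (24 * coef_const) * expR (eta + 2) * (L ^+ 8 / D)
          + expR 1 * (L / expR (eta ^+ 2 * L))) + rho &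
   expR L * (1 - Phi (thr (x + 2 * eta) / Num.sqrt (1 + g)))
       - 4 * pi * expR (- (x + eta)) * expR (g * L) *
         (256 * 2000 * (24 * coef_const) * expR (eta + 2) * (L ^+ 8 / D)
          + expR 1 * (L / expR (eta ^+ 2 * L))) - rho
    <= expR L * (\int[P]_t (sigma * thr x + fine 'E_P[Y] < Y t)%R%:R)].
Proof.
exists g; rewrite (Xinv_mean d indZ lawZ).
have vr4 : al ^+ 4 + vr <= 4 by have := al4_le; have := vr_le2; lra.
have gE : al ^+ 4 + vr = 1 + g by rewrite /g; ring.
split.
- rewrite /g -addrA; apply: le_trans (ler_normD _ _) _.
  by rewrite (gtr0_norm al4_gt0) lerD2l.
- have := Xinv_tail_upper indZ lawZ d_gt0 d_le sigma_gt0 (ltW v_gt0) theta_a al4_gt0 vrE vr4 theta4_le delta_le (thr x).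
  rewrite gE (_ : thr x - 2 * s = thr (x - 2 * eta)); last by rewrite /thr /s; ring.
  rewrite (_ : thr x - s = thr (x - eta)); last by rewrite /thr /s; ring.
  move=> /(ler_wpM2l (expR_ge0 L)) h; apply: (le_trans h).
  rewrite 2!mulrDr; apply: lerD; last exact: rest_le.
  by apply: lerD => //; exact: err_le.
- have := Xinv_tail_lower indZ lawZ d_gt0 d_le sigma_gt0 (ltW v_gt0) theta_a al4_gt0 vrE vr4 theta4_le delta_le theta_s (thr x).
  rewrite gE (_ : thr x + 2 * s = thr (x + 2 * eta)); last by rewrite /thr /s; ring.
  rewrite (_ : thr x + s = thr (x + eta)); last by rewrite /thr /s; ring.
  move=> /(ler_wpM2l (expR_ge0 L)) h; apply: le_trans h.
  rewrite [leRHS]mulrBr [X in _ <= X - _]mulrBr; apply: lerB; last exact: rest_le.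
  by apply: lerB => //; exact: err_le.
Qed.

End Xinv_tail_bounds.

Lemma near_choice {R : realType} (Q : nat -> R -> Prop) :
  (\forall n \near \oo, exists g, Q n g) ->
  exists g : nat -> R, \forall n \near \oo, Q n (g n).
Proof.
move=> h; exists (fun n => xget 0 [set g | Q n g]).
by apply: filterS h => n [g Qg]; exact: (@xgetPex _ 0 [set g | Q n g] (ex_intro _ g Qg)).
Qed.

(** * Passage to the limit in the two-sided bounds *)

Section sandwich_limit.
Context {R : realType}.
Variables (L tau u w q : nat -> R) (A B C x : R).

(** The value of [beta k + alpha k * y], written in terms of [l = ln k]. *)
Definition gumbel_threshold (l y : R) : R :=
  Num.sqrt (2 * l) - 2^-1 * (Num.sqrt (2 * l))^-1 * (ln l + ln (4 * pi))
  + (Num.sqrt (2 * l))^-1 * y.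

Let main n g y := expR (L n) * (1 - Phi (gumbel_threshold (L n) y / Num.sqrt (1 + g))).
Let error eta n g y := 4 * pi * expR (- y) * expR (g * L n) *
  (A * expR (eta + 2) * u n + expR 1 * (L n / expR (eta ^+ 2 * L n))).

Hypothesis Ly : L n @[n --> \oo] --> +oo.
Hypothesis tauL : tau n * L n @[n --> \oo] --> (0 : R).
Hypothesis u0 : u n @[n --> \oo] --> (0 : R).
Hypothesis w0 : w n @[n --> \oo] --> (0 : R).

Hypothesis sandwich : forall eta, 0 < eta -> \forall n \near \oo, exists g,
  [/\ `|g| <= (Num.sqrt (2 * L n))^-1 ^+ 4 + C * tau n,
      q n <= main n g (x - 2 * eta) + error eta n g (x - eta) + B / eta ^+ 2 * w n &
      main n g (x + 2 * eta) - error eta n g (x + eta) - B / eta ^+ 2 * w n <= q n].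

Let gL0 g : (\forall n \near \oo, `|g n| <= (Num.sqrt (2 * L n))^-1 ^+ 4 + C * tau n) ->
  g n * L n @[n --> \oo] --> (0 : R).
Proof.
move=> gle; apply: (@cvg0_norm_le _ _ (fun n => 4^-1 * (L n)^-1 + C * (tau n * L n))).
  have L0 : \forall n \near \oo, 0 < L n by move/cvgryPgt : Ly.
  near=> n; have Ln : 0 < L n by near: n.
  rewrite normrM (gtr0_norm Ln) mulrA -ler_pdivlMr//.
  have -> : (4^-1 * (L n)^-1 + C * tau n * L n) / L n = (Num.sqrt (2 * L n))^-1 ^+ 4 + C * tau n.
    have -> : (Num.sqrt (2 * L n))^-1 ^+ 4 = (2 * L n)^-1 ^+ 2.
      by rewrite (exprM _ 2 2) exprVn sqr_sqrtr// mulr_ge0// ltW.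
    by field; rewrite gt_eqF.
  by near: n.
rewrite -[X in _ --> X](addr0 (0 : R)); apply: cvgD.
  rewrite -[X in _ --> X](mulr0 (4^-1 : R)); apply: cvgM; first exact: cvg_cst.
  exact: cvgV_infty.
by rewrite -[X in _ --> X](mulr0 C); apply: cvgM; first exact: cvg_cst.
Unshelve. all: by end_near. Qed.

Let error0 eta g y : 0 < eta -> g n * L n @[n --> \oo] --> (0 : R) ->
  error eta n (g n) y @[n --> \oo] --> (0 : R).
Proof.
move=> eta0 gL; have e2 : 0 < eta ^+ 2 by rewrite exprn_gt0.
have h1 : A * expR (eta + 2) * u n @[n --> \oo] --> (0 : R).
  by rewrite -[X in _ --> X](mulr0 (A * expR (eta + 2))); apply: cvgM; first exact: cvg_cst.
have h2 : expR 1 * (L n / expR (eta ^+ 2 * L n)) @[n --> \oo] --> (0 : R).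
  have My : eta ^+ 2 * L n @[n --> \oo] --> +oo.
    apply/cvgryPge => M; move/cvgryPge : Ly => /(_ (M / eta ^+ 2)).
    by apply: filterS => n; rewrite ler_pdivrMr// mulrC.
  have := exprn_div_expR_cvg0 1 My => h.
  rewrite -[X in _ --> X](mulr0 (expR 1 / eta ^+ 2)).
  rewrite (_ : (fun n => _) = fun n => expR 1 / eta ^+ 2 * ((eta ^+ 2 * L n) ^+ 1 / expR (eta ^+ 2 * L n))).
    by apply: cvgM h; exact: cvg_cst.
  by apply/funext => n; rewrite expr1; field; rewrite !gt_eqF ?expR_gt0.
have h3 : expR (g n * L n) @[n --> \oo] --> expR (0 : R).
  exact: (cvg_comp (fun n => g n * L n) _ gL (@continuous_expR R 0)).
rewrite -[X in _ --> X](mulr0 (4 * pi * expR (- y) * expR 0)); apply: cvgM.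
  by apply: cvgM => //; exact: cvg_cst.
by rewrite -[X in _ --> X](addr0 (0 : R)); exact: cvgD.
Qed.

Lemma sandwich_limit : q n @[n --> \oo] --> expR (- x).
Proof.
have Bw eta : B / eta ^+ 2 * w n @[n --> \oo] --> (0 : R).
  by rewrite -[X in _ --> X](mulr0 (B / eta ^+ 2)); apply: cvgM => //; exact: cvg_cst.
have bounds eta e : 0 < eta -> 0 < e -> \forall n \near \oo,
    expR (- (x + 2 * eta)) - e < q n < expR (- (x - 2 * eta)) + e.
  move=> eta0 e0; have [g gP] := near_choice (sandwich eta0).
  have gL : g n * L n @[n --> \oo] --> (0 : R) by apply: gL0; apply: filterS gP => n [].
  have up : main n (g n) (x - 2 * eta) + error eta n (g n) (x - eta) + B / eta ^+ 2 * w n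
      @[n --> \oo] --> expR (- (x - 2 * eta)) + 0 + 0.
    by apply: cvgD (Bw eta); apply: cvgD; [exact: gaussian_tail_limit|exact: error0].
  have lo : main n (g n) (x + 2 * eta) - error eta n (g n) (x + eta) - B / eta ^+ 2 * w n
      @[n --> \oo] --> expR (- (x + 2 * eta)) - 0 - 0.
    by apply: cvgB (Bw eta); apply: cvgB; [exact: gaussian_tail_limit|exact: error0].
  move/cvgrPdist_lt : up => /(_ e e0) up; move/cvgrPdist_lt : lo => /(_ e e0) lo.
  near=> n.
  have [_ qu ql] : [/\ `|g n| <= (Num.sqrt (2 * L n))^-1 ^+ 4 + C * tau n,
      q n <= main n (g n) (x - 2 * eta) + error eta n (g n) (x - eta) + B / eta ^+ 2 * w n &
      main n (g n) (x + 2 * eta) - error eta n (g n) (x + eta) - B / eta ^+ 2 * w n <= q n].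
    by near: n.
  have : `|expR (- (x - 2 * eta)) + 0 + 0 - (main n (g n) (x - 2 * eta) + error eta n (g n) (x - eta) + B / eta ^+ 2 * w n)| < e.
    by near: n.
  have : `|expR (- (x + 2 * eta)) - 0 - 0 - (main n (g n) (x + 2 * eta) - error eta n (g n) (x + eta) - B / eta ^+ 2 * w n)| < e.
    by near: n.
  rewrite !ltr_norml => /andP[l1 l2] /andP[u1 u2].
  move: l1 l2 u1 u2 qu ql.
  set m1 := main _ _ _; set m2 := main _ _ _; set r1 := error _ _ _ _; set r2 := error _ _ _ _.
  by set z := _ * w n => ? ? ? ? ? ?; apply/andP; split; lra.
apply/cvgrPdist_lt => e e0; have E0 := expR_gt0 (- x).
(* [eta] is tuned so that [expR (2 * eta) = 1 + de]: the upper limit is then exactly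
   [expR (- x) + e / 2], and the other half of [e] goes to the convergence for fixed [eta]. *)
pose de := e / 2 / expR (- x); have de0 : 0 < de by rewrite !divr_gt0.
pose eta := ln (1 + de) / 2.
have eta0 : 0 < eta by rewrite divr_gt0// ln_gt0//; lra.
have eE : expR (2 * eta) = 1 + de by rewrite /eta [2 * _]mulrC divfK ?pnatr_eq0// lnK// posrE; lra.
have e2 : 0 < e / 2 by rewrite divr_gt0.
apply: filterS (bounds eta (e / 2) eta0 e2) => n.
have dE : expR (- x) * de = e / 2 by rewrite /de mulrC divfK// gt_eqF.
have -> : expR (- (x - 2 * eta)) = expR (- x) + e / 2.
  by rewrite opprB expRD eE mulrDl mul1r [de * _]mulrC dE.
have : expR (- x) - e / 2 <= expR (- (x + 2 * eta)).
  rewrite opprD expRD (expRN (2 * eta)) eE ler_pdivlMr; last by lra.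
  by rewrite mulrDr mulr1 mulrBl dE; have := mulr_gt0 e2 de0; lra.
by rewrite ltr_norml; set E := expR _; set E' := expR _ => h /andP[h1 h2]; apply/andP; split; lra.
Unshelve. all: by end_near. Qed.

End sandwich_limit.

(** * The law of the row maximum *)

Section maximum_limit.
Context {R : realType}.

(** Squeezes [1 - p] between [expR (- p / (1 - p))] and [expR (- p)]. As [k] tends to infinity, [p]
    tends to [0] and both [k]-th powers have the same limit. *)
Lemma one_sub_exprn_limit (k : nat -> nat) (p : nat -> R) (c : R) :
  k @ \oo --> \oo -> (\forall n \near \oo, 0 <= p n) ->
  (k n)%:R * p n @[n --> \oo] --> c ->
  (1 - p n) ^+ k n @[n --> \oo] --> expR (- c).
Proof.
move=> ky p0 kp.
have kR : (k n)%:R @[n --> \oo] --> (+oo : set_system R).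
  exact: (cvg_comp _ _ ky (@cvgr_idn R)).
have pc : p n @[n --> \oo] --> (0 : R).
  have h : (k n)%:R^-1 * ((k n)%:R * p n) @[n --> \oo] --> 0 * c.
    by apply: cvgM => //; exact: cvgV_infty.
  rewrite mul0r in h; apply: cvg_trans h; apply: near_eq_cvg.
  move/cvgryPgt : kR => /(_ 0); apply: filterS => n k0.
  by rewrite mulKf// gt_eqF.
have up : expR (- ((k n)%:R * p n)) @[n --> \oo] --> expR (- c).
  by apply: (cvg_comp _ _ (cvgN kp) (@continuous_expR R (- c))).
have lo : expR (- ((k n)%:R * p n * (1 - p n)^-1)) @[n --> \oo] --> expR (- c).
  suff h : (k n)%:R * p n * (1 - p n)^-1 @[n --> \oo] --> c.
    exact: (cvg_comp (fun n => - ((k n)%:R * p n * (1 - p n)^-1)) _ (cvgN h) (@continuous_expR R (- c))).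
  rewrite -[X in _ --> X]mulr1; apply: cvgM => //.
  have h1 : 1 - p n @[n --> \oo] --> (1 - 0 : R) by apply: cvgB => //; exact: cvg_cst.
  rewrite subr0 in h1.
  by rewrite -[X in _ --> X]invr1; apply: cvgV => //; exact: oner_neq0.
apply: (squeeze_cvgr _ lo up).
move/cvgrPdist_lt : pc => /(_ 1 ltr01); apply: filterS2 p0 => n pn0.
rewrite sub0r normrN ger0_norm// => p1; have p1' : 0 < 1 - p n by lra.
have expE a : expR (- a) ^+ k n = expR (- ((k n)%:R * a)) :> R.
  by rewrite -expRM_natl mulrN.
rewrite -mulrA -!expE; apply/andP; split; apply: lerXn2r; rewrite ?nnegrE ?expR_ge0 ?(ltW p1')//.
  rewrite expRN -[leRHS]invrK lef_pV2 ?posrE ?expR_gt0 ?invr_gt0//.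
  apply: le_trans (expR_ge1Dx _); rewrite le_eqVlt; apply/orP; left; apply/eqP.
  by field; rewrite gt_eqF.
exact: expR_ge1Dx.
Qed.

Lemma row_max_le {T : Type} (k : nat) (X : 'I_k -> T -> R) (y : R) (t : T) :
  (row_max X t <= y%:E)%E = [forall j, X j t <= y].
Proof.
rewrite /row_max; apply/idP/forallP => [h j|h].
  by rewrite -lee_fin (le_trans _ h)//; exact: (le_bigmax -oo%E (fun j => (X j t)%:E)).
by apply: bigmax_le => [|j _]; rewrite ?leNye// lee_fin.
Qed.

Lemma row_max_cdf {dT : measure_display} {T : measurableType dT} {P : probability T R}
    (mu : probability R R) (k : nat) (X : 'I_k -> {RV P >-> R}) (y : R) :
  iid_with_law X mu ->
  P [set t | (row_max X t <= y%:E)%E] = (fine (mu `]-oo, y]%classic) ^+ k)%:E.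
Proof.
move=> [indX lawX].
have -> : [set t | (row_max X t <= y%:E)%E] =
    \bigcap_(i in [set` [set: 'I_k]%SET]) (X i @^-1` `]-oo, y]).
  apply/seteqP; split=> t /=; rewrite row_max_le.
    by move/forallP => h i _ /=; rewrite in_itv/=.
  by move=> h; apply/forallP => i; have := h i (finset.in_setT i); rewrite /= in_itv.
rewrite (indX [set: 'I_k]%SET (fun=> `]-oo, y]%classic)); last by move=> i; exact: measurable_itv.
have PE i : P (X i @^-1` `]-oo, y]%classic) = (fine (mu `]-oo, y]%classic))%:E.
  transitivity (distribution P (X i) `]-oo, y]%classic) => //.
  have mI : measurable (`]-oo, y]%classic : set R) by exact: measurable_itv.
  by rewrite lawX// fineK//; exact: fin_num_measure.
under eq_bigr do rewrite PE.
by rewrite prodEFin prodr_const cardsT card_ord.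
Qed.

Lemma distribution_le {dT : measure_display} {T : measurableType dT} {P : probability T R}
    (Y : {RV P >-> R}) (y : R) :
  fine (distribution P Y `]-oo, y]%classic) = 1 - \int[P]_t (y < Y t)%R%:R.
Proof.
have mA : measurable (`]y, +oo[%classic : set R) by exact: measurable_itv.
have -> : `]-oo, y]%classic = ~` `]y, +oo[%classic :> set R.
  by apply/seteqP; split=> z /=; rewrite !in_itv/= andbT leNgt => /negP.
rewrite probability_setC// fineB//; last by rewrite fin_num_measure.
have mYA : measurable (Y @^-1` `]y, +oo[%classic).
  by rewrite -[X in measurable X]setTI; exact: measurable_funPT.
rewrite /= ; congr (_ - _); rewrite /distribution /pushforward -(Ex_indic _ mYA).
apply: eq_Rintegral => t _; rewrite indicE.
rewrite (_ : (t \in _) = (y < Y t)%R)//.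
by apply/idP/idP; rewrite inE /= in_itv/= andbT.
Qed.

End maximum_limit.

Lemma littleo_div_cvg0 {R : realType} (f e : nat -> R) :
  (f : nat -> R^o) =o_\oo (e : nat -> R^o) -> f n / e n @[n --> \oo] --> (0 : R).
Proof.
move=> /eqoP fe; apply/cvgrPdist_le => eps eps0.
apply: filterS (fe eps eps0) => n; rewrite sub0r normrN normrM normfV /= => h.
(* Division by zero returns zero, so indices with [e n = 0] satisfy the bound. *)
have [->|e0] := eqVneq (e n) 0; first by rewrite normr0 invr0 mulr0 ltW.
by rewrite ler_pdivrMr// normr_gt0.
Qed.

(** All smallness conditions on the weights follow from the single limit [L ^+ 8 / D -> 0]; the [96]
    is [4 * 24] from the fourth-power condition. *)
Lemma exprn_ratio_le {R : realFieldType} (l D c : R) : 1 <= l -> 0 < D -> 0 < c ->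
  l ^+ 8 / D < 8^-1 -> l ^+ 8 / D < (96 * c)^-1 ->
  [/\ 8 <= D, 2 * l * (c / D) <= 1 & (2 * l) ^+ 2 * (24 * c / D) <= 1].
Proof.
move=> l1 D0 c0 h8 hc; have lj j : (j <= 8)%N -> 96 * c * (l ^+ j / D) <= 1.
  move=> j8; rewrite -ler_pdivlMl ?mulr_gt0// mulr1; apply: le_trans (ltW hc).
  by rewrite ler_pM2r ?invr_gt0// ler_weXn2l.
have cl : 0 <= c * (l / D) by rewrite mulr_ge0 ?divr_ge0 ?(ltW c0) ?(ltW D0)// (le_trans ler01 l1).
split.
- by move: h8; rewrite ltr_pdivrMr//; have := exprn_ege1 8 l1; lra.
- have -> : 2 * l * (c / D) = 2 * (c * (l / D)) by ring.
  have := lj 1 isT; rewrite expr1 -mulrA; set a := c * _ in cl *; lra.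
- by have -> : (2 * l) ^+ 2 * (24 * c / D) = 96 * c * (l ^+ 2 / D); [ring|exact: lj].
Qed.

(** * Consequences of the growth condition, and the theorem *)

Section rates.
Context {R : realType}.
Variables (L D N : nat -> R).
Hypothesis Ly : L n @[n --> \oo] --> +oo.
Hypothesis D_gt0 : \forall n \near \oo, 0 < D n.
Hypothesis D_le : \forall n \near \oo, D n <= 2 * N n.
Hypothesis rate : expR (L n) * L n * N n / D n ^+ 2 @[n --> \oo] --> (0 : R).

(** The square is [N L ^+ 2 / D ^+ 2], and [L <= expR L] bounds it by the rate. This makes the error
    in the variance invisible at the extremal scale. *)
Lemma sqrt_div_mul_cvg0 : Num.sqrt (N n) / D n * L n @[n --> \oo] --> (0 : R).
Proof.
apply: (@cvg0_norm_le _ _ (fun n => Num.sqrt (expR (L n) * L n * N n / D n ^+ 2))); last first.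
  by rewrite -[X in _ --> X](@sqrtr0 R); apply: (cvg_comp _ _ rate (@sqrt_continuous R 0)).
have L1 : \forall n \near \oo, 0 < L n by move/cvgryPgt : Ly.
near=> n; have Ln : 0 < L n by near: n.
have Dn : 0 < D n by near: n.
have DN : D n <= 2 * N n by near: n.
have Nn : 0 <= N n by lra.
rewrite ger0_norm; last by rewrite mulr_ge0 ?(ltW Ln)// divr_ge0 ?sqrtr_ge0 ?(ltW Dn).
have -> : Num.sqrt (N n) / D n * L n = Num.sqrt (N n * L n ^+ 2 / D n ^+ 2).
  have -> : N n * L n ^+ 2 / D n ^+ 2 = N n * (L n / D n) ^+ 2 by field; rewrite gt_eqF.
  by rewrite sqrtrM// sqrtr_sqr ger0_norm ?divr_ge0 ?ltW// mulrAC mulrA.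
apply: ler_wsqrtr; rewrite ler_pM2r ?invr_gt0 ?exprn_gt0// [leRHS]mulrC ler_wpM2l//.
rewrite expr2 ler_pM2r//; apply: le_trans (expR_ge1Dx _); lra.
Unshelve. all: by end_near. Qed.

(** By [D <= 2 N] one has [1 / D <= 2 N / D ^+ 2], so the quotient is at most the rate times
    [2 * L ^+ 7 / expR L]. *)
Lemma exprn_div_cvg0 : L n ^+ 8 / D n @[n --> \oo] --> (0 : R).
Proof.
apply: (@cvg0_norm_le _ _ (fun n => 2 * (L n ^+ 7 / expR (L n)) * (expR (L n) * L n * N n / D n ^+ 2))); last first.
  rewrite -[X in _ --> X](mulr0 (2 * 0 : R)); apply: cvgM => //.
  by apply: cvgM; [exact: cvg_cst|exact: exprn_div_expR_cvg0].
have L1 : \forall n \near \oo, 0 < L n by move/cvgryPgt : Ly.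
near=> n; have Ln : 0 < L n by near: n.
have Dn : 0 < D n by near: n.
rewrite ger0_norm ?divr_ge0 ?exprn_ge0 ?(ltW Ln) ?(ltW Dn)//.
have -> : 2 * (L n ^+ 7 / expR (L n)) * (expR (L n) * L n * N n / D n ^+ 2)
    = L n ^+ 8 / D n * (2 * N n / D n).
  by field; rewrite (gt_eqF Dn) (gt_eqF (expR_gt0 _)).
rewrite ler_peMr ?divr_ge0 ?exprn_ge0 ?(ltW Ln) ?(ltW Dn)//.
by rewrite ler_pdivlMr// mul1r; near: n.
Unshelve. all: by end_near. Qed.

End rates.

Unset Implicit Arguments.

Section inversion_tail_limit.
Context {R : realType}.
Variables (W : nat -> weyl_family) (d k : nat -> nat).
Variables (dZ : nat -> measure_display) (TZ : forall n, measurableType (dZ n)).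
Variables (PZ : forall n, probability (TZ n) R) (Z : forall n, 'I_n -> {RV (PZ n) >-> R}).
Hypothesis d_bounds : forall n, (2 <= n)%N -> (1 <= d n <= dmax (W n) n - 1)%N.
Hypothesis d_large : (fun n => Num.sqrt n%:R : R^o) =o_\oo (fun n => (d n)%:R : R^o).
Hypothesis k_infty : k @ \oo --> \oo.
Hypothesis k_small : (fun n => (k n)%:R * ln (k n)%:R : R^o) =o_\oo
  (fun n => (d n)%:R ^+ 2 / n%:R : R^o).
Hypothesis iidZ : forall n, (2 <= n)%N -> iid_with_law (Z n) (uniform_prob (Zlow_lt1 (W n))).

Let Y n := Xinv (W n) (d n) (Z n).
Let sigma n : R := Num.sqrt (fine 'V_(PZ n)[Y n]).
Let L n : R := ln (k n)%:R.
Let tau n : R := Num.sqrt n%:R / (d n)%:R.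

Let kR : (k n)%:R @[n --> \oo] --> (+oo : set_system R).
Proof. exact: (cvg_comp _ _ k_infty (@cvgr_idn R)). Qed.

Let Ly : L n @[n --> \oo] --> +oo. Proof. exact: ln_cvg_infty. Qed.

Let expL : \forall n \near \oo, expR (L n) = (k n)%:R.
Proof. by move/cvgryPgt : kR => /(_ 0); apply: filterS => n k0; rewrite lnK. Qed.

Let n_ge2 : \forall n \near \oo, (2 <= n)%N. Proof. exact: nbhs_infty_ge. Qed.

Let d_le n : (2 <= n)%N -> (d n <= 2 * n)%N.
Proof.
by move=> n2; have /andP[_] := d_bounds _ n2; rewrite /dmax; case: (W n); lia.
Qed.

Let D_gt0 : \forall n \near \oo, (0 : R) < (d n)%:R.
Proof. by apply: filterS n_ge2 => n n2; have /andP[h _] := d_bounds _ n2; rewrite ltr0n. Qed.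

Let D_le : \forall n \near \oo, (d n)%:R <= 2 * n%:R :> R.
Proof. by apply: filterS n_ge2 => n /(d_le _); rewrite -natrM ler_nat. Qed.

Let tau0 : tau n @[n --> \oo] --> (0 : R).
Proof. exact: littleo_div_cvg0. Qed.

Let rate : expR (L n) * L n * n%:R / (d n)%:R ^+ 2 @[n --> \oo] --> (0 : R).
Proof.
apply: cvg_trans (littleo_div_cvg0 k_small); apply: near_eq_cvg.
by apply: filterS expL => n ->; rewrite invf_div mulrA.
Qed.

Let LD0 : L n ^+ 8 / (d n)%:R @[n --> \oo] --> (0 : R).
Proof. exact: exprn_div_cvg0 Ly D_gt0 D_le rate. Qed.

Lemma inversion_tail_limit (x : R) :
  (k n)%:R * (\int[PZ n]_t (sigma n * alpha (k n) * x
     + (sigma n * beta (k n) + fine 'E_(PZ n)[Y n]) < Y n t)%R%:R)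
  @[n --> \oo] --> expR (- x).
Proof.
apply: (@sandwich_limit R L tau (fun n => L n ^+ 8 / (d n)%:R)
  (fun n => expR (L n) * L n * n%:R / (d n)%:R ^+ 2) _
  (256 * 2000 * (24 * coef_const)) (51 * 2 * (1024 * 24)) (2 * ratio_const)) => //.
  exact: sqrt_div_mul_cvg0 Ly D_gt0 D_le rate.
move=> eta eta0.
have c0 : 0 < coef_const :> R by rewrite /coef_const; lra.
have r0 : 0 < ratio_const :> R by rewrite /ratio_const; lra.
have near_lt (h : nat -> R) (e : R) : 0 < e -> h n @[n --> \oo] --> (0 : R) ->
    \forall n \near \oo, h n < e.
  move=> e0 /cvgrPdist_lt/(_ e e0); apply: filterS => n; rewrite sub0r normrN.
  exact: le_lt_trans (ler_norm _).
have L1 : \forall n \near \oo, 1 <= L n by move/cvgryPge : Ly.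
have al0 : (2 * L n)^-1 @[n --> \oo] --> (0 : R).
  rewrite (_ : (fun n => _) = (fun n => 2^-1 * (L n)^-1)); last by apply/funext => n; rewrite invfM.
  rewrite -[X in _ --> X](mulr0 (2^-1 : R)).
  by apply: cvgM; [exact: cvg_cst|exact: cvgV_infty].
(* With [eta] fixed, every condition of [Xinv_tail_bounds] holds eventually, because [tau], [1 / L]
   and [L ^+ 8 / d] all tend to [0]. *)
near=> n.
have n2 : (2 <= n)%N by near: n.
have Ln : 1 <= L n by near: n.
have Dn : (0 : R) < (d n)%:R by near: n.
have t1 : tau n < 1 by near: n; exact: near_lt.
have t2 : tau n < 2^-1 / ratio_const.
  by near: n; apply: near_lt => //; apply: divr_gt0.
have a1 : (2 * L n)^-1 < eta by near: n; exact: near_lt.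
have a2 : (2 * L n)^-1 < eta ^+ 2 by near: n; apply: near_lt => //; exact: exprn_gt0.
have l8 : L n ^+ 8 / (d n)%:R < 8^-1 by near: n; apply: near_lt => //; rewrite invr_gt0.
have lc : L n ^+ 8 / (d n)%:R < (96 * coef_const)^-1.
  by near: n; apply: near_lt => //; rewrite invr_gt0 mulr_gt0.
have eL : expR (L n) = (k n)%:R by near: n.
have vv : Num.sqrt (2 * L n) ^+ 2 = 2 * L n by rewrite sqr_sqrtr// mulr_ge0// (le_trans ler01 Ln).
have [D8 c1 c2] := exprn_ratio_le Ln Dn c0 l8 lc.
have d8 : (8 <= d n)%N by rewrite -(ler_nat R).
have ts : ratio_const * tau n <= 2^-1.
  by rewrite mulrC -ler_pdivlMr// ltW.
have v0 : 0 < Num.sqrt (2 * L n) by rewrite sqrtr_gt0 mulr_gt0// (lt_le_trans ltr01 Ln).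
have al_eta : (Num.sqrt (2 * L n))^-1 <= eta.
  rewrite -(@ler_pXn2r _ 2) ?nnegrE ?invr_ge0 ?(ltW v0) ?(ltW eta0)//.
  by rewrite exprVn vv ltW.
have al2_eta : (Num.sqrt (2 * L n))^-1 ^+ 2 <= eta by rewrite exprVn vv ltW.
have [g [g1 g2 g3]] := Xinv_tail_bounds (iidZ _ n2).1 (iidZ _ n2).2 d8 (d_le _ n2) x Ln eta0
  (ltW t1) ts al_eta al2_eta c1 c2.
exists g; rewrite -eL; have -> : sigma n * alpha (k n) * x + (sigma n * beta (k n) + fine 'E_(PZ n)[Y n])
    = sigma n * gumbel_threshold (L n) x + fine 'E_(PZ n)[Y n].
  rewrite addrA; congr (_ + _); rewrite /gumbel_threshold /beta /alpha -/(L n) invrK.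
  by rewrite -mulrA -mulrDr addrC.
by split.
Unshelve. all: by end_near. Qed.

End inversion_tail_limit.

Theorem theorem4p3 (R : realType) (W : nat -> weyl_family) (d k : nat -> nat)
  (* the variables Z_1, ..., Z_n defining X_inv on W_n *)
  (dZ : nat -> measure_display) (TZ : forall n, measurableType (dZ n))
  (PZ : forall n, probability (TZ n) R)
  (Z : forall n, 'I_n -> {RV (PZ n) >-> R})
  (* the rows X_n1, ..., X_nk_n *)
  (dX : nat -> measure_display) (TX : forall n, measurableType (dX n))
  (PX : forall n, probability (TX n) R)
  (X : forall n, 'I_(k n) -> {RV (PX n) >-> R}) :
  (forall n, (2 <= n)%N -> (1 <= d n <= dmax (W n) n - 1)%N) ->
  (fun n => Num.sqrt n%:R : R^o) =o_\oo (fun n => (d n)%:R : R^o) ->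
  (forall n, (2 <= n)%N -> (0 < k n)%N) ->
  k @ \oo --> \oo ->
  (fun n => (k n)%:R * ln (k n)%:R : R^o) =o_\oo
    (fun n => (d n)%:R ^+ 2 / n%:R : R^o) ->
  (forall n, (2 <= n)%N ->
     iid_with_law (Z n) (uniform_prob (Zlow_lt1 (W n)))) ->
  (forall n, (2 <= n)%N ->
     iid_with_law (X n) (distribution (PZ n) (Xinv (W n) (d n) (Z n)))) ->
  let Y n := Xinv (W n) (d n) (Z n) in
  let sigma n : R := Num.sqrt (fine 'V_(PZ n)[Y n]) in
  let a n := sigma n * alpha (k n) in
  let b n := sigma n * beta (k n) + fine 'E_(PZ n)[Y n] in
  forall x : R,
    PX n [set t | (row_max (X n) t <= (a n * x + b n)%:E)%E] @[n --> \oo]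
      --> (expR (- expR (- x)))%:E.
Proof.
move=> d_bounds d_large k_gt0 k_infty k_small iidZ iidX Y sigma a b x.
pose p n : R := \int[PZ n]_t (a n * x + b n < Y n t)%R%:R.
have kp : (k n)%:R * p n @[n --> \oo] --> expR (- x).
  exact: inversion_tail_limit.
have p0 : \forall n \near \oo, 0 <= p n by apply: nearW => n; apply: Ex_ge0.
have h := one_sub_exprn_limit k_infty p0 kp.
have cdfE : \forall n \near \oo,
    PX n [set t | (row_max (X n) t <= (a n * x + b n)%:E)%E] = ((1 - p n) ^+ k n)%:E.
  near=> n; have n2 : (2 <= n)%N by near: n; exact: nbhs_infty_ge.
  by rewrite (row_max_cdf _ (iidX n n2)) distribution_le.
apply: cvg_EFin; first by apply: filterS cdfE => n ->.
by apply: cvg_trans h; apply: near_eq_cvg; apply: filterS cdfE => n /= ->.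
Unshelve. all: by end_near. Qed.
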